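(* Let $\|\cdot\|_{\mathcal P}$ be a norm on $\mathbb R^2$ whose closed unit ball $\mathcal P$ is a quadrilateral, let $(G,\theta)$ be a $\mathbb Z_2$-symmetric graph such that $\theta$ acts freely on the vertices and edges of $G$, and let $(G_0,\psi)$ be the gain graph for $(G,\theta)$. The following are equivalent. (i) There exist a representation $\tau:\mathbb Z_2\to\mathrm{Isom}(\mathbb R^2,\|\cdot\|_{\mathcal P})$ and a realisation $p$ such that $\mathcal G=(G,p,\theta,\tau)$ is well-positioned, $\mathcal C_2$-symmetric and $\chi_1$-symmetrically isostatic in $(\mathbb R^2,\|\cdot\|_{\mathcal P})$. (ii) $(G_0,\psi)$ is $(2,2,2)$-gain-tight. (iii) $(G_0,\psi)$ can be constructed from $K_1$ by a sequence of H1a,b moves, H2a,b moves, vertex-to-$K_4$ moves, and vertex splitting moves.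
   Context: Symmetric frameworks. $X=(\mathbb R^2,\|\cdot\|_{\mathcal P})$, $X_{\mathbb C}=\mathbb C\otimes_{\mathbb R}X$; $\mathrm{Isom}$ denotes the group of linear isometries; $\mathbb Z_2=\{1,-1\}$ and $\chi_1$ is the character with $\chi_1(-1)=-1$. A $\mathbb Z_2$-symmetric graph is $(G,\theta)$ with $G=(V,E)$ finite, simple, undirected and $\theta:\mathbb Z_2\to\mathrm{Aut}(G)$ a homomorphism acting freely on $V$; write $\gamma v,\gamma e$ for the action. A realisation is $p=(p_v)\in X^V$ with distinct components. $(G,p)$ is well-positioned if $f_G:X^V\to\mathbb R^E$, $(x_v)\mapsto(\|x_v-x_w\|_{\mathcal P})_{vw\in E}$, is differentiable at $p$. $\mathcal G=(G,p,\theta,\tau)$ is $\mathcal C_2$-symmetric if $\tau(\gamma)p_v=p_{\gamma v}$ for all $\gamma,v$ and $\tau(-1)$ is the half-turn $-I$. A rigid motion of $X$ is a family of continuous paths $\{\alpha_x:[-1,1]\to X\}_{x\in X}$ with $\alpha_x(0)=x$ and $\|\alpha_x(t)-\alpha_y(t)\|_{\mathcal P}=\|x-y\|_{\mathcal P}$ for all $x,y,t$; $\mathcal T(X)$ is the space of vector fields $\eta(x)=\alpha_x'(0)$ so obtained, and $\mathcal T(X;\mathbb C)$ the complex span of the fields $x\mapsto1\otimes\eta(x)$. Put $X_{\chi_1}=\{x\in(X_{\mathbb C})^V:x_{\gamma v}=\chi_1(\gamma)\tau(\gamma)x_v\ \forall\gamma,v\}$, $Y_{\chi_1}=\{y\in\mathbb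 C^E:y_{\gamma e}=\chi_1(\gamma)y_e\ \forall\gamma,e\}$, $\mathcal T_{\chi_1}(X)=\{\eta\in\mathcal T(X;\mathbb C):\eta(\tau(\gamma)x)=\chi_1(\gamma)\tau(\gamma)\eta(x)\ \forall\gamma,x\}$. Let $R_{\chi_1}:X_{\chi_1}\to Y_{\chi_1}$ be the restriction of the complexified $df_G(p)$ and $\rho_{\chi_1}:\mathcal T_{\chi_1}(X)\to X_{\chi_1}$, $\eta\mapsto(\eta(p_v))_v$. $\mathcal G$ is $\chi_1$-symmetrically isostatic if $\ker R_{\chi_1}=\mathrm{im}\,\rho_{\chi_1}$ and $R_{\chi_1}$ is surjective. Gain graphs. The gain graph of $(G,\theta)$ is the quotient multigraph $G_0=(V_0,E_0)$ of vertex orbits and edge orbits, where, after choosing a representative $\tilde v$ of each vertex orbit, an edge orbit $[e]$ joining $[v],[w]$ has gain the $\gamma\in\mathbb Z_2$ with $\tilde v(\gamma\tilde w)\in[e]$. Thus parallel edges have different gains and any loop has gain $-1$. $(uv,\alpha)$ denotes an edge joining $u$ and $v$ with gain $\alpha$. Changing the representative of $v$ (switching at $v$) multiplies the gains of non-loop edges at $v$ by $-1$; gain graphs related by switchings are identified throughout (one may switch at any stage of a construction). An edge set is balanced if every cycle in it (loops and pairs of parallel edges count as cycles) has product of gains $1$. $(G_0,\psi)$ is $(2,2,2)$-gain-tight if $|E_0|=2|V_0|-2$ and $|F|\le2|V(F)|-2$ for every nonempty $F\subseteq E_0$ (in general, $(k,l,m)$-gain-tight means $|E_0|=k|V_0|-m$,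 $|F|\le k|V(F)|-l$ for nonempty balanced $F$, and $|F|\le k|V(F)|-m$ for nonempty $F$), where $V(F)$ is the set of vertices incident with $F$. $K_1$ is the gain graph with one vertex and no edges. Moves (in the H-moves, gains of new edges are arbitrary unless specified, subject to parallel edges having different gains). In the H-moves a new vertex $v$ is added. H1a: $v$ is joined by one edge to each of two distinct vertices. H1b: $v$ is joined to one vertex by two parallel edges (gains $1,-1$). H2a: delete $(xy,\alpha)$, $x\ne y$; add $(xv,\beta),(yv,\gamma)$ with $\beta\gamma=\alpha$ and an edge from $v$ to a third vertex distinct from $x,y$. H2b: delete $(xy,\alpha)$, $x\neq y$; add $(xv,1),(xv,-1),(yv,\delta)$. Vertex-to-$K_4$: remove a vertex $v$ and its incident edges and add a new $K_4$ with all gains $1$; each removed edge $(xv,\gamma)$, $x\neq v$, is replaced by $(xy,\gamma)$ for some $y$ in the new $K_4$ (no loops occur in the constructions considered here). Vertex splitting: choose a vertex $v_1$, a neighbour $v_2$ of $v_1$, and a partition $N_1,N_2$ of the remaining neighbours of $v_1$; delete the edges from $v_1$ to vertices in $N_1$, add a new vertex $v_0$ joined to the vertices in $N_1$ (the edges from $v_0$ to $N_1$ replacing the deleted edges, with the same gains), and finally add two new edges $v_0v_1$ and $v_0v_2$, where $v_0v_1$ is given gain $1$ and $v_0v_2$ is given the same gain as $v_1v_2$. *)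

(* Defs.v *)
From HB Require Import structures.
From mathcomp Require Import all_boot all_order all_algebra all_fingroup.
From mathcomp Require Import complex.
From mathcomp Require Import all_classical all_reals all_analysis.

Set Implicit Arguments.
Unset Strict Implicit.
Unset Printing Implicit Defensive.

Import Order.TTheory GRing.Theory Num.Theory.
Import numFieldNormedType.Exports.

Local Open Scope ring_scope.
Local Open Scope complex_scope.

(* The group Z_2 = {1, -1} is bool with the law (+): false stands for 1 and
   true for -1. *)

(* The edge (uv, a). The end set of a loop is a singleton. As an edge is
   determined by its ends and its gain, parallel edges have different gains. *)
Definition gedge (T : finType) (u v : T) (a : bool) : {set T} * bool :=
  ([set u; v]%SET, a).

Record gain_graph := GainGraph {
  gvert :> finType;
  gedges : {set {set gvert} * bool} }.

Definition edge_support (T : finType) (F : {set {set T} * bool}) : {set T} :=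
  (\bigcup_(e in F) e.1)%SET.

(* Additive form of |E_0| = 2|V_0| - 2 and |F| <= 2|V(F)| - 2. *)
Definition gain_tight222 (G : gain_graph) : Prop :=
  (#|gedges G| + 2 = 2 * #|gvert G|)%N /\
  (forall F : {set {set G} * bool},
     F \subset gedges G -> F != finset.set0 ->
     (#|F| + 2 <= 2 * #|edge_support F|)%N).

Definition map_edge (T U : finType) (f : T -> U) (e : {set T} * bool) :
    {set U} * bool :=
  ([set f x | x in e.1]%SET, e.2).

Definition gain_iso (G H : gain_graph) : Prop :=
  exists2 f : G -> H, bijective f &
    gedges H = [set map_edge f e | e in gedges G]%SET.

Definition switch_edge (T : finType) (v : T) (e : {set T} * bool) :
    {set T} * bool :=
  (e.1, if (v \in e.1) && (#|e.1| == 2%N) then ~~ e.2 else e.2).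

Definition switch (G : gain_graph) (v : G) : gain_graph :=
  @GainGraph G [set switch_edge v e | e in gedges G]%SET.

Definition K1 : gain_graph := @GainGraph unit finset.set0.

(* In the moves that add one vertex to G, the new vertex set is option G, and
   the new vertex is None. *)
Definition old_edges (T : finType) (F : {set {set T} * bool}) :
    {set {set option T} * bool} :=
  [set map_edge Some e | e in F]%SET.

Definition H1a (G : gain_graph) (x y : G) (a b : bool) : gain_graph :=
  @GainGraph (option G)
    (old_edges (gedges G) :|:
     [set gedge None (Some x) a; gedge None (Some y) b])%SET.

Definition H1b (G : gain_graph) (x : G) : gain_graph :=
  @GainGraph (option G)
    (old_edges (gedges G) :|:
     [set gedge None (Some x) false; gedge None (Some x) true])%SET.

Definition H2a (G : gain_graph) (x y z : G) (a b c d : bool) : gain_graph :=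
  @GainGraph (option G)
    (old_edges (gedges G :\ gedge x y a) :|:
     [set gedge None (Some x) b; gedge None (Some y) c;
          gedge None (Some z) d])%SET.

Definition H2b (G : gain_graph) (x y : G) (a d : bool) : gain_graph :=
  @GainGraph (option G)
    (old_edges (gedges G :\ gedge x y a) :|:
     [set gedge None (Some x) false; gedge None (Some x) true;
          gedge None (Some y) d])%SET.

(* The removed edge (xv, a) becomes (xy, a) with y := f x a, so that two
   parallel removed edges may be attached to different vertices of K_4. *)
Definition vertex_to_K4 (G : gain_graph) (v : G)
    (f : {x : G | x != v} -> bool -> 'I_4) : gain_graph :=
  let T : finType := ({x : G | x != v} + 'I_4)%type in
  @GainGraph T
    ([set e : {set T} * bool | [exists x, exists y,
        (e.1 == [set inl x; inl y]) && (gedge (val x) (val y) e.2 \in gedges G)]]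
     :|: [set e : {set T} * bool | [exists i, exists j,
           (i != j) && (e == gedge (inr i) (inr j) false)]]
     :|: [set e : {set T} * bool | [exists x,
           (e.1 == [set inl x; inr (f x e.2)])
           && (gedge (val x) v e.2 \in gedges G)]])%SET.

Definition neighbours (G : gain_graph) (v : G) : {set G} :=
  [set x | (x != v) && [exists a, gedge v x a \in gedges G]]%SET.

(* The other part N2 of the partition consists of the neighbours of v1 that are
   neither v2 nor in N1. The gain of the edge v1v2 is a: if two parallel edges
   join v1 and v2, either of them may be chosen. *)
Definition vertex_split (G : gain_graph) (v1 v2 : G) (a : bool)
    (N1 : {set G}) : gain_graph :=
  let moved := [set e in gedges G |
                 [exists x in N1, e == gedge v1 x e.2]]%SET in
  @GainGraph (option G)
    (old_edges (gedges G :\: moved) :|: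
     [set e : {set option G} * bool | [exists x in N1,
        (e.1 == [set None; Some x]) && (gedge v1 x e.2 \in gedges G)]] :|:
     [set gedge None (Some v1) false; gedge None (Some v2) a])%SET.

(* Gain graphs are taken up to isomorphism and, at every stage, up to
   switching. *)
Inductive constructible : gain_graph -> Prop :=
| con_K1 : constructible K1
| con_iso G H : gain_iso G H -> constructible G -> constructible H
| con_switch G v : constructible G -> constructible (@switch G v)
| con_H1a G x y a b : x != y ->
    constructible G -> constructible (@H1a G x y a b)
| con_H1b G x : constructible G -> constructible (@H1b G x)
| con_H2a G x y z a b c d :
    gedge x y a \in gedges G -> x != y -> z != x -> z != y -> b (+) c = a ->
    constructible G -> constructible (@H2a G x y z a b c d)
| con_H2b G x y a d :
    gedge x y a \in gedges G -> x != y ->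
    constructible G -> constructible (@H2b G x y a d)
| con_K4 G v f : constructible G -> constructible (@vertex_to_K4 G v f)
| con_split (G : gain_graph) (v1 v2 : G) a (N1 : {set G}) :
    v2 != v1 -> gedge v1 v2 a \in gedges G ->
    N1 \subset (neighbours v1 :\ v2)%SET ->
    constructible G -> constructible (@vertex_split G v1 v2 a N1).

Section SymmetricGraph.
Variables (V : finType) (E : {set {set V}}) (theta : bool -> {perm V}).

Definition simple_graph : Prop := forall e, e \in E -> #|e| = 2%N.

Definition graph_aut (s : {perm V}) : Prop :=
  [set s @: e | e : {set V} in E]%SET = E.

Definition Z2_symmetric : Prop :=
  [/\ forall g, graph_aut (theta g),
      forall g h, theta (g (+) h) = (theta g * theta h)%g &
      forall g v, g != false -> theta g v != v].

Definition free_on_edges : Prop :=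
  forall g e, g != false -> e \in E -> theta g @: e != e.

Definition vertex_orbit : finType :=
  {O : {set V} | O \in [set [set theta g v | g : bool] | v : V]%SET}.

(* The edge orbit [e] joining u and v is recorded as ({u, v}, g), where g is
   the gain given by ~u (g ~v) \in [e], with ~u := rep u; ({u, v}, g)
   determines [e], and both end orders give the same g. As E is a union of edge
   orbits, ~u (g ~v) lies in some edge orbit iff it lies in E. *)
Definition quotient_gain_graph (rep : vertex_orbit -> V) : gain_graph :=
  @GainGraph vertex_orbit
    [set e : {set vertex_orbit} * bool | [exists u, exists v,
       (e.1 == [set u; v]) && ([set rep u; theta e.2 (rep v)] \in E)]]%SET.

End SymmetricGraph.

(* X = R^2 is 'cV[R]_2. Its library topology is that of the sup norm; all norms
   on R^2 induce the same topology and the same notion of derivative. *)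

Section Plane.
Variables (R : realType) (N : 'cV[R]_2 -> R).
Implicit Types (x y : 'cV[R]_2) (eta : 'cV[R]_2 -> 'cV[R]_2).

Definition is_norm : Prop :=
  [/\ forall x, N x = 0 -> x = 0,
      forall (a : R) x, N (a *: x) = `|a| * N x &
      forall x y, N (x + y) <= N x + N y].

Definition convex_hull n (P : pred 'I_n) (a : 'I_n -> 'cV[R]_2) :
    set 'cV[R]_2 :=
  [set x | exists c : 'I_n -> R,
     [/\ forall i, 0 <= c i, \sum_(i | P i) c i = 1 &
         x = \sum_(i | P i) c i *: a i]]%classic.

Definition quadrilateral (A : set 'cV[R]_2) : Prop :=
  exists a : 'I_4 -> 'cV[R]_2,
    A = convex_hull xpredT a /\
    (forall i, ~ convex_hull (fun j => j != i) a (a i)).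

Definition closed_unit_ball : set 'cV[R]_2 := [set x | N x <= 1]%classic.

(* The values alpha x t with t outside [-1, 1] are irrelevant. *)
Definition rigid_motion (alpha : 'cV[R]_2 -> R -> 'cV[R]_2) : Prop :=
  [/\ forall x, {within `[-1, 1], continuous (alpha x)}%classic,
      forall x, alpha x 0 = x &
      forall x y t, -1 <= t <= 1 -> N (alpha x t - alpha y t) = N (x - y)].

Definition inf_motion eta : Prop :=
  exists2 alpha, rigid_motion alpha &
    forall x, is_derive (0 : R) (1 : R) (alpha x) (eta x).

Definition to_complex m n (A : 'M[R]_(m, n)) : 'M[R[i]]_(m, n) :=
  map_mx (real_complex R) A.

Definition complex_inf_motion (eta : 'cV[R]_2 -> 'cV[R[i]]_2) : Prop :=
  exists n (c : 'I_n -> R[i]) (h : 'I_n -> 'cV[R]_2 -> 'cV[R]_2),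
    (forall k, inf_motion (h k)) /\
    (forall x, eta x = \sum_(k < n) c k *: to_complex (h k x)).

Definition representation (tau : bool -> 'M[R]_2) : Prop :=
  [/\ tau false = 1%:M,
      forall g h, tau (g (+) h) = tau g *m tau h &
      forall g x, N (tau g *m x) = N x].

End Plane.

Definition chi1 (K : pzRingType) (g : bool) : K := (-1) ^+ g.

(* K^2-valued families indexed by V are 2 x |V| matrices. *)
Definition point (K : Type) (V : finType) (x : 'M[K]_(2, #|V|)) (v : V) :
    'cV[K]_2 :=
  col (enum_rank v) x.

Section Framework.
Variables (R : realType) (N : 'cV[R]_2 -> R).
Variables (V : finType) (E : {set {set V}}) (theta : bool -> {perm V}).
Variables (tau : bool -> 'M[R]_2) (p : 'M[R]_(2, #|V|)).

(* As N is even, the choice of the order of the ends is irrelevant. *)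
Definition edge_length (x : 'M[R]_(2, #|V|)) (e : {set V}) : R :=
  if [pick vw : V * V | e == [set vw.1; vw.2]%SET] is Some (v, w)
  then N (point x v - point x w) else 0.

Definition rigidity_map (x : 'M[R]_(2, #|V|)) : 'rV[R]_#|E| :=
  \row_(i < #|E|) edge_length x (enum_val i).

Definition realisation : Prop := injective (point p).

Definition well_positioned : Prop := differentiable rigidity_map p.

Definition C2_symmetric : Prop :=
  (forall g v, tau g *m point p v = point p (theta g v)) /\
  tau true = - 1%:M.

Definition X_chi1 (x : 'M[R[i]]_(2, #|V|)) : Prop :=
  forall g v,
    point x (theta g v) = chi1 _ g *: (to_complex (tau g) *m point x v).

Definition Y_chi1 (y : 'rV[R[i]]_#|E|) : Prop :=
  forall g (i j : 'I_#|E|), enum_val j = theta g @: enum_val i ->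
    y 0 j = chi1 _ g * y 0 i.

Definition T_chi1 (eta : 'cV[R]_2 -> 'cV[R[i]]_2) : Prop :=
  complex_inf_motion N eta /\
  (forall g x, eta (tau g *m x) = chi1 _ g *: (to_complex (tau g) *m eta x)).

Definition complexified_differential (x : 'M[R[i]]_(2, #|V|)) :
    'rV[R[i]]_#|E| :=
  to_complex ('d rigidity_map p (map_mx (@complex.Re R) x)) +
  'i *: to_complex ('d rigidity_map p (map_mx (@complex.Im R) x)).

Definition rho_chi1 (eta : 'cV[R]_2 -> 'cV[R[i]]_2) : 'M[R[i]]_(2, #|V|) :=
  \matrix_(i, j) eta (point p (enum_val j)) i 0.

Definition chi1_isostatic : Prop :=
  ([set x | X_chi1 x /\ complexified_differential x = 0] =
     [set rho_chi1 eta | eta in T_chi1])%classic /\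
  (forall y, Y_chi1 y -> exists2 x, X_chi1 x & complexified_differential x = y).

End Framework.

(* Main.v *)
(* In suitable coordinates the norm is the l^1 norm, so an edge of a
   well-positioned framework has one of two colours, according to whether its two
   coordinate differences have equal or opposite signs. A velocity field that is
   symmetric with respect to the character is a function on the vertex orbits,
   and the corresponding part of the differential is the direct sum of the
   incidence matrices of the two colour classes of the gain graph. As the
   infinitesimal rigid motions are the translations, the framework is isostatic
   iff both colour classes are spanning trees, which forces tightness.

   Conversely, a tight gain graph with more than one vertex can be reduced by an
   inverse move. A vertex of degree 2, or of degree 3 that is not in a balanced
   K_4, is removed by an inverse H-move. In a balanced K_4, either the K_4 can
   be contracted to a vertex, or an outside vertex forms a balanced triangle with
   two of its vertices, and contracting an edge of this triangle undoes a vertex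
   splitting unless a vertex of the K_4 has degree at least 5; a discharging
   argument excludes that this happens everywhere.

   Finally every move preserves the existence of a framework on the gain graph
   whose colour classes are both connected: the new vertices are placed next to a
   suitable point of the covering framework. *)

Require Import Defs.
From HB Require Import structures.
From mathcomp Require Import all_boot all_order all_algebra all_fingroup.
From mathcomp Require Import complex.
From mathcomp Require Import all_classical all_reals all_analysis.
From mathcomp Require Import zify ring lra.
From mathcomp Require Import fintype finset.
Import Order.TTheory GRing.Theory Num.Theory.
Import numFieldNormedType.Exports.
Local Open Scope ring_scope.

Set Implicit Arguments.
Unset Strict Implicit.
Unset Printing Implicit Defensive.

(** * Edges and constructibility inside a fixed vertex type *)

Section Edges.
Local Open Scope nat_scope.
Local Open Scope set_scope.

(** The (2,2,2) count does not see balance, so gains matter to the combinatorics only where a move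
    prescribes them: in H2a, in the K_4, and in the triangle of a vertex splitting. Switching brings
    the gains involved to 1 before a contraction. The genuine obstacle is that a contraction is
    admissible only if no two surviving edges become equal; the case distinctions and the
    discharging come from this. On the analytic side at most 2|V_0| - 2 edges together with two
    connected colour classes already make each class a spanning tree, so only an upper bound for the
    number of edges is carried through the moves. Colours are comparisons of signs of finitely many
    nonzero numbers and survive small displacements. A point placed next to a point of the covering
    framework therefore inherits all its colours, except towards that point itself, where the colour
    can be chosen. This freedom keeps both classes connected. *)

Lemma imset_id_in (T : finType) (f : T -> T) (A : {set T}) :
  {in A, f =1 id} -> [set f x | x in A] = A.
Proof. by move=> fA; rewrite -[RHS](imset_id A); apply: eq_in_imset. Qed.

Lemma gedgeC (T : finType) (u v : T) a : gedge u v a = gedge v u a.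
Proof. by rewrite /gedge setUC. Qed.

Lemma set2_eq (T : finType) (u v x y : T) : [set u; v] = [set x; y] ->
  (u = x /\ v = y) \/ (u = y /\ v = x).
Proof.
move=> e.
have: u \in [set x; y] by rewrite -e set21.
have: v \in [set x; y] by rewrite -e set22.
have: x \in [set u; v] by rewrite e set21.
have: y \in [set u; v] by rewrite e set22.
rewrite !inE => /orP[] /eqP h1 /orP[] /eqP h2 /orP[] /eqP h3 /orP[] /eqP h4;
  by subst; auto.
Qed.

Lemma gedge_inj (T : finType) (v x y : T) a b :
  gedge v x a = gedge v y b -> x = y /\ a = b.
Proof. by case=> /set2_eq[[_ ->]|[<- ->]] ->. Qed.

Lemma edge_at (T : finType) (e : {set T} * bool) v :
  #|e.1| = 2 -> v \in e.1 -> exists2 x, x != v & e = gedge v x e.2.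
Proof.
case: e => s a /= /eqP/cards2P[x [y [xy ->]]]; rewrite !inE.
case/orP=> /eqP->; first by exists y => //; rewrite eq_sym.
by exists x => //; rewrite gedgeC.
Qed.

Lemma edge_ends (T : finType) (e : {set T} * bool) :
  #|e.1| = 2 -> exists u v, u != v /\ e = gedge u v e.2.
Proof. by case: e => s a /= /eqP/cards2P[x [y [xy ->]]]; exists x, y. Qed.

Lemma map_edge_gedge (T U : finType) (f : T -> U) u v a :
  map_edge f (gedge u v a) = gedge (f u) (f v) a.
Proof. by rewrite /map_edge /gedge /= imsetU !imset_set1. Qed.

Lemma map_edge_inj (T U : finType) (f : T -> U) :
  injective f -> injective (map_edge f).
Proof.
by move=> fi [s a] [t b] [/(imset_inj fi) -> ->].
Qed.

Lemma mem_map_edge (T U : finType) (f : T -> U) (F : {set {set T} * bool}) u v a :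
  injective f ->
  (gedge (f u) (f v) a \in [set map_edge f e | e in F]) = (gedge u v a \in F).
Proof. by move=> fi; rewrite -map_edge_gedge (mem_imset _ _ (map_edge_inj fi)). Qed.

Lemma mem_map_edgeW (T U : finType) (f : T -> U) (F : {set {set T} * bool}) u v a :
  gedge u v a \in F -> gedge (f u) (f v) a \in [set map_edge f e | e in F].
Proof. by move=> h; rewrite -map_edge_gedge; apply: imset_f. Qed.

Definition ext (S T : Type) (f : S -> T) (v : T) (o : option S) : T :=
  if o is Some x then f x else v.

Lemma ext_inj (S T : finType) (f : S -> T) (v : T) :
  injective f -> v \notin [set f x | x : S] -> injective (ext f v).
Proof.
move=> fi vn [x|] [y|] //= => [/fi->//|h|h]; case/imsetP: vn.
  by exists x.
by exists y.
Qed.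

Lemma ext_im (S T : finType) (f : S -> T) (v : T) :
  [set ext f v x | x : option S] = v |: [set f x | x : S].
Proof.
apply/setP=> y; rewrite !inE; apply/imsetP/orP.
  by case=> [[x|] _ ->]; [right; apply: imset_f|left].
by case=> [/eqP->|/imsetP[x _ ->]]; [exists None|exists (Some x)].
Qed.

Lemma map_ext_old (S T : finType) (f : S -> T) (v : T) (F : {set {set S} * bool}) :
  [set map_edge (ext f v) e | e in old_edges F] = [set map_edge f e | e in F].
Proof.
rewrite /old_edges -imset_comp; apply: eq_imset => e.
by rewrite /map_edge /= -imset_comp.
Qed.

Lemma map_edgeD (S T : finType) (f : S -> T) (F D : {set {set S} * bool}) :
  injective f ->
  [set map_edge f e | e in F :\: D] =
  [set map_edge f e | e in F] :\: [set map_edge f e | e in D].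
Proof.
move=> fi; have mi := map_edge_inj fi; apply/setP=> e; rewrite inE.
apply/imsetP/andP.
  by case=> x; rewrite inE => /andP[xD xF] ->; rewrite !mem_imset.
by case=> /negP h /imsetP[x xF ee]; exists x => //; rewrite inE xF andbT;
  apply/negP=> xD; apply: h; rewrite ee imset_f.
Qed.

End Edges.

(* Constructibility of a gain graph whose vertex set is a subset [S] of a
   fixed type, so that the inductive argument never has to change the type of
   vertices. *)
Definition constructible_on (T : finType) (S : {set T}) (E : {set {set T} * bool}) :=
  exists (H : gain_graph) (f : H -> T),
    [/\ constructible H, injective f, S = [set f x | x : H]%SET
      & E = [set map_edge f e | e in gedges H]%SET].

Section ConstructibleOn.
Local Open Scope nat_scope.
Local Open Scope set_scope.
Variable T : finType.
Implicit Types (E F : {set {set T} * bool}) (A B S : {set T}).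

Lemma con_on_K1 (x : T) : constructible_on [set x] set0.
Proof.
exists K1, (fun _ => x); split; first exact: con_K1.
- by move=> [] [].
- apply/setP=> y; rewrite inE; apply/eqP/imsetP => [->|[_ _ ->]] //.
  by exists tt.
- by rewrite imset0.
Qed.

Lemma con_on_all (G : gain_graph) :
  constructible_on [set: G] (gedges G) -> constructible G.
Proof.
case=> H [f [cH fi fS fE]]; apply: con_iso cH; exists f => //.
by apply: inj_card_bij => //; rewrite -cardsT fS; apply: leq_imset_card.
Qed.

(** Every move that adds one vertex lives on an option type. Sending [None] to a fresh [v] brings
    the result back to subsets of [T], once for all such moves. *)
Lemma con_on_ext (H : gain_graph) (f : H -> T) v
    (F' : {set {set H} * bool}) (News : {set {set option H} * bool}) :
  constructible (@GainGraph (option H) (old_edges F' :|: News)) ->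
  injective f -> v \notin [set f x | x : H] ->
  constructible_on (v |: [set f x | x : H])
    ([set map_edge f e | e in F'] :|: [set map_edge (ext f v) e | e in News]).
Proof.
move=> c fi vn; exists (@GainGraph (option H) (old_edges F' :|: News)), (ext f v).
split=> //=; first exact: ext_inj.
  by rewrite ext_im.
by rewrite imsetU map_ext_old.
Qed.

(** H1a and H1b in one statement: for [x = y] the distinctness of the new edges forces their gains
    to differ. *)
Lemma con_on_H1 S E v x y a b :
  constructible_on S E -> v \notin S -> x \in S -> y \in S ->
  gedge v x a != gedge v y b ->
  constructible_on (v |: S) (E :|: [set gedge v x a; gedge v y b]).
Proof.
case=> H [f [cH fi -> ->]] vS /imsetP[x' _ ->] /imsetP[y' _ ->] ne.
have [exy|nxy] := eqVneq x' y'.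
  have := con_on_ext (con_H1b x' cH) fi vS.
  rewrite imsetU !imset_set1 !map_edge_gedge /=.
  have: a != b by apply: contraNneq ne => ->; rewrite exy.
  rewrite -exy; case: (a); case: (b) => // _.
  by rewrite (setUC [set gedge v (f x') true]).
have := con_on_ext (con_H1a a b nxy cH) fi vS.
by rewrite imsetU !imset_set1 !map_edge_gedge.
Qed.

Lemma con_on_H2a S E v x y z a b c d :
  constructible_on S E -> v \notin S -> x \in S -> y \in S -> z \in S ->
  gedge x y a \in E -> x != y -> z != x -> z != y -> b (+) c = a ->
  constructible_on (v |: S) ((E :\ gedge x y a) :|:
    [set gedge v x b; gedge v y c; gedge v z d]).
Proof.
case=> H [f [cH fi -> ->]] vS /imsetP[x' _ ->] /imsetP[y' _ ->] /imsetP[z' _ ->].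
rewrite mem_map_edge // !(inj_eq fi) => xyE xy zx zy bc.
have := con_on_ext (con_H2a d xyE xy zx zy bc cH) fi vS.
by rewrite !imsetU !imset_set1 !map_edge_gedge /= map_edgeD // imset_set1 map_edge_gedge.
Qed.

Lemma con_on_H2b S E v x y a d :
  constructible_on S E -> v \notin S -> x \in S -> y \in S ->
  gedge x y a \in E -> x != y ->
  constructible_on (v |: S) ((E :\ gedge x y a) :|:
    [set gedge v x false; gedge v x true; gedge v y d]).
Proof.
case=> H [f [cH fi -> ->]] vS /imsetP[x' _ ->] /imsetP[y' _ ->].
rewrite mem_map_edge // !(inj_eq fi) => xyE xy.
have := con_on_ext (con_H2b d xyE xy cH) fi vS.
by rewrite !imsetU !imset_set1 !map_edge_gedge /= map_edgeD // imset_set1 map_edge_gedge.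
Qed.

Lemma con_on_split S E v0 v1 v2 a (N1 : {set T}) :
  constructible_on S E -> v0 \notin S -> v1 \in S -> v2 \in S ->
  v2 != v1 -> gedge v1 v2 a \in E ->
  (forall x, x \in N1 -> [/\ x \in S, x != v1, x != v2 & exists b, gedge v1 x b \in E]) ->
  constructible_on (v0 |: S)
    ((E :\: [set e in E | [exists x in N1, e == gedge v1 x e.2]]) :|:
     [set e | [exists x in N1, (e.1 == [set v0; x]) && (gedge v1 x e.2 \in E)]] :|:
     [set gedge v0 v1 false; gedge v0 v2 a]).
Proof.
case=> H [f [cH fi -> ->]] vS /imsetP[x1 _ ->] /imsetP[x2 _ ->].
rewrite (inj_eq fi) mem_map_edge // => x21 aE hN.
pose N1' : {set H} := f @^-1: N1.
have N1'P : N1' \subset neighbours x1 :\ x2.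
  apply/subsetP=> x; rewrite !inE => /hN[_]; rewrite !(inj_eq fi) => -> -> /= [b].
  by rewrite mem_map_edge // => bE; apply/existsP; exists b.
have cS := con_split x21 aE N1'P cH.
have := @con_on_ext H f v0 (gedges H :\: [set e in gedges H |
    [exists x in N1', e == gedge x1 x e.2]]) _.
move/(_ ([set e : {set option H} * bool | [exists x in N1',
        (e.1 == [set None; Some x]) && (gedge x1 x e.2 \in gedges H)]] :|:
     [set gedge None (Some x1) false; gedge None (Some x2) a])).
rewrite setUA => /(_ cS fi vS).
rewrite setUA !imsetU !imset_set1 !map_edge_gedge /= map_edgeD //.
rewrite -!setUA; congr (constructible_on _ ((_ :\: _) :|: (_ :|: _))).
- apply/setP=> e; apply/imsetP/idP.
    case=> e' /setIdP[e'E /existsP[x /andP[]]].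
    rewrite [in X in X -> _]inE => xN /eqP ee ->; rewrite inE imset_f //=; apply/existsP.
    by exists (f x); rewrite xN /= ee map_edge_gedge.
  case/setIdP=> /imsetP[e' e'E ->] /existsP[y /andP[yN /eqP]].
  have [/imsetP[x _ xy] _ _ _] := hN _ yN; rewrite {y}xy in yN *.
  rewrite -map_edge_gedge => /(map_edge_inj fi) /= ee; exists e' => //.
  by rewrite inE e'E; apply/existsP; exists x; rewrite inE yN {1}ee /=.
- apply/setP=> e; apply/imsetP/idP.
    case=> e'; rewrite [in X in X -> _]inE => /existsP[x /andP[]].
    rewrite [in X in X -> _]inE => xN /andP[/eqP ee eE] ->; rewrite inE; apply/existsP.
    exists (f x); rewrite xN /= mem_map_edge // eE andbT ee.
    by rewrite imsetU !imset_set1.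
  rewrite inE => /existsP[y /andP[yN /andP[/eqP ee]]].
  have [/imsetP[x _ xy] _ _ _] := hN _ yN; rewrite {y}xy in yN ee *.
  rewrite mem_map_edge // => xE.
  exists (gedge None (Some x) e.2); last by rewrite map_edge_gedge [LHS]surjective_pairing ee.
  by rewrite inE; apply/existsP; exists x; rewrite inE yN /= eqxx xE.
Qed.

Lemma con_on_switch S E v :
  constructible_on S E -> (forall e, e \in E -> e.1 \subset S) ->
  constructible_on S [set switch_edge v e | e in E].
Proof.
move=> + ES; case: (boolP (v \in S)) => vS cS; last first.
  rewrite imset_id_in // => -[s b] eE; rewrite /switch_edge /=.
  case: ifP => // /andP[vs _]; case/negP: vS.
  by apply: (subsetP (ES _ eE)).
case: cS vS => H [f [cH fi -> ->]] /imsetP[w _ ->].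
exists (switch w), f; split=> //; first exact: con_switch.
rewrite /= -!imset_comp; apply: eq_imset => -[s b].
by rewrite /= /switch_edge /map_edge /= (mem_imset _ _ fi) card_imset.
Qed.

End ConstructibleOn.

Section ConstructibleOn2.
Local Open Scope nat_scope.
Local Open Scope set_scope.
Variable T : finType.
Implicit Types (E F : {set {set T} * bool}) (A B S : {set T}).

(** The new vertices have to avoid only [S :\ w], so that [w] may be one of them; [reduce_K4]
    contracts onto such a vertex. *)
Lemma con_on_K4 S E w (k : 'I_4 -> T) (att : T -> bool -> 'I_4) :
  constructible_on S E -> w \in S -> (forall e, e \in E -> #|e.1| = 2) ->
  injective k -> (forall i, k i \notin S :\ w) ->
  constructible_on ((S :\ w) :|: [set k i | i : 'I_4])
    ([set e in E | w \notin e.1] :|: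
     [set e | [exists i, exists j, (i != j) && (e == gedge (k i) (k j) false)]] :|:
     [set e | [exists x, [&& x != w, e.1 == [set x; k (att x e.2)]
                           & gedge x w e.2 \in E]]]).
Proof.
case=> H [f [cH fi -> ->]] /imsetP[w' _ ->] E2 ki kS.
pose T' : finType := ({x : H | x != w'} + 'I_4)%type.
pose f' (z : T') : T := match z with inl x => f (val x) | inr i => k i end.
pose G' := vertex_to_K4 (v := w') (fun x a => att (f (val x)) a).
have f'l x : f' (inl x) = f (val x) by [].
have f'r i : f' (inr i) = k i by [].
have fS x : x != w' -> f x \in [set f x | x : H] :\ f w'.
  by move=> xw; rewrite !inE (inj_eq fi) xw imset_f.
have f'i : injective f'.
  move=> [x|i] [y|j] //=.
  - by move=> /fi/val_inj->.
  - by move=> h; case/negP: (kS j); rewrite -h fS // (valP x).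
  - by move=> h; case/negP: (kS i); rewrite h fS // (valP y).
  - by move=> /ki->.
exists G', f'; split=> //; first exact: con_K4.
  apply/setP=> y; rewrite inE; apply/orP/imsetP.
    case=> [|/imsetP[i _ ->]]; last by exists (inr i).
    rewrite !inE => /andP[yw /imsetP[x _ yx]]; rewrite yx (inj_eq fi) in yw.
    by exists (inl (exist _ x yw)).
  case=> [[x|i] _ ->]; [left|right]; last exact: imset_f.
  by rewrite /= fS // (valP x).
rewrite /= !imsetU; congr (_ :|: _ :|: _); apply/setP=> e; apply/idP/imsetP.
- rewrite inE => /andP[/imsetP[e' e'E ee] we].
  have [u [v [uv ev]]] := edge_ends (E2 _ (imset_f (map_edge f) e'E)).
  have e'2 : #|e'.1| = 2.
    by rewrite -(E2 _ (imset_f (map_edge f) e'E)) /= card_imset.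
  have [x [y [xy exy]]] := edge_ends e'2.
  rewrite ee exy map_edge_gedge !inE !(inj_eq fi) negb_or in we.
  have [xw yw] := andP we; rewrite eq_sym in xw; rewrite eq_sym in yw.
  exists (gedge (inl (exist _ x xw)) (inl (exist _ y yw)) e'.2).
    rewrite inE; apply/existsP; exists (exist _ x xw).
    by apply/existsP; exists (exist _ y yw); rewrite eqxx /= -exy.
  by rewrite map_edge_gedge /= ee {1}exy map_edge_gedge.
- case=> e'; rewrite [in X in X -> _]inE => /existsP[x /existsP[y /andP[/eqP ee eE]]] ->.
  rewrite inE; apply/andP; split.
    apply/imsetP; exists (gedge (val x) (val y) e'.2) => //.
    by rewrite map_edge_gedge /map_edge ee imsetU !imset_set1.
  rewrite /= ee imsetU !imset_set1 !inE !(inj_eq fi) negb_or.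
  by rewrite eq_sym (valP x) eq_sym (valP y).
- rewrite inE => /existsP[i /existsP[j /andP[ij /eqP->]]].
  exists (gedge (inr i) (inr j) false); last by rewrite map_edge_gedge.
  by rewrite inE; apply/existsP; exists i; apply/existsP; exists j; rewrite ij /=.
- case=> e'; rewrite [in X in X -> _]inE => /existsP[i /existsP[j /andP[ij /eqP->]]] ->.
  by rewrite inE; apply/existsP; exists i; apply/existsP; exists j;
    rewrite ij /= map_edge_gedge.
- rewrite inE => /existsP[y /and3P[yw /eqP ee eE]].
  have [/= x xy] : exists x, y = f x.
    case/imsetP: eE => e' e'E; move/(congr1 fst); rewrite /gedge /= => h.
    have: y \in [set y; f w'] by rewrite set21.
    by rewrite h => /imsetP[x _ ->]; exists x.
  rewrite {y}xy in yw ee eE; rewrite (inj_eq fi) in yw.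
  rewrite mem_map_edge // in eE.
  exists (gedge (inl (exist _ x yw)) (inr (att (f x) e.2)) e.2).
    by rewrite inE; apply/existsP; exists (exist _ x yw); rewrite eqxx.
  by rewrite map_edge_gedge [LHS]surjective_pairing ee.
- case=> e'; rewrite [in X in X -> _]inE => /existsP[x /andP[/eqP ee eE]] ->.
  rewrite inE; apply/existsP; exists (f (val x)); rewrite (inj_eq fi) (valP x) /=.
  by rewrite mem_map_edge // eE andbT ee imsetU !imset_set1.
Qed.

(** Switching at all vertices of [A] at once. An edge with two ends changes its gain iff exactly one
    end lies in [A], hence the parity. *)
Definition switch_at A (e : {set T} * bool) : {set T} * bool :=
  (e.1, e.2 (+) odd #|e.1 :&: A|).

Lemma switch_atK A : involutive (switch_at A).
Proof. by move=> [s b]; rewrite /switch_at /= addbK. Qed.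

Lemma switch_at_gedge A u v a : u != v ->
  switch_at A (gedge u v a) = gedge u v (a (+) ((u \in A) (+) (v \in A))).
Proof.
move=> uv; rewrite /switch_at /gedge /=; congr (_, _ (+) _).
rewrite setIUl cardsU.
have -> : [set u] :&: A :&: ([set v] :&: A) = set0.
  apply/setP=> z; rewrite !inE; have [->|] := eqVneq z u => //=.
  by rewrite (negPf uv) /= andbF.
rewrite cards0 subn0 oddD; have h z : odd #|[set z] :&: A| = (z \in A).
  case: (boolP (z \in A)) => zA.
    by rewrite (setIidPl _) ?cards1 // sub1set.
  by rewrite (_ : _ :&: _ = set0) ?cards0 //; apply/eqP; rewrite setI_eq0 disjoints1.
by rewrite !h.
Qed.

Lemma con_on_switch_at S E A :
  (forall e, e \in E -> #|e.1| = 2 /\ e.1 \subset S) ->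
  constructible_on S [set switch_at A e | e in E] -> constructible_on S E.
Proof.
(* Since [switch_at] is an involution, it suffices that it preserves constructibility. This follows
   one vertex of [B] at a time. *)
move=> ES; suff H B E' : (forall e, e \in E' -> #|e.1| = 2 /\ e.1 \subset S) ->
    constructible_on S E' -> constructible_on S [set switch_at B e | e in E'].
  move/(H A) => h; have := h _; rewrite -imset_comp.
  rewrite (_ : imset (switch_at A \o switch_at A) _ = E); last first.
    by apply: imset_id_in => e _; apply: (switch_atK A e).
  by apply=> _ /imsetP[e /ES ? ->].
have [n] := ubnP #|B|; elim: n B => // n IHn B leB E'2 cE'.
have [->|[v vB]] := set_0Vmem B.
  rewrite imset_id_in // => -[s b] _.
  by rewrite /switch_at /= setI0 cards0 addbF.
rewrite (_ : imset _ _ = [set switch_edge v e | e in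
    [set switch_at (B :\ v) e | e in E']]).
  apply: con_on_switch; last by move=> _ /imsetP[e /E'2[_ ?] ->].
  by apply: IHn => //; move: leB; rewrite (cardsD1 v) vB.
rewrite -imset_comp; apply: eq_in_imset => e /E'2[e2 _].
have [x [y [xy ->]]] := edge_ends e2.
rewrite /comp !switch_at_gedge // /switch_edge /gedge /= !inE cards2 xy andbT.
congr (_, _); rewrite !(eq_sym _ v).
have [vx|vx] := eqVneq v x; have [vy|vy] := eqVneq v y => //=.
- by move: xy; rewrite -vx -vy eqxx.
- by rewrite -vx vB; case: (y \in B); case: e.2.
- by rewrite -vy vB; case: (x \in B); case: e.2.
Qed.

End ConstructibleOn2.

(** * Tight gain graphs are constructible *)

Definition inside (T : finType) (E : {set {set T} * bool}) (A : {set T}) :=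
  [set e in E | e.1 \subset A]%SET.

Definition edges_at (T : finType) (E : {set {set T} * bool}) (v : T) :=
  [set e in E | v \in e.1]%SET.

(** The bound is imposed on vertex sets: the edges spanned by [A] are the largest edge set with
    support in [A], and vertex sets allow the union and intersection argument. *)
Definition sparse (T : finType) (E : {set {set T} * bool}) :=
  forall A : {set T}, A != finset.set0 -> (#|inside E A| + 2 <= 2 * #|A|)%N.

Definition tight_on (T : finType) (S : {set T}) (E : {set {set T} * bool}) :=
  [/\ forall e, e \in E -> #|e.1| = 2%N /\ e.1 \subset S,
      (#|E| + 2 = 2 * #|S|)%N & sparse E].

(** Only the lower bound; for a nonempty [A] in a sparse graph it is an equality. *)
Definition tight_set (T : finType) (E : {set {set T} * bool}) (A : {set T}) :=
  (2 * #|A| <= #|inside E A| + 2)%N.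

(** * Tight vertex sets and supermodularity *)

Section Sparse.
Local Open Scope nat_scope.
Local Open Scope set_scope.
Variable T : finType.
Implicit Types (E F X : {set {set T} * bool}) (A B S : {set T}).

Lemma gedge_sub (u v : T) a A : ((gedge u v a).1 \subset A) = (u \in A) && (v \in A).
Proof. by rewrite /gedge /= subUset !sub1set. Qed.

Lemma cards3 (U : finType) (X : {set U}) : #|X| = 3 ->
  exists x y z, [/\ x != y, z != x, z != y & X = [set x; y; z]].
Proof.
move=> X3; have [X0|[x xX]] := set_0Vmem X; first by rewrite X0 cards0 in X3.
have := cardsD1 x X; rewrite xX X3 => -[/esym/eqP/cards2P[y [z [yz e]]]].
have yX : y \in X :\ x by rewrite e set21.
have zX : z \in X :\ x by rewrite e set22.
exists x, y, z; rewrite !inE in yX zX; case/andP: yX => yx _; case/andP: zX => zx _.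
by split=> //; [rewrite eq_sym|rewrite eq_sym|rewrite -(setD1K xX) e setUA].
Qed.

Lemma insideS E F A B : E \subset F -> A \subset B -> #|inside E A| <= #|inside F B|.
Proof.
move=> EF AB; apply/subset_leq_card/subsetP=> e; rewrite !inE => /andP[/(subsetP EF)->].
by move/subset_trans; apply.
Qed.

Lemma sparseS E F : E \subset F -> sparse F -> sparse E.
Proof.
by move=> EF sF A /sF; apply: leq_trans; rewrite leq_add2r insideS.
Qed.

(** Supermodularity of the number of spanned edges. [X] collects edges of the union that lie in
    neither part and improves the inequality by their number. *)
Lemma inside_super E A B X : X \subset inside E (A :|: B) ->
  (forall e, e \in X -> ~~ (e.1 \subset A) /\ ~~ (e.1 \subset B)) ->
  #|inside E A| + #|inside E B| + #|X| <= #|inside E (A :|: B)| + #|inside E (A :&: B)|.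
Proof.
move=> XE Xn; rewrite -cardsUI addnAC.
rewrite (_ : inside E A :&: inside E B = inside E (A :&: B)); last first.
  by apply/setP=> e; rewrite !inE subsetI; case: (e \in E).
rewrite leq_add2r -[_ + #|X|]cardsUI (_ : _ :&: X = set0); last first.
  apply/setP=> e; rewrite !inE; case: (boolP (e \in X)) => eX; last by rewrite andbF.
  by have [/negPf-> /negPf->] := Xn _ eX; rewrite !andbF.
rewrite cards0 addn0; apply/subset_leq_card; rewrite !subUset XE andbT.
by apply/andP; split; apply/subsetP=> e; rewrite !inE => /andP[->] /=;
  move/subset_trans; apply; rewrite ?subsetUl ?subsetUr.
Qed.

Lemma inside_add E A v X : v \notin A ->
  X \subset E -> (forall e, e \in X -> v \in e.1 /\ e.1 \subset v |: A) ->
  #|inside E A| + #|X| <= #|inside E (v |: A)|.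
Proof.
move=> vA /subsetP XE hX; rewrite -cardsUI (_ : _ :&: X = set0) ?cards0 ?addn0.
  apply/subset_leq_card/subsetP=> e; case/setUP=> [/setIdP[eE h]|eX]; rewrite inE.
    by rewrite eE; apply: subset_trans h _; apply: subsetUr.
  by rewrite XE // (hX _ eX).2.
apply/setP=> e; rewrite !inE; apply: contraNF vA => /andP[/andP[_ /subsetP eA] /hX[vX _]].
exact: eA.
Qed.

(** Supermodularity against sparsity of the union and of the intersection, which is nonempty because
    of [x]: all bounds are attained, so no edge can cross between the two sets. *)
Lemma tight_setU E A B x : sparse E -> tight_set E A -> tight_set E B ->
  x \in A -> x \in B -> tight_set E (A :|: B) /\
  (forall e, e \in E -> e.1 \subset A :|: B -> e.1 \subset A \/ e.1 \subset B).
Proof.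
rewrite /tight_set => sE tA tB xA xB.
have := cardsUI A B; have I0 : A :&: B != set0 by apply/set0Pn; exists x; rewrite inE xA.
have := sE _ I0; split=> [|e eE eAB].
  have := @inside_super E A B set0 (sub0set _); rewrite cards0 => h.
  suff /h : forall e, e \in (set0 : {set {set T} * bool}) ->
    ~~ (e.1 \subset A) /\ ~~ (e.1 \subset B) by lia.
  by move=> e; rewrite inE.
apply/orP; apply: contraT; rewrite negb_or => /andP[eA eB].
have U0 : A :|: B != set0 by apply/set0Pn; exists x; rewrite inE xA.
have := sE _ U0; have := @inside_super E A B [set e]; rewrite cards1 sub1set !inE eE eAB.
move=> /(_ isT) h; suff /h : forall e', e' \in [set e] -> ~~ (e'.1 \subset A) /\ ~~ (e'.1 \subset B) by lia.
by move=> e'; rewrite inE => /eqP->.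
Qed.

Lemma tight_set_add E A v X : tight_set E A -> v \notin A ->
  X \subset E -> (forall e, e \in X -> v \in e.1 /\ e.1 \subset v |: A) ->
  2 <= #|X| -> tight_set E (v |: A).
Proof.
rewrite /tight_set => tA vA XE hX X2; have := inside_add vA XE hX.
by rewrite cardsU1 vA; lia.
Qed.

(** Three edges from [v] into a tight set would make [v |: A] violate sparsity. *)
Lemma tight_set_deg E A v X : sparse E -> tight_set E A -> v \notin A ->
  X \subset E -> (forall e, e \in X -> v \in e.1 /\ e.1 \subset v |: A) ->
  #|X| <= 2.
Proof.
rewrite /tight_set => sE tA vA XE hX; have := inside_add vA XE hX.
have vA0 : v |: A != set0 by apply/set0Pn; exists v; rewrite !inE eqxx.
by have := sE _ vA0; rewrite cardsU1 vA; lia.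
Qed.

Lemma sum_deg S E : (forall e, e \in E -> #|e.1| = 2 /\ e.1 \subset S) ->
  \sum_(v in S) #|edges_at E v| = 2 * #|E|.
Proof.
move=> ES; transitivity (\sum_(v in S) \sum_(e in E) (v \in e.1)).
  apply: eq_bigr => v _; rewrite -sum1_card big_mkcond [RHS]big_mkcond /=.
  apply: eq_bigr => e _; rewrite inE; case: (e \in E) => //=; by case: ifP.
rewrite exchange_big /= (eq_bigr (fun=> 2)) ?sum_nat_const 1?mulnC // => e /ES[e2 eS].
rewrite -e2 -sum1_card [RHS]big_mkcond [LHS]big_mkcond /=; apply: eq_bigr => v _.
case: (boolP (v \in e.1)) => h; last by case: (v \in S).
by rewrite (subsetP eS).
Qed.

Lemma edges_atS E v : edges_at E v \subset E.
Proof. by apply/subsetP=> e; rewrite inE => /andP[]. Qed.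

(** Sparsity leaves at most [2 * (#|S| - 1) - 2] edges off [v], two fewer than [E] has. *)
Lemma tight_deg_ge2 S E v : tight_on S E -> v \in S -> 1 < #|S| ->
  2 <= #|edges_at E v|.
Proof.
case=> ES E2 sE vS S2; have S0 : S :\ v != set0.
  by rewrite -card_gt0; have := cardsD1 v S; rewrite vS; lia.
have := sE _ S0; have := cardsD1 v S; rewrite vS.
have : E \subset edges_at E v :|: inside E (S :\ v).
  apply/subsetP=> e eE; rewrite !inE eE /=; case: (boolP (v \in e.1)) => //= ve.
  by rewrite subsetD1 ve (ES _ eE).2.
move/subset_leq_card; have := cardsU (edges_at E v) (inside E (S :\ v)); lia.
Qed.

End Sparse.

(** * Inverse H-moves at vertices of degree 2 and 3 *)

Section Reductions.
Local Open Scope nat_scope.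
Local Open Scope set_scope.
Variable T : finType.
Implicit Types (E F X : {set {set T} * bool}) (A B S : {set T}).

Lemma edges_at_gedge S E v e : tight_on S E -> e \in edges_at E v ->
  exists x, [/\ x != v, x \in S :\ v & e = gedge v x e.2].
Proof.
case=> ES _ _; rewrite inE => /andP[eE ve]; have [e2 eS] := ES _ eE.
have [x xv ee] := edge_at e2 ve; exists x; split=> //.
by rewrite !inE xv (subsetP eS) // ee !inE eqxx orbT.
Qed.

Lemma del_edges S E v : tight_on S E ->
  forall e, e \in E :\: edges_at E v -> #|e.1| = 2 /\ e.1 \subset S :\ v.
Proof.
case=> ES _ _ e; rewrite !inE => /andP[+ eE]; rewrite eE /= => ve.
by have [? ?] := ES _ eE; split=> //; rewrite subsetD1 ve andbT.
Qed.

Lemma card_del E v : #|E :\: edges_at E v| + #|edges_at E v| = #|E|.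
Proof. by rewrite addnC -(cardsID (edges_at E v) E) (setIidPr (edges_atS E v)). Qed.

Lemma edges_splitK E v : E = (E :\: edges_at E v) :|: edges_at E v.
Proof. by rewrite -{1}(setID E (edges_at E v)) (setIidPr (edges_atS E v)) setUC. Qed.

Lemma reduce_deg2 S E v : tight_on S E -> v \in S -> #|edges_at E v| = 2 ->
  (forall S' E', #|S'| < #|S| -> tight_on S' E' -> constructible_on S' E') ->
  constructible_on S E.
Proof.
move=> tE vS v2 IH; have [ES E2 sE] := tE.
have SC := cardsD1 v S; rewrite vS in SC.
have /IH cS : #|S :\ v| < #|S| by lia.
have := card_del E v; rewrite v2 => Ec.
have {}cS : constructible_on (S :\ v) (E :\: edges_at E v).
  apply: cS; split; [exact: del_edges|lia|exact: sparseS (subsetDl _ _) sE].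
move/eqP/cards2P: v2 => [e1 [e2 [e12 ev]]].
have [||x [xv xS ex]] := @edges_at_gedge S E v e1 => //; first by rewrite ev set21.
have [||y [yv yS ey]] := @edges_at_gedge S E v e2 => //; first by rewrite ev set22.
rewrite ex ey in e12 ev.
rewrite -(setD1K vS) (edges_splitK E v) {2}ev; apply: con_on_H1 => //.
by rewrite !inE eqxx.
Qed.

(** The new edge can break sparsity only on a set that contains both its ends and was tight before;
    the last hypothesis excludes such sets. *)
Lemma tight_add_edge S E v x y a : tight_on S E -> v \in S ->
  #|edges_at E v| = 3 -> x != y -> x \in S :\ v -> y \in S :\ v ->
  gedge x y a \notin E ->
  (forall A, x \in A -> y \in A -> v \notin A -> ~ tight_set E A) ->
  tight_on (S :\ v) (gedge x y a |: (E :\: edges_at E v)).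
Proof.
move=> tE vS v3 xy xS yS aE hA; have [ES E2 sE] := tE.
have SC := cardsD1 v S; rewrite vS in SC; have := card_del E v; rewrite v3 => Ec.
split.
- move=> e; case/setU1P=> [->|]; last exact: del_edges.
  by rewrite gedge_sub xS yS /= cards2 xy.
- have -> : #|gedge x y a |: E :\: edges_at E v| = #|E :\: edges_at E v|.+1.
    by rewrite cardsU1 [_ \in _]inE (negPf aE) andbF.
  by lia.
- move=> A A0; case: (boolP ((x \in A) && (y \in A))) => [/andP[xA yA]|xyA]; last first.
    apply: leq_trans (sE _ A0); rewrite leq_add2r; apply/subset_leq_card/subsetP=> e.
    case/setIdP=> /setU1P[->|]; first by rewrite gedge_sub (negPf xyA).
    by rewrite !inE => /andP[_ ->].
  (* Once its edges are deleted [v] spans nothing, so the count may be made on [A :\ v], to which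
     the hypothesis applies. *)
  have := hA (A :\ v); rewrite !inE xA yA eqxx /=.
  have [/andP[-> _] /andP[-> _]] : (x != v) && (x \in S) /\ (y != v) && (y \in S).
    by move: xS yS; rewrite !inE.
  rewrite /tight_set => /(_ isT isT isT) nt.
  have : inside (gedge x y a |: E :\: edges_at E v) A \subset
         gedge x y a |: inside E (A :\ v).
    apply/subsetP=> e /setIdP[/setU1P[->|]]; first by rewrite !inE eqxx.
    rewrite !inE => /andP[+ eE]; rewrite eE /= subsetD1 => -> ->.
    by rewrite orbT.
  move/subset_leq_card; rewrite cardsU1; move: (_ \notin inside E _) => b.
  have := leq_b1 b; move: (nat_of_bool b) => {}b.
  have := subset_leq_card (subsetDl A [set v]). move/negP: nt; rewrite -ltnNge.
  move: #|inside _ _| #|inside E _| #|A| #|A :\ v|; clear; lia.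
Qed.

Lemma tight_set_nbrs S E v x y z a b c A : tight_on S E -> v \in S ->
  edges_at E v = [set gedge v x a; gedge v y b; gedge v z c] ->
  #|edges_at E v| = 3 ->
  x \in A -> y \in A -> z \in A -> v \notin A -> ~ tight_set E A.
Proof.
case=> ES E2 sE vS ev v3 xA yA zA vA tA.
suff: #|edges_at E v| <= 2 by rewrite v3.
apply: (tight_set_deg sE tA vA (edges_atS E v)) => e eE; split.
  by move: eE; rewrite inE => /andP[].
by move: eE; rewrite ev !inE => /orP[/orP[]|] /eqP->; rewrite gedge_sub !inE eqxx
  ?xA ?yA ?zA orbT.
Qed.

Lemma reduce_H2b S E v x z a c : tight_on S E -> v \in S ->
  #|edges_at E v| = 3 -> x != z -> x \in S :\ v -> z \in S :\ v ->
  edges_at E v = [set gedge v x a; gedge v x (~~ a); gedge v z c] ->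
  (forall S' E', #|S'| < #|S| -> tight_on S' E' -> constructible_on S' E') ->
  constructible_on S E.
Proof.
move=> tE vS v3 xz xS zS ev IH; have [ES E2 sE] := tE.
have SC := cardsD1 v S; rewrite vS in SC.
have nt A : x \in A -> z \in A -> v \notin A -> ~ tight_set E A.
  by move=> xA zA; apply: (tight_set_nbrs tE vS ev v3).
have vxz : v \notin [set x; z].
  by move: xS zS; rewrite !inE !(eq_sym v) => /andP[/negPf-> _] /andP[/negPf->].
(* If both parallel edges between [x] and [z] were present, these two vertices would form a tight
   set containing all neighbours of [v]. H2b puts no condition on the gain of the deleted edge, so
   any missing gain [d] will do. *)
have [d dE] : exists d, gedge x z d \notin E.
  apply/existsP; apply: contraT; rewrite negb_exists => /forallP h.
  have {}h d : gedge x z d \in E by have := h d; rewrite negbK.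
  case: (nt [set x; z]); rewrite ?set21 ?set22 // /tight_set cards2 xz.
  have : [set gedge x z true; gedge x z false] \subset inside E [set x; z].
    by apply/subsetP=> e /set2P[] ->; rewrite inE h gedge_sub set21 set22.
  move/subset_leq_card; rewrite cards2.
  have -> : gedge x z true != gedge x z false by apply/eqP=> /gedge_inj[].
  by move: #|inside _ _| => n /=; lia.
have tE' := tight_add_edge tE vS v3 xz xS zS dE nt.
have /IH/(_ tE') cS : #|S :\ v| < #|S| by lia.
have vS' : v \notin S :\ v by rewrite !inE eqxx.
have xzE : gedge x z d \in gedge x z d |: (E :\: edges_at E v) by rewrite !inE eqxx.
have := con_on_H2b c cS vS' xS zS xzE xz.
rewrite setU1K ?inE ?(negPf dE) ?andbF // setD1K //.
rewrite (_ : [set gedge v x false; _; _] = edges_at E v) -?edges_splitK // ev.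
by case: (a); rewrite //= [in RHS](setUC [set gedge v x true]).
Qed.

(** The inverse of H2a prescribes the gain [a (+) b] of the edge to be restored; the last two
    alternatives are the two ways in which adding it can fail. *)
Lemma try_H2a S E v x y z a b c : tight_on S E -> v \in S ->
  #|edges_at E v| = 3 ->  x != y -> z != x -> z != y ->
  x \in S :\ v -> y \in S :\ v -> z \in S :\ v ->
  edges_at E v = [set gedge v x a; gedge v y b; gedge v z c] ->
  (forall S' E', #|S'| < #|S| -> tight_on S' E' -> constructible_on S' E') ->
  [\/ constructible_on S E, gedge x y (a (+) b) \in E |
      exists A, [/\ x \in A, y \in A, v \notin A & tight_set E A]].
Proof.
move=> tE vS v3 xy zx zy xS yS zS ev IH.
have SC := cardsD1 v S; rewrite vS in SC.
case: (boolP (gedge x y (a (+) b) \in E)) => [|abE]; first by constructor 2.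
have [[A hA]|nA] := pselect (exists A, [/\ x \in A, y \in A, v \notin A & tight_set E A]).
  by constructor 3; exists A.
constructor 1.
have tE' : tight_on (S :\ v) (gedge x y (a (+) b) |: (E :\: edges_at E v)).
  by apply: tight_add_edge => // A xA yA vA tA; apply: nA; exists A.
have /IH/(_ tE') cS : #|S :\ v| < #|S| by lia.
have vS' : v \notin S :\ v by rewrite !inE eqxx.
have xyE : gedge x y (a (+) b) \in gedge x y (a (+) b) |: (E :\: edges_at E v).
  by rewrite !inE eqxx.
have := con_on_H2a c cS vS' xS yS zS xyE xy zx zy erefl.
by rewrite setU1K ?inE ?(negPf abE) ?andbF // setD1K // -ev -edges_splitK.
Qed.

(* The gain of each new edge is the sum of the gains of the two edges at [v]
   closing it up, i.e. [v], [x], [y], [z] span a balanced K_4. *)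
Definition balanced_K4 E (x y z : T) (a b c : bool) :=
  [&& gedge x y (a (+) b) \in E, gedge x z (a (+) c) \in E
    & gedge y z (b (+) c) \in E].

(** Although [A] blocks the pair [x], [y], one of the other pairs works. A tight set blocking [x],
    [z] or [y], [z] would unite with [A] to a tight set containing all three neighbours; if both
    other edges were present, [z |: A] would be such a set. *)
Lemma K4_of_tight S E v x y z a b c A : tight_on S E -> v \in S ->
  #|edges_at E v| = 3 ->  x != y -> z != x -> z != y ->
  x \in S :\ v -> y \in S :\ v -> z \in S :\ v ->
  edges_at E v = [set gedge v x a; gedge v y b; gedge v z c] ->
  (forall S' E', #|S'| < #|S| -> tight_on S' E' -> constructible_on S' E') ->
  x \in A -> y \in A -> v \notin A -> tight_set E A -> constructible_on S E.
Proof.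
move=> tE vS v3 xy zx zy xS yS zS ev IH xA yA vA tA; have [ES E2 sE] := tE.
have nt := tight_set_nbrs tE vS ev v3.
have zA : z \notin A by apply/negP=> zA; exact: (nt A).
have vz : v != z by move: zS; rewrite !inE eq_sym => /andP[].
have ev1 : edges_at E v = [set gedge v x a; gedge v z c; gedge v y b].
  by rewrite ev setUAC.
have ev2 : edges_at E v = [set gedge v y b; gedge v z c; gedge v x a].
  by rewrite ev -setUA setUC.
have nB w B : (w = x \/ w = y) -> w \in B -> z \in B -> v \notin B -> ~ tight_set E B.
  move=> wxy wB zB vB tB.
  have wA : w \in A by case: wxy => ->.
  have [tU _] := tight_setU sE tA tB wA wB.
  by apply: (nt (A :|: B)); rewrite ?inE ?xA ?yA ?zB ?orbT // negb_or vA.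
have xz : x != z by rewrite eq_sym.
have yz : y != z by rewrite eq_sym.
have yx : y != x by rewrite eq_sym.
have [//| xzE | [B [xB zB vB tB]]] := try_H2a tE vS v3 xz yx yz xS zS yS ev1 IH; last first.
  by case: (nB x B); auto.
have [//| yzE | [B [yB zB vB tB]]] := try_H2a tE vS v3 yz xy xz yS zS xS ev2 IH; last first.
  by case: (nB y B); auto.
case: (nt (z |: A)); rewrite ?inE ?xA ?yA ?eqxx ?orbT // ?negb_or ?vz //.
apply: (@tight_set_add _ _ _ _ [set gedge x z (a (+) c); gedge y z (b (+) c)]) => //.
- by apply/subsetP=> e /set2P[] ->.
- by move=> e /set2P[] ->; rewrite gedge_sub !inE ?xA ?yA eqxx ?orbT.
- rewrite cards2; case: eqP => // /(congr1 (fun e : {set T} * bool => x \in e.1)).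
  by rewrite /= !inE eqxx (negPf xy) (negPf xz).
Qed.

(** Coinciding neighbours lead to the inverse of H2b. For distinct ones a pair blocked by a tight
    set is settled by [K4_of_tight], so failure for all three pairs leaves only the presence of all
    three edges. *)
Lemma deg3_cases S E v : tight_on S E -> v \in S -> #|edges_at E v| = 3 ->
  (forall S' E', #|S'| < #|S| -> tight_on S' E' -> constructible_on S' E') ->
  constructible_on S E \/
  exists x y z a b c, [/\ [/\ x != y, z != x & z != y],
    [/\ x \in S :\ v, y \in S :\ v & z \in S :\ v],
    edges_at E v = [set gedge v x a; gedge v y b; gedge v z c] &
    balanced_K4 E x y z a b c].
Proof.
move=> tE vS v3 IH; have [ES E2 sE] := tE.
have [e1 [e2 [e3 [e12 e31 e32 ev]]]] := cards3 v3.
have [||x [xv xS ex]] := @edges_at_gedge S E v e1 => //; first by rewrite ev !inE eqxx.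
have [||y [yv yS ey]] := @edges_at_gedge S E v e2 => //; first by rewrite ev !inE eqxx orbT.
have [||z [zv zS ez]] := @edges_at_gedge S E v e3 => //; first by rewrite ev !inE eqxx !orbT.
move: ev e12 e31 e32; rewrite ex ey ez.
move: (e1.2) (e2.2) (e3.2) => a b c ev e12 e31 e32.
have neg (d e : bool) : d != e -> e = ~~ d by case: d e => [] [].
have [exy|xy] := eqVneq x y.
  rewrite -exy in ev e12 e32; left; have ba : b = ~~ a.
    by apply: neg; apply: contraNneq e12 => ->.
  rewrite ba in ev; apply: (reduce_H2b tE vS v3 _ xS zS ev IH).
  apply/eqP=> xz; move: e31 e32; rewrite -xz ba.
  by case: (a); case: (c); rewrite eqxx.
have [ezx|zx] := eqVneq z x.
  rewrite ezx in ev e31 e32 *; left; have ca : c = ~~ a.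
    by apply: neg; apply: contraNneq e31 => ->.
  rewrite ca setUAC in ev; exact: (reduce_H2b tE vS v3 xy xS yS ev IH).
have [ezy|zy] := eqVneq z y.
  rewrite ezy in ev e31 e32 *; left; have cb : c = ~~ b.
    by apply: neg; apply: contraNneq e32 => ->.
  rewrite cb -setUA setUC in ev; apply: (reduce_H2b tE vS v3 _ yS xS ev IH).
  by rewrite eq_sym.
have ev1 : edges_at E v = [set gedge v x a; gedge v z c; gedge v y b].
  by rewrite ev setUAC.
have ev2 : edges_at E v = [set gedge v y b; gedge v z c; gedge v x a].
  by rewrite ev -setUA setUC.
have xz : x != z by rewrite eq_sym.
have yz : y != z by rewrite eq_sym.
have yx : y != x by rewrite eq_sym.
have [|h1|[A [? ? ? ?]]] := try_H2a tE vS v3 xy zx zy xS yS zS ev IH; first by left.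
  have [|h2|[A [? ? ? ?]]] := try_H2a tE vS v3 xz yx yz xS zS yS ev1 IH; first by left.
    have [|h3|[A [? ? ? ?]]] := try_H2a tE vS v3 yz xy xz yS zS xS ev2 IH; first by left.
      by right; exists x, y, z, a, b, c; split=> //; rewrite /balanced_K4 h1 h2.
    by left; apply: (@K4_of_tight S E v y z x b c a A).
  by left; apply: (@K4_of_tight S E v x z y a c b A).
by left; apply: (@K4_of_tight S E v x y z a b c A).
Qed.

End Reductions.

(** * Contraction of a K_4 and of an edge of a triangle *)

Definition collapse (T : finType) (K : {set T}) (w x : T) : T :=
  if x \in K then w else x.

Section Contractions.
Local Open Scope nat_scope.
Local Open Scope set_scope.
Variable T : finType.
Implicit Types (E F X : {set {set T} * bool}) (A B S K : {set T}).

Lemma collapse_id K w e : e.1 :&: K = set0 -> map_edge (collapse K w) e = e.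
Proof.
case: e => s a /= sK; congr (_, _); rewrite /= imset_id_in // => x xs.
rewrite /collapse; case: ifP => // xK.
by have : x \in s :&: K by [rewrite inE xs xK]; rewrite sK inE.
Qed.

Lemma card_cover2 A K w : w \in A -> w \in K -> #|A :|: K| + 1 <= #|A| + #|K|.
Proof.
move=> wA wK; have := cardsUI A K; suff : 0 < #|A :&: K| by lia.
by rewrite card_gt0; apply/set0Pn; exists w; rewrite inE wA.
Qed.

(** [F] is the set of surviving edges, and injectivity on [F] says that no two of them are
    identified. Sparsity is inherited from [E] for sets without [w], whose preimage avoids [K]; only
    sets containing [w], whose preimage swallows [K], need a hypothesis. *)
Lemma collapse_tight S E K w F : tight_on S E -> w \in K -> K \subset S ->
  F \subset E -> (forall e, e \in F -> ~~ (e.1 \subset K)) ->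
  {in F &, injective (map_edge (collapse K w))} ->
  #|E| + 2 = #|F| + 2 * #|K| ->
  (forall A, w \in A -> #|inside F (A :|: K)| + 2 <= 2 * #|A|) ->
  tight_on (S :\: (K :\ w)) [set map_edge (collapse K w) e | e in F].
Proof.
move=> [ES E2 sE] wK KS FE FK Finj cF hA.
have cS : #|S :\: (K :\ w)| + #|K| = #|S| + 1.
  have : K :\ w \subset S by apply: subset_trans (subsetDl _ _) KS.
  move=> sub; have := cardsD S (K :\ w); rewrite (setIidPr sub).
  have := subset_leq_card sub; have := cardsD1 w K; rewrite wK.
  move: #|K| #|S| #|K :\ w| #|_ :\: _|; clear; lia.
split.
- move=> _ /imsetP[e eF ->]; have [e2 eS] := ES _ (subsetP FE _ eF).
  have [x [y [xy ee]]] := edge_ends e2; have := FK _ eF.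
  rewrite ee gedge_sub map_edge_gedge gedge_sub negb_and => nK.
  have xS : x \in S by apply: (subsetP eS); rewrite ee !inE eqxx.
  have yS : y \in S by apply: (subsetP eS); rewrite ee !inE eqxx orbT.
  have wS := subsetP KS _ wK.
  rewrite /collapse; split; last first.
    by apply/andP; split; case: ifP => h; rewrite !inE ?eqxx ?wS ?h ?xS ?yS ?andbF.
  rewrite cards2; case: ifP => hx; case: ifP => hy; rewrite ?xy //.
  + by rewrite hx hy in nK.
  + by rewrite (_ : w != y) //; apply: contraFneq hy => <-.
  + by rewrite (_ : x != w) //; apply: contraFneq hx => ->.
- rewrite (card_in_imset Finj); move: cF E2 cS.
  by move: #|K| #|F| #|E| #|S| #|_ :\: _|; clear; lia.
- move=> A A0.
  have sub : inside [set map_edge (collapse K w) e | e in F] A \subset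
      [set map_edge (collapse K w) e | e in inside F (collapse K w @^-1: A)].
    apply/subsetP=> _ /setIdP[/imsetP[e eF ->]]; rewrite sub_imset_pre => eA.
    by apply: imset_f; rewrite inE eF.
  have {sub} := leq_trans (subset_leq_card sub) (leq_imset_card _ _).
  have [wA|wA] := boolP (w \in A).
    rewrite (_ : _ @^-1: A = A :|: K); last first.
      apply/setP=> x; rewrite !inE /collapse; case: ifP => h; rewrite ?wA ?orbT ?orbF //.
    by move=> h; apply: leq_trans (hA _ wA); rewrite leq_add2r.
  rewrite (_ : _ @^-1: A = A :\: K); last first.
    by apply/setP=> x; rewrite !inE /collapse; case: ifP; rewrite ?(negPf wA) ?andbF.
  move=> h; apply: leq_trans (sE _ A0); rewrite leq_add2r; apply: leq_trans h _.
  by apply: insideS => //; apply: subsetDl.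
Qed.

(** Sparsity allows [2 * 4 - 2 = 6] edges on four vertices, so the six edges of gain [false] are all
    of them. *)
Lemma K4_edges E (k : 'I_4 -> T) : sparse E -> injective k ->
  (forall i j, i != j -> gedge (k i) (k j) false \in E) ->
  inside E [set k i | i : 'I_4] =
    [set e | [exists i, exists j, (i != j) && (e == gedge (k i) (k j) false)]]
  /\ #|inside E [set k i | i : 'I_4]| = 6.
Proof.
move=> sE ki kE; set K := imset _ _.
pose D := [set A : {set 'I_4} | #|A| == 2].
have D6 : #|D| = 6.
  have := cards_draws [set: 'I_4] 2; rewrite cardsT card_ord => h; transitivity 'C(4, 2) => //; rewrite -h.
  by apply: eq_card => A; rewrite !inE subsetT.
pose g (A : {set 'I_4}) := (k @: A, false).
have gi : injective g by move=> A B [] /(imset_inj ki).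
have K4 : #|K| = 4 by rewrite card_imset // card_ord.
have K0 : K != set0 by rewrite -card_gt0 K4.
have gE : [set g A | A in D] =
    [set e | [exists i, exists j, (i != j) && (e == gedge (k i) (k j) false)]].
  apply/setP=> e; rewrite inE; apply/imsetP/existsP.
    case=> A; rewrite inE => /cards2P[i [j [ij ->]]] ->.
    by exists i; apply/existsP; exists j; rewrite ij /g imsetU !imset_set1 eqxx.
  case=> i /existsP[j /andP[ij /eqP->]]; exists [set i; j].
    by rewrite inE cards2 ij.
  by rewrite /g imsetU !imset_set1.
have sub : [set g A | A in D] \subset inside E K.
  rewrite gE; apply/subsetP=> e; rewrite inE => /existsP[i /existsP[j /andP[ij /eqP->]]].
  by rewrite inE kE // gedge_sub !imset_f.
have c6 : #|[set g A | A in D]| = 6 by rewrite card_imset.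
have := sE _ K0; rewrite K4 => le6.
have eq : [set g A | A in D] = inside E K.
  by apply/eqP; rewrite eqEcard sub c6 -(leq_add2r 2).
by rewrite -eq c6 gE.
Qed.

(** No outside vertex sends two edges of the same gain to the K_4: this is what keeps edges distinct
    under its contraction. *)
Lemma reduce_K4 S E (k : 'I_4 -> T) : tight_on S E -> injective k ->
  (forall i, k i \in S) ->
  (forall i j, i != j -> gedge (k i) (k j) false \in E) ->
  (forall u i j a, u \notin [set k i | i : 'I_4] -> gedge u (k i) a \in E ->
     gedge u (k j) a \in E -> i = j) ->
  (forall S' E', #|S'| < #|S| -> tight_on S' E' -> constructible_on S' E') ->
  constructible_on S E.
Proof.
move=> tE ki kS kE nd IH; have [ES E2 sE] := tE.
have [iE i6] := K4_edges sE ki kE.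
set K := [set k i | i : 'I_4] in iE i6 nd *.
have K4 : #|K| = 4 by rewrite card_imset // card_ord.
have wK : k ord0 \in K by apply: imset_f.
set w := k ord0 in wK *.
have KS : K \subset S by apply/subsetP=> _ /imsetP[i _ ->].
pose F := E :\: inside E K; pose phi := collapse K w.
have FE : F \subset E by apply: subsetDl.
have iKE : inside E K \subset E by apply/subsetP=> e; rewrite inE => /andP[].
have FK e : e \in F -> ~~ (e.1 \subset K).
  by rewrite !inE negb_and => /andP[/orP[/negPf->|]].
have phiK x : x \in K -> phi x = w by rewrite /phi /collapse => ->.
have phiN x : x \notin K -> phi x = x by rewrite /phi /collapse => /negPf->.
have kK i : k i \in K by apply: imset_f.
have Fshape e : e \in F -> e.1 :&: K = set0 \/
    exists u i, [/\ u \notin K, e = gedge u (k i) e.2 & map_edge phi e = gedge u w e.2].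
  move=> eF; have [e2 _] := ES _ (subsetP FE _ eF).
  have [x [y [xy ee]]] := edge_ends e2; have := FK _ eF; rewrite ee gedge_sub.
  have [xK|xK] := boolP (x \in K); have [yK|yK] //= := boolP (y \in K) => _.
  - right; case/imsetP: xK => i _ xi; exists y, i; split=> //; first by rewrite -xi gedgeC.
    by rewrite map_edge_gedge (phiK x) ?(phiN y) // ?xi // gedgeC.
  - right; case/imsetP: yK => i _ yi; exists x, i; split=> //; first by rewrite -yi.
    by rewrite map_edge_gedge (phiK y) ?(phiN x) // yi.
  - left; apply/setP=> z; rewrite !inE; apply/negP=> /andP[/orP[] /eqP->].
      exact/negP.
    exact/negP.
have Finj : {in F &, injective (map_edge phi)}.
  move=> e f eF fF; have := subsetP FE _ eF; have := subsetP FE _ fF => fE eE.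
  have [eK|[u [i [uK ee ->]]]] := Fshape _ eF; have [fK|[v [j [vK ef ->]]]] := Fshape _ fF.
  - by rewrite !collapse_id.
  - rewrite collapse_id // => h; have : w \in e.1 :&: K by rewrite inE wK h !inE eqxx orbT.
    by rewrite eK inE.
  - rewrite collapse_id // => h; have : w \in f.1 :&: K by rewrite inE wK -h !inE eqxx orbT.
    by rewrite fK inE.
  - rewrite (gedgeC u) (gedgeC v) => /gedge_inj[uv ab].
    rewrite ee ef ab uv; congr (gedge _ (k _) _); apply: (nd v i j f.2 vK).
      by rewrite -uv -ab -ee.
    by rewrite -ef.
have cF : #|E| = #|F| + 6.
  by have := cardsID (inside E K) E; rewrite (setIidPr iKE) i6 addnC.
have tE' : tight_on (S :\: (K :\ w)) [set map_edge phi e | e in F].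
  apply: (collapse_tight tE wK KS FE FK Finj); first by rewrite cF K4; lia.
  (* Adding [K] to [A] costs at most three vertices, hence 6 in the bound, and the six edges of [K]
     are missing from [F]. *)
  move=> A wA; have U0 : A :|: K != set0 by apply/set0Pn; exists w; rewrite inE wA.
  have := sE _ U0; have := card_cover2 wA wK; rewrite K4.
  have : #|inside F (A :|: K)| + 6 <= #|inside E (A :|: K)|.
    rewrite -i6 -cardsUI (_ : _ :&: _ = set0) ?cards0 ?addn0; last first.
      apply/setP=> e; rewrite !inE; case: (e \in E); rewrite ?andbF //=.
      by case: (e.1 \subset K); rewrite ?andbF.
    apply/subset_leq_card/subsetP=> e; rewrite !inE.
    case: (e \in E); rewrite ?andbF //= => /orP[/andP[]//|] h.
    exact: subset_trans h (subsetUr _ _).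
  by move: #|inside F _| #|inside E _| #|A :|: K| #|A|; clear; lia.
have wS : w \in S :\: (K :\ w) by rewrite !inE eqxx (subsetP KS).
have lt : #|S :\: (K :\ w)| < #|S|.
  have [_ + _] := tE'; rewrite (card_in_imset Finj); move: E2; rewrite cF.
  move: #|F| #|S| #|_ :\: _|; clear; lia.
have kn i : k i \notin (S :\: (K :\ w)) :\ w.
  by rewrite !inE kK; case: eqP.
(* By [nd] there is at most one such [i] for [u] outside [K]; the default is taken only where there
   is no edge. *)
pose att u a := odflt ord0 [pick i | gedge u (k i) a \in E].
have attP u i a : u \notin K -> gedge u (k i) a \in E -> att u a = i.
  move=> uK iE'; rewrite /att; case: pickP => [j jE /=|/(_ i)]; last by rewrite iE'.
  exact: nd uK jE iE'.
have := con_on_K4 att (IH _ _ lt tE') wS (fun e h => (let: And3 h' _ _ := tE' in h' e h).1) ki kn.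
congr (constructible_on _ _).
  apply/setP=> x; rewrite !inE; have [xK|xK] /= := boolP (x \in K).
    by rewrite orbT (subsetP KS).
  by rewrite andbF orbF /= (_ : x != w) //; apply: contraNneq xK => ->.
rewrite -iE; apply/setP=> e; apply/idP/idP => [|eE].
  rewrite in_setU => /orP[|]; last first.
    rewrite inE => /existsP[x /and3P[xw /eqP ee /imsetP[e' e'F]]].
    have e'E := subsetP FE _ e'F.
    have [e'K|[u [i [uK ee' ->]]]] := Fshape _ e'F.
      rewrite collapse_id // => h; have : w \in e'.1 :&: K by rewrite inE wK -h !inE eqxx orbT.
      by rewrite e'K inE.
    rewrite (gedgeC x) (gedgeC u) => /gedge_inj[xu ab].
    rewrite ee' -ab -xu in e'E; rewrite -xu in uK.
    rewrite [e]surjective_pairing ee (attP x i) //.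
  rewrite in_setU => /orP[|/(subsetP iKE)//].
  rewrite inE => /andP[/imsetP[e' e'F ->]]; have e'E := subsetP FE _ e'F.
  have [e'K|[u [i [uK ee' ->]]]] := Fshape _ e'F; first by rewrite collapse_id.
  by rewrite !inE eqxx orbT.
rewrite in_setU in_setU; have [eK|eK] := boolP (e \in inside E K); first by rewrite orbT.
rewrite orbF; have eF : e \in F by rewrite inE eK.
have [e'K|[u [i [uK ee' pe]]]] := Fshape _ eF.
  rewrite [e \in finset _]inE -{1}(collapse_id w e'K) imset_f //= (_ : w \notin e.1) //.
  by apply/negP=> h; have : w \in e.1 :&: K by [rewrite inE h]; rewrite e'K inE.
apply/orP; right; rewrite inE; apply/existsP; exists u.
rewrite (_ : u != w); last by apply: contraNneq uK => ->.
by rewrite (attP u i) // -?ee' // {1}ee' eqxx -pe imset_f.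
Qed.

(* The contraction of [u] into [x] undoes a vertex splitting with [v_2 = y]. As a
   splitting moves all the parallel edges to a neighbour together, common
   neighbours other than [y] have to be excluded whatever the gains are. *)
Lemma reduce_split S E K u x y : tight_on S E -> tight_set E K ->
  u \in S -> x \in K -> y \in K -> x \in S -> y \in S -> u \notin K -> x != y ->
  gedge u x false \in E -> gedge u y false \in E -> gedge x y false \in E ->
  (forall w a b, w != y -> gedge u w a \in E -> gedge x w b \in E -> false) ->
  (forall S' E', #|S'| < #|S| -> tight_on S' E' -> constructible_on S' E') ->
  constructible_on S E.
Proof.
move=> tE tK uS xK yK xS yS uK xy uxE uyE xyE nc IH; have [ES E2 sE] := tE.
have ux : u != x by apply: contraNneq uK => ->.
have uy : u != y by apply: contraNneq uK => ->.
have uxy : gedge u x false != gedge u y false.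
  by apply: contraNneq xy => /gedge_inj[->].
(* As [K] is tight, [u] sends only two edges into it, those to [x] and [y]. *)
have u2 w a : w \in K -> gedge u w a \in E ->
    gedge u w a = gedge u x false \/ gedge u w a = gedge u y false.
  move=> wK waE; have [->|n1] := eqVneq (gedge u w a) (gedge u x false); first by left.
  have [->|n2] := eqVneq (gedge u w a) (gedge u y false); first by right.
  have := @tight_set_deg _ E K u
    (gedge u w a |: [set gedge u x false; gedge u y false]) sE tK uK.
  rewrite cardsU1 cards2 !inE negb_or n1 n2 uxy => h; suff: 3 <= 2 by []; apply: h.
    by apply/subsetP=> e /setU1P[->//|/set2P[]->].
  by move=> e /setU1P[->|/set2P[]->]; rewrite gedge_sub !inE eqxx ?wK ?xK ?yK ?orbT.
pose C := [set u; x]; pose phi := collapse C x.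
(* Under the contraction the edge from [u] to [x] disappears and the one from [u] to [y] coincides
   with the one from [x] to [y], so both are left out. *)
pose F := E :\: [set gedge u x false; gedge u y false].
have FE : F \subset E by apply: subsetDl.
have CS : C \subset S by apply/subsetP=> z /set2P[]->.
have xC : x \in C by rewrite set22.
have Fu e : e \in F -> u \in e.1 -> exists q,
    [/\ q != u, q != x, q != y, e = gedge u q e.2 & map_edge phi e = gedge x q e.2].
  move=> eF ue; have eE := subsetP FE _ eF; have [e2 _] := ES _ eE.
  have [q qu ee] := edge_at e2 ue.
  move: (eF); rewrite !inE negb_or => /andP[/andP[nx ny] _].
  have nq z : z \in K -> q != z.
    move=> zK; apply/eqP=> qz; rewrite qz in ee.
    have := u2 z e.2 zK; rewrite -ee eE => /(_ isT)[] h; [move: nx|move: ny];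
      by rewrite h eqxx.
  have [qx qy] := (nq x xK, nq y yK); exists q; split=> //.
  rewrite {1}ee map_edge_gedge /phi /collapse !inE eqxx (negPf qu) (negPf qx) //.
have Fn e : e \in F -> u \notin e.1 -> map_edge phi e = e.
  move=> eF ue; case: e eF ue => s a _ /= us; congr (_, _); rewrite /= imset_id_in // => z zs.
  rewrite /phi /collapse !inE; case: eqP => [zu|_] /=; first by rewrite -zu zs in us.
  by case: eqP => [->|].
have FC e : e \in F -> ~~ (e.1 \subset C).
  move=> eF; have eE := subsetP FE _ eF; have [e2 _] := ES _ eE.
  have [ue|ue] := boolP (u \in e.1).
    have [q [qu qx qy ee _]] := Fu _ eF ue.
    rewrite ee; apply/subsetPn; exists q; first by rewrite set22.
    by rewrite !inE negb_or qu.
  apply/negP=> eC; have : e.1 \subset [set x].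
    apply/subsetP=> z ze; have := subsetP eC _ ze; rewrite !inE => /orP[/eqP zu|//].
    by rewrite -zu ze in ue.
  by move/subset_leq_card; rewrite e2 cards1.
have Finj : {in F &, injective (map_edge phi)}.
  suff H e f : e \in F -> f \in F -> u \in e.1 -> map_edge phi e = map_edge phi f -> e = f.
    move=> e f eF fF h; have [ue|ue] := boolP (u \in e.1); first exact: H.
    have [uf|uf] := boolP (u \in f.1); first by apply/esym/H.
    by move: h; rewrite !Fn.
  move=> eF fF ue; have [q [qu qx qy ee ->]] := Fu _ eF ue.
  have [uf|uf] := boolP (u \in f.1).
    have [q' [_ _ _ ef ->]] := Fu _ fF uf => /gedge_inj[qq ab].
    by rewrite ee ef qq ab.
  rewrite Fn // => h; have := nc q e.2 e.2 qy; rewrite -ee h.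
  by rewrite (subsetP FE _ eF) (subsetP FE _ fF) => /(_ isT isT).
have cF : #|E| = #|F| + 2.
  have sub : [set gedge u x false; gedge u y false] \subset E.
    by apply/subsetP=> e /set2P[]->.
  by rewrite -(cardsID [set gedge u x false; gedge u y false] E) (setIidPr sub)
    cards2 uxy addnC.
have C2 : #|C| = 2 by rewrite cards2 ux.
have tE' : tight_on (S :\: (C :\ x)) [set map_edge phi e | e in F].
  have cE : #|E| + 2 = #|F| + 2 * #|C| by rewrite C2 cF -addnA.
  apply: (collapse_tight tE xC CS FE FC Finj cE) => A xA.
  have -> : A :|: C = u |: A.
    apply/setP=> z; rewrite !inE; case: (eqVneq z x) => [->|_].
      by rewrite xA !orbT.
    by rewrite orbF orbC.
  have A0 : A != set0 by apply/set0Pn; exists x.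
  have U0 : u |: A != set0 by apply/set0Pn; exists u; rewrite !inE eqxx.
  have [uA|uA] := boolP (u \in A).
    apply: leq_trans (sE _ A0); rewrite leq_add2r (setUidPr _) ?sub1set //.
    exact: insideS.
  have := sE _ U0; rewrite cardsU1 uA.
  (* With [y] in [A] both removed edges lie in [u |: A] and pay for [u]. Otherwise only one does,
     and the missing unit comes from [u |: A] not being tight: else the edge from [u] to [y] would
     cross between it and [K]. *)
  have [yA|yA] := boolP (y \in A).
    have : #|inside F (u |: A)| + 2 <= #|inside E (u |: A)|.
      have -> : inside F (u |: A) =
          inside E (u |: A) :\: [set gedge u x false; gedge u y false].
        by apply/setP=> e; rewrite !inE andbA.
      rewrite -(cardsID [set gedge u x false; gedge u y false] (inside E (u |: A))).
      rewrite addnC leq_add2r (setIidPr _) ?cards2 ?uxy //.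
      by apply/subsetP=> e /set2P[]->; rewrite inE gedge_sub !inE eqxx ?xA ?yA ?orbT ?uxE ?uyE.
    by move: #|inside F _| #|inside E _| #|A|; clear; lia.
  have : ~~ tight_set E (u |: A).
    apply/negP=> tA; have [|_] := tight_setU sE tA tK (_ : x \in u |: A) xK.
      by rewrite !inE xA orbT.
    move/(_ _ uyE); rewrite !gedge_sub !inE eqxx yK orbT => /(_ isT)[].
      by rewrite (eq_sym y) (negPf uy) (negPf yA).
    by rewrite (negPf uK).
  have : #|inside F (u |: A)| + 1 <= #|inside E (u |: A)|.
    have uxi : gedge u x false \in inside E (u |: A).
      by rewrite inE uxE gedge_sub !inE eqxx xA orbT.
    rewrite (cardsD1 (gedge u x false) (inside E _)) uxi addnC leq_add2l.
    apply/subset_leq_card/subsetP=> e; rewrite !inE negb_or.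
    by move=> /andP[/andP[/andP[-> _] ->] ->].
  rewrite /tight_set cardsU1 uA -ltnNge.
  by move: #|inside F _| #|inside E _| #|A|; clear; lia.
have CE : S :\: (C :\ x) = S :\ u.
  apply/setP=> z; rewrite !inE; case: (eqVneq z x) => [->|_] /=; last by rewrite orbF.
  by rewrite (eq_sym x) (negPf ux).
rewrite CE in tE'.
have lt : #|S :\ u| < #|S| by rewrite (cardsD1 u S) uS.
pose N1 := [set w | [&& w != x, w != y & [exists b, gedge u w b \in E]]].
have FN e q : e \in F -> e = gedge u q e.2 -> q \in N1.
  move=> eF ee; have [|q' [_ qx qy ee' _]] := Fu _ eF; first by rewrite ee !inE eqxx.
  rewrite inE (_ : q = q'); last by move: ee; rewrite ee' => /gedge_inj[->].
  by rewrite qx qy; apply/existsP; exists e.2; rewrite -ee' (subsetP FE).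
have xyF : gedge x y false \in F.
  rewrite inE xyE andbT !inE negb_or; apply/andP; split.
    by apply/eqP; rewrite (gedgeC u) => /gedge_inj[/eqP]; rewrite (eq_sym y) (negPf uy).
  by apply/eqP; rewrite gedgeC (gedgeC u) => /gedge_inj[/eqP]; rewrite (eq_sym x) (negPf ux).
have xyE' : gedge x y false \in [set map_edge phi e | e in F].
  apply/imsetP; exists (gedge x y false) => //; rewrite Fn //.
  by rewrite !inE negb_or ux uy.
have N1F w b : w \in N1 -> gedge u w b \in E -> gedge u w b \in F.
  rewrite inE => /and3P[wx wy _] wE; rewrite inE wE andbT !inE negb_or.
  by apply/andP; split; apply/eqP=> /gedge_inj[/eqP]; rewrite ?(negPf wx) ?(negPf wy).
have N1P w : w \in N1 -> [/\ w \in S :\ u, w != x, w != y &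
    exists b, gedge x w b \in [set map_edge phi e | e in F]].
  move=> wN; move: (wN); rewrite inE => /and3P[wx wy /existsP[b bE]].
  have bF := N1F _ _ wN bE; have [e2 eS] := ES _ bE.
  have wu : w != u by apply/eqP=> wu; move: e2; rewrite wu /gedge /= setUid cards1.
  split=> //.
    by rewrite !inE wu; apply: (subsetP eS); rewrite !inE eqxx orbT.
  exists b; apply/imsetP; exists (gedge u w b) => //.
  rewrite map_edge_gedge /phi /collapse !inE eqxx (negPf wx) (negPf wu) //.
have uS' : u \notin S :\ u by rewrite !inE eqxx.
have xS' : x \in S :\ u by rewrite !inE eq_sym ux.
have yS' : y \in S :\ u by rewrite !inE eq_sym uy.
have yx : y != x by rewrite eq_sym.
have := con_on_split (IH _ _ lt tE') uS' xS' yS' yx xyE' N1P.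
rewrite setD1K //; congr (constructible_on _ _).
have E'P w b : w \in N1 ->
    (gedge x w b \in [set map_edge phi e | e in F]) = (gedge u w b \in E).
  move=> wN; apply/idP/idP => [/imsetP[e eF]|bE].
    have [ue|ue] := boolP (u \in e.1).
      have [q [_ _ _ ee ->]] := Fu _ eF ue => /gedge_inj[-> ->].
      by rewrite -ee (subsetP FE).
    move: (wN); rewrite inE => /and3P[wx wy /existsP[c cE]].
    by rewrite Fn // => h; have := nc w c b wy cE; rewrite h (subsetP FE _ eF) => /(_ isT).
  apply/imsetP; exists (gedge u w b); first exact: N1F.
  have [|q [_ _ _ /gedge_inj[-> _] ->]] := Fu _ (N1F _ _ wN bE) => //.
  by rewrite !inE eqxx.
apply/setP=> e; apply/idP/idP => [|eE].
  case/setUP=> [/setUP[|]|/set2P[]-> //].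
    case/setDP=> /imsetP[e' e'F ->] nm.
    have [ue|ue] := boolP (u \in e'.1); last by rewrite Fn // (subsetP FE).
    have [q [_ _ _ ee' pe]] := Fu _ e'F ue; case/negP: nm.
    rewrite inE imset_f //=; apply/existsP; exists q.
    by rewrite (FN _ _ e'F ee') pe eqxx.
  rewrite inE => /existsP[w /andP[wN /andP[/eqP ee]]].
  by rewrite E'P // [X in _ -> X \in _]surjective_pairing ee.
have [eF|] := boolP (e \in F); last first.
  rewrite !inE eE andbT negbK => h.
  by rewrite -in_set2 in h *; rewrite h orbT.
have [ue|ue] := boolP (u \in e.1).
  have [q [_ _ _ ee _]] := Fu _ eF ue; apply/setUP; left; apply/setUP; right.
  rewrite inE; apply/existsP; exists q; rewrite (FN _ _ eF ee) /= E'P ?(FN _ _ eF ee) // -ee eE.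
  by rewrite {1}ee eqxx.
apply/setUP; left; apply/setUP; left; apply/setDP; split.
  by apply/imsetP; exists e => //; rewrite Fn.
apply/negP; rewrite inE => /andP[_ /existsP[w /andP[wN /eqP ee]]].
move: (wN); rewrite inE => /and3P[wx wy /existsP[c cE]].
by have := nc w c e.2 wy cE; rewrite -ee eE => /(_ isT).
Qed.

End Contractions.

(** * Invariance of tightness and degrees under switching *)

Section Switching.
Local Open Scope nat_scope.
Local Open Scope set_scope.
Variable T : finType.
Implicit Types (E F X : {set {set T} * bool}) (A B S K : {set T}).

Lemma switch_at_inj A : injective (switch_at A).
Proof. exact: (can_inj (switch_atK A)). Qed.

Lemma inside_switch E A B :
  inside [set switch_at A e | e in E] B = [set switch_at A e | e in inside E B].
Proof.
apply/setP=> e; rewrite inE; apply/andP/imsetP => [[/imsetP[f fE ->] fB]|[f]].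
  by exists f => //; rewrite inE fE.
by rewrite inE => /andP[fE fB] ->; split=> //; apply: imset_f.
Qed.

Lemma deg_switch E A v :
  #|edges_at [set switch_at A e | e in E] v| = #|edges_at E v|.
Proof.
rewrite -[RHS](card_imset _ (@switch_at_inj A)); congr #|pred_of_set _|.
apply/setP=> e; rewrite inE; apply/andP/imsetP => [[/imsetP[f fE ->] fB]|[f]].
  by exists f => //; rewrite inE fE.
by rewrite inE => /andP[fE fB] ->; split=> //; apply: imset_f.
Qed.

Lemma tight_switch S E A : tight_on S E -> tight_on S [set switch_at A e | e in E].
Proof.
case=> ES E2 sE; split.
- by move=> _ /imsetP[e /ES ? ->].
- by rewrite card_imset //; apply: switch_at_inj.
- move=> B B0; rewrite inside_switch card_imset; last exact: switch_at_inj.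
  exact: sE.
Qed.

Lemma mem_switch_at E A u v a : u != v ->
  (gedge u v a \in [set switch_at A e | e in E]) =
  (gedge u v (a (+) ((u \in A) (+) (v \in A))) \in E).
Proof.
move=> uv; rewrite -[gedge u v a](switch_atK A).
by rewrite (mem_imset _ _ (@switch_at_inj A)) switch_at_gedge.
Qed.

End Switching.

(** Gains are not mentioned, so that the notion survives switching; injectivity of [fst] excludes
    parallel edges. *)
Definition is_K4 (T : finType) (E : {set {set T} * bool}) (K : {set T}) : Prop :=
  [/\ #|K| = 4%N, #|inside E K| = 6%N & {in inside E K &, injective fst}].

(** * Degrees around a balanced K_4, and discharging *)

Section Discharging.
Local Open Scope nat_scope.
Local Open Scope set_scope.
Variable T : finType.
Implicit Types (E F X : {set {set T} * bool}) (A B S K : {set T}).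

Lemma deg_ge S E x B : tight_on S E -> (forall q, q \in B -> exists a, gedge x q a \in E) ->
  #|B| <= #|edges_at E x|.
Proof.
move=> [ES _ _] hB; pose other (e : {set T} * bool) := odflt x [pick y in e.1 :\ x].
apply: leq_trans (leq_imset_card other _); apply/subset_leq_card/subsetP=> q /hB[a aE].
have [e2 _] := ES _ aE.
apply/imsetP; exists (gedge x q a); first by rewrite !inE aE eqxx.
have xq : q != x by apply/eqP=> qx; move: e2; rewrite qx /gedge /= setUid cards1.
rewrite /other; case: pickP => [y /=|/(_ q)]; last by rewrite !inE xq eqxx orbT.
by rewrite !inE => /andP[/negPf->] /eqP.
Qed.

(** The only obstruction to contracting [u] into [k i] is a common neighbour [w] other than [k j].
    It lies outside the K_4, into which [u] sends just two edges, so [k i] is adjacent to [u], [w]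
    and the three other vertices of the K_4. *)
Lemma split_or_deg S E (k : 'I_4 -> T) u i j : tight_on S E -> injective k ->
  (forall i, k i \in S) ->
  (forall i j, i != j -> gedge (k i) (k j) false \in E) ->
  u \notin [set k i | i : 'I_4] -> i != j ->
  gedge u (k i) false \in E -> gedge u (k j) false \in E ->
  (forall S' E', #|S'| < #|S| -> tight_on S' E' -> constructible_on S' E') ->
  constructible_on S E \/ 5 <= #|edges_at E (k i)|.
Proof.
move=> tE ki kS kE uK ij uiE ujE IH; have [ES E2 sE] := tE.
have [_ i6] := K4_edges sE ki kE; set K := [set k i | i : 'I_4] in i6 uK *.
have kK l : k l \in K by apply: imset_f.
have tK : tight_set E K by rewrite /tight_set i6 card_imset // card_ord.
have uS : u \in S by apply: (subsetP (ES _ uiE).2); rewrite !inE eqxx.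
have kij : k i != k j by rewrite (inj_eq ki).
have [[w [a [b [wj uw iw]]]]|nc] := pselect (exists w a b,
    [/\ w != k j, gedge u w a \in E & gedge (k i) w b \in E]); last first.
  left; apply: (reduce_split tE tK uS (kK i) (kK j) (kS i) (kS j) uK kij uiE ujE) => //.
    exact: kE.
  by move=> w a b wj uw iw; case: nc; exists w, a, b.
right; have neqE p q d : gedge p q d \in E -> q != p.
  move=> /ES[+ _]; apply: contra_eq_neq => ->.
  by rewrite /gedge /= setUid cards1.
have wi := neqE _ _ _ iw; have wu := neqE _ _ _ uw.
have wK : w \notin K.
  apply/negP=> wK; have := @tight_set_deg _ E K u
    (gedge u w a |: [set gedge u (k i) false; gedge u (k j) false]) sE tK uK.
  have gne p q d e : p != q -> gedge u p d != gedge u q e.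
    by apply: contraNneq => /gedge_inj[->].
  rewrite cardsU1 cards2 !inE negb_or !gne // => h; suff: 3 <= 2 by []; apply: h.
    by apply/subsetP=> e /setU1P[->//|/set2P[]->].
  by move=> e /setU1P[->|/set2P[]->]; rewrite gedge_sub !inE eqxx ?wK ?kK ?orbT.
apply: leq_trans (deg_ge (B := u |: (w |: (K :\ k i))) tE _).
  have := cardsD1 (k i) K; rewrite kK card_imset // card_ord !cardsU1 !inE.
  rewrite (eq_sym u) (negPf wu) (negPf wK) (negPf uK) !andbF /= => h.
  by move: h; move: #|_ :\ _|; clear; lia.
move=> q /setU1P[->|/setU1P[->|]]; first by exists false; rewrite gedgeC.
  by exists b.
case/setD1P=> qi /imsetP[l _ ql]; rewrite ql in qi *; exists false; apply: kE.
by rewrite eq_sym -(inj_eq ki).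
Qed.

(** If the K_4 cannot be contracted, some outside [u] has two edges of equal gain to it. The
    resulting triangle allows the contraction of [u] into [k i] or into [k j], and each failure
    gives a vertex of degree at least 5. *)
Lemma K4_normal S E (k : 'I_4 -> T) : tight_on S E -> injective k ->
  (forall i, k i \in S) ->
  (forall i j, i != j -> gedge (k i) (k j) false \in E) ->
  (forall S' E', #|S'| < #|S| -> tight_on S' E' -> constructible_on S' E') ->
  constructible_on S E \/
  2 <= #|[set x in [set k i | i : 'I_4] | 5 <= #|edges_at E x|]|.
Proof.
move=> tE ki kS kE IH; have [ES _ _] := tE; set K := imset _ _.
have [[u [i [j [b [uK uiE ujE ij]]]]]|nd] := pselect (exists u i j b,
   [/\ u \notin K, gedge u (k i) b \in E, gedge u (k j) b \in E & i != j]); last first.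
  left; apply: reduce_K4 tE ki kS kE _ IH => u i j b uK uiE ujE.
  by apply/eqP/contraT=> ij; case: nd; exists u, i, j, b.
(* Switching at [u] brings the gain of its two edges to [false] and leaves the K_4 alone. *)
pose A := if b then [set u] else set0.
have uA : (u \in A) = b by rewrite /A; case: (b); rewrite !inE ?eqxx.
have kA l : (k l \in A) = false.
  rewrite /A; case: (b); rewrite !inE //; apply: contraNF uK => /eqP<-.
  exact: imset_f.
have tE' := tight_switch A tE.
have kE' l m : l != m -> gedge (k l) (k m) false \in [set switch_at A e | e in E].
  by move=> lm; rewrite mem_switch_at ?(inj_eq ki) // !kA kE.
have uk l : u != k l by apply: contraNneq uK => ->; apply: imset_f.
have uE' l : gedge u (k l) b \in E ->
    gedge u (k l) false \in [set switch_at A e | e in E].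
  by rewrite mem_switch_at // uA kA addFb addbF.
have ji : j != i by rewrite eq_sym.
have [h|hi] := split_or_deg tE' ki kS kE' uK ij (uE' _ uiE) (uE' _ ujE) IH.
  by left; apply: con_on_switch_at ES h.
have [h|hj] := split_or_deg tE' ki kS kE' uK ji (uE' _ ujE) (uE' _ uiE) IH.
  by left; apply: con_on_switch_at ES h.
rewrite !deg_switch in hi hj; right.
suff: #|[set k i; k j]| <= #|[set x in K | 5 <= #|edges_at E x|]|.
  by rewrite cards2 (inj_eq ki) ij.
by apply/subset_leq_card/subsetP=> x /set2P[]->; rewrite inE imset_f.
Qed.

Lemma deg3_K4 S E v : tight_on S E -> v \in S -> #|edges_at E v| = 3 ->
  (forall S' E', #|S'| < #|S| -> tight_on S' E' -> constructible_on S' E') ->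
  constructible_on S E \/
  exists K, [/\ is_K4 E K, v \in K & 2 <= #|[set x in K | 5 <= #|edges_at E x|]|].
Proof.
move=> tE vS v3 IH; have [ES _ _] := tE.
have [h|[x [y [z [a [b [c [[xy zx zy] [xS yS zS] ev hK]]]]]]]] := deg3_cases tE vS v3 IH.
  by left.
move: xS yS zS; rewrite !in_setD1 => /andP[xv xS] /andP[yv yS] /andP[zv zS].
have [vx vy vz] : [/\ v != x, v != y & v != z] by rewrite !(eq_sym v).
have [xz yz] : x != z /\ y != z by rewrite !(eq_sym _ z).
(* Switching at the neighbours joined to [v] with gain [true] gives the three edges at [v] gain
   [false], and by balance the other three as well. *)
pose A := [set w | [|| (w == x) && a, (w == y) && b | (w == z) && c]].
have vA : (v \in A) = false by rewrite inE (negPf vx) (negPf vy) (negPf vz).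
have xA : (x \in A) = a by rewrite inE eqxx (negPf xy) (negPf xz) orbF.
have yA : (y \in A) = b by rewrite inE eqxx eq_sym (negPf xy) (negPf yz) orbF.
have zA : (z \in A) = c by rewrite inE eqxx (negPf zx) (negPf zy).
set E' := [set switch_at A e | e in E].
have tE' : tight_on S E' by apply: tight_switch.
have vxE : gedge v x a \in E by apply: (subsetP (edges_atS E v)); rewrite ev !inE eqxx.
have vyE : gedge v y b \in E.
  by apply: (subsetP (edges_atS E v)); rewrite ev !inE eqxx orbT.
have vzE : gedge v z c \in E.
  by apply: (subsetP (edges_atS E v)); rewrite ev !inE eqxx !orbT.
have [xyE xzE yzE] := and3P hK.
pose k (i : 'I_4) := nth v [:: v; x; y; z] i.
have us : uniq [:: v; x; y; z] by rewrite /= !inE !negb_or vx vy vz xy xz yz.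
have ki : injective k.
  by move=> i j /eqP; rewrite nth_uniq //= => /eqP/val_inj.
have kS i : k i \in S.
  have : k i \in [:: v; x; y; z] by apply: mem_nth.
  by rewrite !inE => /or4P[] /eqP->.
have kE : forall i j, i != j -> gedge (k i) (k j) false \in E'.
  suff h (i j : 'I_4) : i < j -> gedge (k i) (k j) false \in E'.
    move=> i j; rewrite -(inj_eq val_inj) neq_ltn => /orP[] /h //.
    by rewrite gedgeC.
  case: i j => [[|[|[|[|//]]]] ?] [[|[|[|[|//]]]] ?] // _;
    by rewrite /k /= mem_switch_at // ?vA ?xA ?yA ?zA ?addFb //.
have [h|h] := K4_normal tE' ki kS kE IH; first by left; apply: con_on_switch_at ES h.
right; exists [set k i | i : 'I_4]; split.
- have [_ _ sE'] := tE'; have [iE i6] := K4_edges sE' ki kE; split.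
  + by rewrite card_imset // card_ord.
  + by rewrite -i6 inside_switch card_imset //; apply: switch_at_inj.
  + move=> e f eK fK ef; apply: (@switch_at_inj _ A); move: ef.
    have : switch_at A e \in inside E' [set k i | i : 'I_4].
      by rewrite inside_switch imset_f.
    have : switch_at A f \in inside E' [set k i | i : 'I_4].
      by rewrite inside_switch imset_f.
    rewrite iE !inE => /existsP[? /existsP[? /andP[_ /eqP h1]]].
    move=> /existsP[? /existsP[? /andP[_ /eqP h2]]] ef.
    rewrite [LHS]surjective_pairing [RHS]surjective_pairing.
    by rewrite (congr1 snd h1) (congr1 snd h2) /= ef.
- by apply/imsetP; exists ord0.
- by move: h; under eq_finset do rewrite deg_switch.
Qed.

Lemma K4_inside S E K B : tight_on S E -> is_K4 E K -> B \subset K ->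
  #|inside E B| <= 'C(#|B|, 2).
Proof.
move=> [ES _ _] [_ _ ifst] BK.
have sub : inside E B \subset inside E K.
  apply/subsetP=> e; rewrite !inE => /andP[->] /= h; exact: subset_trans h BK.
rewrite -(card_in_imset (f := fst) (D := inside E B)); last first.
  by move=> e f /(subsetP sub) eK /(subsetP sub) fK; apply: ifst.
rewrite -cards_draws; apply/subset_leq_card/subsetP=> _ /imsetP[e + ->].
by rewrite !inE => /andP[/ES[-> _] ->].
Qed.

(** At most ['C(3, 2)] of the six edges avoid [x]. *)
Lemma K4_deg S E K x : tight_on S E -> is_K4 E K -> x \in K ->
  3 <= #|edges_at E x :&: inside E K|.
Proof.
move=> tE K4 xK; have [c4 i6 _] := K4.
have cx : #|K :\ x| = 3 by have := cardsD1 x K; rewrite xK c4 add1n => -[<-].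
have := K4_inside tE K4 (subsetDl K [set x]); rewrite cx (_ : 'C(3, 2) = 3) //.
have := i6; rewrite -(cardsID (edges_at E x) (inside E K)).
rewrite (setIC (edges_at E x)) (_ : inside E K :\: edges_at E x = inside E (K :\ x)).
  by move: #|inside E (_ :\ _)| #|_ :&: _|; clear; lia.
apply/setP=> e; rewrite !inE subsetD1.
by case: (e \in E); case: (e.1 \subset K); rewrite ?andbF ?andbT.
Qed.

(* Supermodularity forces two such tight sets with two common vertices to
   share more edges than a proper subset of a K_4 has. *)
Lemma K4_disjoint S E K K' e : tight_on S E -> is_K4 E K -> is_K4 E K' ->
  e \in inside E K -> e \in inside E K' -> K = K'.
Proof.
move=> tE K4 K4' eK eK'; have [c4 i6 _] := K4; have [c4' i6' _] := K4'.
have [ES _ sE] := tE.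
have [eE eI] : e \in E /\ e.1 \subset K :&: K'.
  by move: eK eK'; rewrite !inE subsetI => /andP[-> ->] /andP[_ ->].
have [e2 _] := ES e eE; have := subset_leq_card eI; rewrite e2 => I2.
have h0 : forall f, f \in (set0 : {set {set T} * bool}) ->
    ~~ (f.1 \subset K) /\ ~~ (f.1 \subset K') by move=> f; rewrite inE.
have := @inside_super _ E K K' _ (sub0set _) h0; rewrite cards0 i6 i6' => isup.
have U0 : K :|: K' != set0.
  by rewrite -card_gt0; apply: leq_trans (subset_leq_card (subsetUl _ _)); rewrite c4.
have := sE _ U0; have := cardsUI K K'; rewrite c4 c4'.
have [|lt4] := leqP 4 #|K :&: K'|.
  move=> ge4 _ _; have /eqP <- : K :&: K' == K by rewrite eqEcard subsetIl c4.
  by apply/eqP; rewrite eqEcard subsetIr c4'.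
have := K4_inside tE K4 (subsetIl K K'); move: isup I2 lt4.
move: #|inside E (K :&: K')| #|inside E _| #|K :&: K'| #|K :|: K'|; clear.
have C3 : 'C(3, 2) = 3 by []; have C2 : 'C(2, 2) = 1 by [].
(* With 2 or 3 common vertices the union spans at most 10 or 8 edges and the intersection at most 1
   or 3, which is 11 in either case, while supermodularity asks for 12. *)
by move=> a b [|[|[|[|c]]]] d; rewrite ?C3 ?C2; lia.
Qed.

(* Discharging: a vertex of degree 3 lies in a K_4 with at least two vertices
   of degree at least 5 and so at most two of degree 3, and distinct such K_4's
   share no edge. A vertex of degree at least 5 in [m] of them has degree at least
   [3 m], hence at least [4 + m], so the average degree is at least 4, while
   tightness makes it less than 4. *)
Lemma irreducible_absurd S E : tight_on S E ->
  (forall v, v \in S -> 3 <= #|edges_at E v|) ->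
  (forall v, v \in S -> #|edges_at E v| = 3 ->
    exists K, [/\ is_K4 E K, v \in K & 2 <= #|[set x in K | 5 <= #|edges_at E x|]|]) ->
  False.
Proof.
move=> tE d3 hK; have [ES E2 sE] := tE.
pose D3 := [set v in S | #|edges_at E v| == 3].
have /choice[Kf KfP] : forall v, exists K, v \in D3 ->
    [/\ is_K4 E K, v \in K & 2 <= #|[set x in K | 5 <= #|edges_at E x|]|].
  move=> v; have [|_] := boolP (v \in D3); last by exists set0.
  by rewrite inE => /andP[vS /eqP v3]; have [K KP] := hK v vS v3; exists K.
pose KK := [set Kf v | v in D3].
pose heavy x := 5 <= #|edges_at E x|.
pose m x := #|[set K in KK | x \in K]|.
have KKP K : K \in KK -> is_K4 E K /\ 2 <= #|[set x in K | heavy x]|.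
  by case/imsetP=> v /KfP[? ? ?] ->.
have K4S K : is_K4 E K -> K \subset S.
  move=> K4; apply/subsetP=> x xK; have := K4_deg tE K4 xK.
  case: (set_0Vmem (edges_at E x :&: inside E K)) => [->|[e]]; first by rewrite cards0.
  by rewrite !inE => /andP[/andP[eE xe] _] _; apply: (subsetP (ES _ eE).2).
(* Distinct members of [KK] through [x] use disjoint sets of edges at [x], with at least three in
   each. *)
have h3 x : 3 * m x <= #|edges_at E x|.
  pose P := [set edges_at E x :&: inside E K | K in [set K in KK | x \in K]].
  have Pi : {in [set K in KK | x \in K] &,
      injective (fun K => edges_at E x :&: inside E K)}.
    move=> K K'; rewrite !inE => /andP[/KKP[K4 _] xK] /andP[/KKP[K4' _] xK'] eqI.
    have := K4_deg tE K4 xK.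
    case: (set_0Vmem (edges_at E x :&: inside E K)) => [->|[e eI] _]; first by rewrite cards0.
    have eI' := eI; rewrite eqI in eI'; move: eI eI'; rewrite !in_setI.
    by move=> /andP[_ eK] /andP[_ eK']; exact: (K4_disjoint tE K4 K4' eK eK').
  have tP : trivIset P.
    apply/trivIsetP=> _ _ /imsetP[K + ->] /imsetP[K' + ->].
    rewrite !inE => /andP[/KKP[K4 _] xK] /andP[/KKP[K4' _] xK'] ne.
    rewrite -setI_eq0; apply: contraT => /set0Pn[e]; rewrite !in_setI.
    move=> /andP[/andP[_ eK] /andP[_ eK']]; case/eqP: ne.
    by rewrite (K4_disjoint tE K4 K4' eK eK').
  have cP : cover P \subset edges_at E x.
    by apply/bigcupsP=> _ /imsetP[K _ ->]; apply: subsetIl.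
  apply: leq_trans (subset_leq_card cP); rewrite -(eqP tP).
  rewrite /P big_imset //= mulnC -sum_nat_const; apply: leq_sum => K.
  by rewrite inE => /andP[/KKP[K4 _] xK]; apply: K4_deg tE K4 xK.
(* Double counting of the incidences between heavy vertices and members of [KK]: each member has at
   least two heavy vertices and hence at most two of degree 3. *)
have hD3 : #|D3| <= \sum_(x in S | heavy x) m x.
  apply: (@leq_trans (\sum_(K in KK) #|[set x in K | heavy x]|)); last first.
    rewrite (eq_bigr (fun K : {set T} => \sum_(x in S | heavy x) (x \in K))); last first.
      move=> K /KKP[K4 _]; rewrite -sum1_card big_mkcond [RHS]big_mkcond /=.
      apply: eq_bigr => x _; rewrite inE; case: (boolP (x \in K)) => [xK|_] /=.
        by rewrite (subsetP (K4S _ K4)).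
      by case: ifP.
    rewrite exchange_big /=; apply: leq_sum => x _; rewrite /m -sum1_card.
    rewrite big_mkcond [X in _ <= X]big_mkcond /=; apply: leq_sum => K _.
    by rewrite inE; case: (K \in KK); case: (x \in K).
  apply: (@leq_trans (\sum_(K in KK) #|K :&: D3|)).
    have : D3 \subset \bigcup_(K in KK) (K :&: D3).
      apply/subsetP=> v vD; apply/bigcupP; exists (Kf v); first exact: imset_f.
      by rewrite inE vD; have [_ ->] := KfP v vD.
    move/subset_leq_card/leq_trans; apply.
    apply: (big_ind2 (fun (A : {set T}) n => #|A| <= n)) => //.
      by rewrite cards0.
    by move=> A a B b hA hB; apply: leq_trans (leq_card_setU _ _) (leq_add hA hB).
  apply: leq_sum => K /KKP[[c4 _ _] h2].
  have : #|K :&: D3| + #|[set x in K | heavy x]| <= #|K|.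
    rewrite -cardsUI (_ : _ :&: finset _ = set0) ?cards0 ?addn0; last first.
      apply/setP=> x; rewrite !inE /heavy; apply/negP.
      by move=> /andP[/and3P[_ _ /eqP->] /andP[]].
    by apply/subset_leq_card; rewrite subUset subsetIl; apply/subsetP=> x; rewrite inE => /andP[].
  by rewrite c4; move: h2; move: #|_ :&: _| #|finset _|; clear; lia.
(* From [5 <= d] and [3 * n <= d] follows [4 + n <= d]. After summation [hD3] cancels the charges
   and leaves [4 * #|S| <= 2 * #|E|], against [#|E| + 2 = 2 * #|S|]. *)
have : \sum_(x in S) (4 + (if heavy x then m x else 0)) <=
       \sum_(x in S) (#|edges_at E x| + (x \in D3)).
  apply: leq_sum => x xS; rewrite inE xS /=; have := d3 x xS; have := h3 x.
  rewrite /heavy; move: #|edges_at E x| (m x) => d n.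
  by case: (leqP 5 d) => h5; case: eqP => /=; lia.
rewrite !big_split /= (sum_deg ES) sum_nat_const -big_mkcondr /=.
have -> : \sum_(x in S) (x \in D3) = #|D3|.
  rewrite -sum1_card big_mkcond [RHS]big_mkcond /=; apply: eq_bigr => x _.
  by rewrite inE; case: (x \in S) => //=; case: ifP.
by move: hD3 E2; move: #|E| #|S| #|D3| (\sum_(x in S | heavy x) m x); clear; lia.
Qed.

Theorem tight_constructible_on S E : tight_on S E -> constructible_on S E.
Proof.
have [n] := ubnP #|S|; elim: n S E => // n IHn S E leS tE.
have [_ E2 _] := tE.
have IH S' E' : #|S'| < #|S| -> tight_on S' E' -> constructible_on S' E'.
  by move=> lt; apply: IHn; apply: leq_trans lt leS.
have [S1|S2] := leqP #|S| 1.
  have {}S1 : #|S| = 1 by move: S1 E2; move: #|S| #|E|; clear; lia.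
  have /cards1P[x Sx] : #|S| == 1 by rewrite S1.
  have -> : E = set0 by apply: cards0_eq; move: E2; rewrite S1; move: #|E|; clear; lia.
  by rewrite Sx; apply: con_on_K1.
have [//|nc] := pselect (constructible_on S E); exfalso.
apply: (irreducible_absurd tE) => [v vS|v vS v3].
  have := tight_deg_ge2 tE vS S2; rewrite leq_eqVlt => /orP[/eqP v2|//].
  by case: nc; apply: (reduce_deg2 tE vS (esym v2)).
by have [|] := deg3_K4 tE vS v3 IH.
Qed.

End Discharging.

(** * Constructible gain graphs have realisations with connected colour classes *)

(** The edges spanned by [A] have their support in [A], so the count on edge sets gives the one on
    vertex sets; when [A] spans no edge, its being nonempty suffices. *)
Lemma tight222_constructible (G : gain_graph) :
  (forall e, e \in gedges G -> #|e.1| = 2%N) -> gain_tight222 G -> constructible G.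
Proof.
move=> G2 [E2 sG]; apply: con_on_all; apply: tight_constructible_on; split.
- by move=> e /G2 ->; rewrite finset.subsetT.
- by rewrite cardsT.
- move=> A A0; have [->|F0] := eqVneq (inside (gedges G) A) finset.set0.
    by rewrite cards0; move: A0; rewrite -card_gt0; move: #|A| => [|n] //; lia.
  have sub : inside (gedges G) A \subset gedges G.
    by apply/subsetP=> e; rewrite inE => /andP[].
  apply: leq_trans (sG _ sub F0) _; rewrite leq_mul2l /=; apply/subset_leq_card.
  by apply/bigcupsP=> e; rewrite inE => /andP[].
Qed.

(** * Generic coordinates and small displacements *)

Section Generic.
Variable R : realFieldType.

(* The difference in a coordinate [c] of the points [u] and [a v] of the
   covering framework, [- u] having the coordinate [- c u]. *)
Definition dif (T : Type) (c : T -> R) (u v : T) (a : bool) : R :=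
  c u - (-1) ^+ a * c v.

(** The case [u = v] with [a] true says that the coordinate is nonzero, that is, a point differs
    from its half-turn image. *)
Definition generic (T : eqType) (c : T -> R) : Prop :=
  forall u v a, (u != v) || a -> dif c u v a != 0.

(* For the l^1 norm the derivative of an edge length is, up to sign, the sum of
   the two coordinates if they have the same sign, and their difference
   otherwise. *)
Definition colour (T : Type) (c d : T -> R) (u v : T) (a : bool) : bool :=
  (0 < dif c u v a) == (0 < dif d u v a).

Lemma difC (T : Type) (c : T -> R) u v a : dif c v u a = - (-1) ^+ a * dif c u v a.
Proof. by rewrite /dif; case: a; rewrite ?expr1 ?expr0; ring. Qed.

Lemma pos_sign (x y : R) (a : bool) : x != 0 -> y != 0 ->
  ((0 < (-1) ^+ a * x) == (0 < (-1) ^+ a * y)) = ((0 < x) == (0 < y)).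
Proof.
move=> x0 y0; case: a; rewrite /= ?expr0 ?mul1r // ?expr1 !mulN1r !oppr_gt0.
by case: (ltrgt0P x) x0; case: (ltrgt0P y) y0; rewrite ?eqxx.
Qed.

Lemma colourC (T : eqType) (c d : T -> R) u v a : generic c -> generic d -> u != v ->
  colour c d v u a = colour c d u v a.
Proof.
move=> gc gd uv; rewrite /colour !(difC _ u v).
have -> : - (-1) ^+ a = (-1) ^+ (~~ a) :> R by case: a; rewrite ?expr0 ?expr1 ?opprK.
by rewrite pos_sign ?gc ?gd ?uv.
Qed.

Lemma fin_gap (I : finType) (P : pred I) (F : I -> R) :
  (forall i, P i -> 0 < F i) -> exists2 e, 0 < e & forall i, P i -> e < F i.
Proof.
move=> F0; suff [e e0 h] : exists2 e, 0 < e & forall i, i \in enum I -> P i -> e < F i.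
  by exists e => // i; apply: h; rewrite mem_enum.
elim: (enum I) => [|i s [e e0 IH]]; first by exists 1.
have [Pi|nPi] := boolP (P i); last first.
  by exists e => // j; rewrite inE => /orP[/eqP->|/IH//]; rewrite (negPf nPi).
exists (Num.min e (F i / 2)) => [|j].
  by rewrite lt_min e0 divr_gt0 ?F0.
rewrite inE => /orP[/eqP-> _|js Pj].
  by rewrite gt_min; apply/orP; right; have := F0 _ Pi; lra.
by rewrite gt_min IH.
Qed.

Lemma generic_gap (T : finType) (c : T -> R) : generic c ->
  exists2 e, 0 < e & forall u v a, (u != v) || a -> 8 * e < `|dif c u v a|.
Proof.
move=> gc; have [|e e0 he] := @fin_gap _ (fun t : T * T * bool =>
    (t.1.1 != t.1.2) || t.2) (fun t => `|dif c t.1.1 t.1.2 t.2|).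
  by move=> [[u v] a] /= h; rewrite normr_gt0 gc.
exists (e / 8) => [|u v a h]; first by rewrite divr_gt0.
by rewrite mulrC divfK //; have := he (u, v, a) h.
Qed.

Lemma gt0_near (x y e : R) : 0 < e -> 8 * e < `|x| -> `|y| <= 6 * e ->
  (0 < x + y) = (0 < x) /\ x + y != 0.
Proof.
move=> e0; case: (ltrgt0P x) => [x0|x0|->] ex; rewrite ler_norml => /andP[y1 y2].
- by split; [apply/idP; lra|apply: lt0r_neq0; lra].
- by split; [apply/negbTE; rewrite -leNgt; lra|apply: ltr0_neq0; lra].
- by move: ex; lra.
Qed.

Definition ext1 (T : Type) (c : T -> R) (z : T) (s : bool) (x : R) : option T -> R :=
  ext c ((-1) ^+ s * c z + x).

Lemma dif_ext (T : Type) (c : T -> R) z s x u a :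
  dif (ext1 c z s x) None (Some u) a = (-1) ^+ s * dif c z u (a (+) s) + x.
Proof. by rewrite /dif /=; case: a; case: s; rewrite ?expr1 ?expr0; ring. Qed.

(** The excluded pair is the point that the new one is placed next to; only there does the
    displacement [x] decide the sign. *)
Lemma ext_near (T : finType) (c : T -> R) z s e x : 0 < e ->
  (forall u v a, (u != v) || a -> 8 * e < `|dif c u v a|) -> `|x| = e ->
  forall u a, (u != z) || (a != s) ->
   (0 < dif (ext1 c z s x) None (Some u) a) = (0 < (-1) ^+ s * dif c z u (a (+) s)) /\
   dif (ext1 c z s x) None (Some u) a != 0.
Proof.
move=> e0 he xe u a h; rewrite dif_ext; apply: (gt0_near e0); last first.
  by rewrite xe; lra.
rewrite normrM normrX normrN1 expr1n mul1r; apply: he.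
by rewrite eq_sym; case: (u == z) h => //=; case: a; case: s.
Qed.

Lemma generic_ext (T : finType) (c : T -> R) z s e x : 0 < e -> generic c ->
  (forall u v a, (u != v) || a -> 8 * e < `|dif c u v a|) -> `|x| = e ->
  generic (ext1 c z s x).
Proof.
move=> e0 gc he xe.
have x0 : x != 0 by rewrite -normr_gt0 xe.
have h u a : dif (ext1 c z s x) None (Some u) a != 0.
  have [|] := boolP ((u != z) || (a != s)); first by move/(ext_near e0 he xe) => [].
  rewrite negb_or !negbK => /andP[/eqP-> /eqP->].
  by rewrite dif_ext addbb /dif expr0 mul1r subrr mulr0 add0r.
move=> [u|] [v|] a //.
- exact: gc.
- by rewrite difC mulf_neq0 // oppr_eq0 signr_eq0.
rewrite /= => ->; have h2 := he z z true (orbT _).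
have -> : dif (ext1 c z s x) None None true = (-1) ^+ s * dif c z z true + (x + x).
  by rewrite /dif /= expr1; ring.
apply: (proj2 (gt0_near e0 _ _)).
  by rewrite normrM normrX normrN1 expr1n mul1r.
by apply: le_trans (ler_normD _ _) _; rewrite xe; lra.
Qed.

(* A new point next to the point [s z] inherits its colours. All the moves other
   than vertex-to-K_4 are realised in this way. *)
Lemma clone (T : finType) (c d : T -> R) z s i : generic c -> generic d ->
  exists c' d' : option T -> R, [/\ generic c', generic d',
    forall u v a, colour c' d' (Some u) (Some v) a = colour c d u v a,
    forall u a, (u != z) || (a != s) ->
      colour c' d' None (Some u) a = colour c d z u (a (+) s) &
    colour c' d' None (Some z) s = i].
Proof.
move=> gc gd; have [e1 e10 h1] := generic_gap gc; have [e2 e20 h2] := generic_gap gd.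
(* The first displacement is positive, so the sign of the second one decides the colour towards the
   copied point. *)
pose x2 := if i then e2 else - e2.
have x1e : `|e1| = e1 by rewrite gtr0_norm.
have x2e : `|x2| = e2 by rewrite /x2; case: (i); rewrite ?normrN gtr0_norm.
exists (ext1 c z s e1), (ext1 d z s x2); split=> //.
- exact: generic_ext e10 gc h1 x1e.
- exact: generic_ext e20 gd h2 x2e.
- move=> u a uas; have [H1 _] := ext_near e10 h1 x1e uas.
  have [H2 _] := ext_near e20 h2 x2e uas; rewrite /colour H1 H2 pos_sign //.
    by apply: gc; rewrite eq_sym; case: (u == z) uas => //=; case: (a); case: (s).
  by apply: gd; rewrite eq_sym; case: (u == z) uas => //=; case: (a); case: (s).
- rewrite /colour !dif_ext addbb /dif expr0 !mul1r !subrr !mulr0 !add0r e10.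
  by rewrite /x2; case: (i); rewrite ?e20 // oppr_gt0 ltNge (ltW e20).
Qed.

End Generic.

(** * Moves that add one vertex preserve connected colour classes *)

Section Realizable.
Variable R : realFieldType.
Local Open Scope nat_scope.
Local Open Scope set_scope.

(** Connectivity without paths: a two-valued function that is constant along the edges of the class
    is constant. *)
Definition colour_connected (G : gain_graph) (c d : G -> R) (i : bool) : Prop :=
  forall f : G -> bool,
    (forall u v a, gedge u v a \in gedges G -> colour c d u v a = i -> f u = f v) ->
    forall u v, f u = f v.

Definition simple_edges (G : gain_graph) : Prop :=
  forall e, e \in gedges G -> #|e.1| = 2.

(** An upper bound for the number of edges suffices, as two connected classes give the opposite one.
    It also survives images of the edge set without any injectivity. *)
Definition realizable (G : gain_graph) : Prop :=
  [/\ simple_edges G, #|gedges G| + 2 <= 2 * #|G| &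
      exists c d : G -> R,
        [/\ generic c, generic d & forall i, colour_connected c d i]].

Lemma gedge_neq (G : gain_graph) u v a : simple_edges G ->
  gedge u v a \in gedges G -> u != v.
Proof.
by move=> sG /sG; apply: contra_eq_neq => ->; rewrite /gedge /= setUid cards1.
Qed.

Lemma simple_old (T : finType) (F : {set {set T} * bool}) :
  (forall e, e \in F -> #|e.1| = 2) -> forall e, e \in old_edges F -> #|e.1| = 2.
Proof.
by move=> F2 _ /imsetP[e eF ->]; rewrite /= card_imset ?F2 //; apply: Some_inj.
Qed.

Lemma card_old (T : finType) (F : {set {set T} * bool}) : #|old_edges F| <= #|F|.
Proof. exact: leq_imset_card. Qed.

Lemma card_new (T : finType) (v : T) a : #|(gedge None (Some v) a).1| = 2.
Proof. by rewrite cards2. Qed.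

Lemma card_set2_le (T : finType) (x y : T) : #|[set x; y]| <= 2.
Proof. by rewrite cards2; case: (_ != _). Qed.

Lemma card_set3_le (T : finType) (x y z : T) : #|[set x; y; z]| <= 3.
Proof.
apply: leq_trans (leq_card_setU _ _) _.
by rewrite cards1 addn1 ltnS card_set2_le.
Qed.

Lemma mem_old (T : finType) (F : {set {set T} * bool}) u v a :
  gedge u v a \in F -> gedge (Some u) (Some v) a \in old_edges F.
Proof. exact: mem_map_edgeW. Qed.

Lemma option_const (G : Type) (f : option G -> bool) (w : G) :
  (forall u v, f (Some u) = f (Some v)) -> f None = f (Some w) ->
  forall u v, f u = f v.
Proof. by move=> h fw [u|] [v|] //; rewrite fw. Qed.

Lemma realizable_K1 : realizable K1.
Proof.
split.
- by move=> e; rewrite inE.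
- by rewrite cards0 card_unit.
- exists (fun _ => 1%R), (fun _ => 1%R).
  have g1 : generic (fun _ : K1 => 1%R : R).
    move=> [] [] a /=; rewrite /dif => ->; rewrite expr1 mulN1r opprK.
    by rewrite -mulr2n pnatr_eq0.
  by split=> // i f _ [] [].
Qed.

Lemma realizable_iso G H : gain_iso G H -> realizable G -> realizable H.
Proof.
case=> f fb EH [sG cG [c [d [gc gd cn]]]]; have [g fK gK] := fb.
have fi := can_inj fK; have gi := can_inj gK; split.
- by move=> e; rewrite EH => /imsetP[e' e'E ->]; rewrite /= card_imset // sG.
- rewrite EH; apply: leq_trans (leq_add (leq_imset_card _ _) (leqnn 2)) _.
  by rewrite -(bij_eq_card fb).
- exists (c \o g), (d \o g); split.
  + by move=> u v a h; apply: gc; rewrite (inj_eq gi).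
  + by move=> u v a h; apply: gd; rewrite (inj_eq gi).
  + move=> i h hP u v; rewrite -(gK u) -(gK v); apply: (cn i (h \o f)) => {}u {}v a uv ci.
    apply: hP; first by rewrite EH; apply: mem_map_edgeW uv.
    by rewrite -ci /colour /dif /= !fK.
Qed.

Lemma realizable_switch (G : gain_graph) v : realizable G -> realizable (@switch G v).
Proof.
case=> sG cG [c [d [gc gd cn]]].
(* Switching at [v] exchanges the point of [v] with its half-turn image: both of its coordinates
   change sign. *)
pose s u : R := ((-1) ^+ (u == v))%R.
have difS (e : G -> R) u w a : u != w ->
    dif (fun u => s u * e u)%R u w (if (v == u) || (v == w) then ~~ a else a) =
    (s u * dif e u w a)%R.
  rewrite /dif /s => uw; rewrite !(eq_sym v); move: uw.
  have [->|_] := eqVneq u v; have [->|_] := eqVneq w v; rewrite ?eqxx //= => _;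
    by case: a; rewrite /= ?expr1 ?expr0; ring.
have gen (e : G -> R) : generic e -> generic (fun u => s u * e u)%R.
  move=> ge u w a; have [<-|uw] := eqVneq u w.
    rewrite /= => ->; rewrite /dif expr1 mulN1r opprK -mulrDr mulf_neq0 //.
      by rewrite /s signr_eq0.
    by have := ge u u true (orbT _); rewrite /dif expr1 mulN1r opprK.
  move=> _; pose b := (v == u) || (v == w).
  have -> : a = if b then ~~ (if b then ~~ a else a) else (if b then ~~ a else a).
    by case: (b); rewrite ?negbK.
  by rewrite difS // mulf_neq0 ?ge ?uw // /s signr_eq0.
split.
- by move=> _ /imsetP[e /sG e2 ->].
- exact: leq_trans (leq_add (leq_imset_card _ _) (leqnn 2)) cG.
- exists (fun u => s u * c u)%R, (fun u => s u * d u)%R; split; [exact: gen|exact: gen|].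
  move=> i f hf; apply: (cn i) => u w a uwE ci.
  have uw := gedge_neq sG uwE.
  apply: (hf u w (if (v == u) || (v == w) then ~~ a else a)); last first.
    by rewrite /colour !difS // pos_sign ?gc ?gd ?uw.
  apply/imsetP; exists (gedge u w a) => //.
  by rewrite /switch_edge /gedge /= cards2 uw /= !inE andbT.
Qed.

(** The new vertex is placed next to the copy [a] of [x]. Its edge to [y] inherits a colour and its
    edge to [x] is given the other one, which attaches it in both classes. With [x = y] this is
    H1b. *)
Lemma realizable_H1 (G : gain_graph) (x y : G) a b :
  (x != y) || (a != b) -> realizable G ->
  realizable (@GainGraph (option G) (old_edges (gedges G) :|:
     [set gedge None (Some x) a; gedge None (Some y) b])).
Proof.
move=> xy [sG cG [c [d [gc gd cn]]]].
have [c' [d' [gc' gd' old oth new]]] := clone x a (~~ colour c d x y (b (+) a)) gc gd.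
split.
- move=> e /setUP[/(simple_old sG)//|/set2P[]->]; exact: card_new.
- rewrite /= card_option; have [+ _] := leq_card_setU (old_edges (gedges G))
    [set gedge None (Some x) a; gedge None (Some y) b].
  have := card_old (gedges G).
  have := card_set2_le (gedge None (Some x) a) (gedge None (Some y) b).
  set N := [set _; _]; move: cG.
  move: #|gedges G| #|N| #|_ :|: N| #|old_edges _| #|G|. by clear; lia.
- exists c', d'; split=> // i f hf.
  have fS : forall u v, f (Some u) = f (Some v).
    apply: (cn i (f \o Some)) => u v g uvE ci; apply: (hf _ _ g); last by rewrite old.
    by apply/setUP; left; apply: mem_old uvE.
  have [ei|ei] := eqVneq (colour c d x y (b (+) a)) i.
    apply: (option_const (w := y) fS); apply: (hf _ _ b).
      by rewrite !inE eqxx !orbT.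
    by rewrite oth // (eq_sym y) (eq_sym b).
  apply: (option_const (w := x) fS); apply: (hf _ _ a).
    by rewrite !inE eqxx !orbT.
  by rewrite new; move: ei; case: (colour _ _ _ _ _); case: (i).
Qed.

(** The edges to [x] and [y] get the colour of the deleted edge and replace it by a path, while the
    edge to [z] attaches the new vertex in the other class. With [z = x] and the other gain this is
    H2b. *)
Lemma realizable_H2 (G : gain_graph) (x y z : G) a b c e :
  gedge x y a \in gedges G -> b (+) c = a ->
  (z != x) || (e != b) -> (z != y) || (e != c) -> realizable G ->
  realizable (@GainGraph (option G) (old_edges (gedges G :\ gedge x y a) :|:
     [set gedge None (Some x) b; gedge None (Some y) c; gedge None (Some z) e])).
Proof.
move=> xyE bc zx zy [sG cG [p [q [gp gq cn]]]].
have xy := gedge_neq sG xyE.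
set i := colour p q x y a.
have [p' [q' [gp' gq' old [cx cy cz]]]] : exists p' q' : option G -> R,
  [/\ generic p', generic q',
      forall u v a, colour p' q' (Some u) (Some v) a = colour p q u v a &
      [/\ colour p' q' None (Some x) b = i, colour p' q' None (Some y) c = i
        & colour p' q' None (Some z) e = ~~ i]].
  have nb (s t : bool) : s != t -> s = ~~ t by case: s t => [] [].
  have yx : y != x by rewrite eq_sym.
  have cyx : colour p q y x (b (+) c) = i by rewrite (colourC _ gp gq xy) bc.
  (* Clone [x] or [y] if its colour to [z] is the other one, and [z] itself if
     both have the colour of the deleted edge. *)
  have [xz|xz] := eqVneq (colour p q x z (e (+) b)) i; last first.
    have [p' [q' [? ? ? oth new]]] := clone x b i gp gq.
    exists p', q'; split=> //; split=> //; first by rewrite oth ?yx // addbC bc.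
    by rewrite oth // (nb _ _ xz).
  have [yz|yz] := eqVneq (colour p q y z (e (+) c)) i; last first.
    have [p' [q' [? ? ? oth new]]] := clone y c i gp gq.
    exists p', q'; split=> //; split=> //; first by rewrite oth ?xy.
    by rewrite oth // (nb _ _ yz).
  have [p' [q' [? ? ? oth new]]] := clone z e (~~ i) gp gq.
  have colz w g : (z != w) || (e != g) -> colour p q w z (e (+) g) = i ->
      colour p' q' None (Some w) g = i.
    move=> zw wz; rewrite oth; last by rewrite (eq_sym w) (eq_sym g).
    rewrite -wz addbC; have [zw'|nzw] := eqVneq z w; last by rewrite colourC // eq_sym.
    by rewrite zw'.
  by exists p', q'; split=> //; split=> //; apply: colz.
split.
- move=> f /setUP[|].
    by apply: simple_old => g /setD1P[_ /sG].
  by rewrite !inE => /orP[/orP[]|] /eqP->; apply: card_new.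
- rewrite /= card_option; have [+ _] := leq_card_setU (old_edges (gedges G :\ gedge x y a))
    [set gedge None (Some x) b; gedge None (Some y) c; gedge None (Some z) e].
  have := card_old (gedges G :\ gedge x y a).
  have := card_set3_le (gedge None (Some x) b) (gedge None (Some y) c)
    (gedge None (Some z) e).
  have := cardsD1 (gedge x y a) (gedges G); rewrite xyE.
  set N := [set _; _; _]; move: cG.
  by move: #|_ :\ _| #|gedges G| #|N| #|_ :|: N| #|old_edges _| #|G|; clear; lia.
- exists p', q'; split=> // k f hf.
  have fx : k = i -> f None = f (Some x).
    by move=> ki; apply: (hf _ _ b); rewrite ?cx // !inE eqxx !orbT.
  have fy : k = i -> f None = f (Some y).
    by move=> ki; apply: (hf _ _ c); rewrite ?cy // !inE eqxx !orbT.
  have fz : k = ~~ i -> f None = f (Some z).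
    by move=> ki; apply: (hf _ _ e); rewrite ?cz // !inE eqxx !orbT.
  have fS : forall u v, f (Some u) = f (Some v).
    apply: (cn k (f \o Some)) => u v g uvE ck /=.
    have [uvx|uvx] := eqVneq (gedge u v g) (gedge x y a); last first.
      apply: (hf _ _ g); last by rewrite old ck.
      by apply/setUP; left; apply: mem_old; rewrite !inE uvx.
    have ki : k = i.
      case: uvx ck => /set2_eq[[-> ->]|[-> ->]] -> <- //.
      by rewrite colourC.
    have e1 := fx ki; have e2 := fy ki.
    by case: uvx => /set2_eq[[-> ->]|[-> ->]] _; rewrite -e1 -e2.
  have [ki|ki] := eqVneq k i; first exact: option_const fS (fx ki).
  apply: option_const fS (fz _).
  by move: ki; case: (k); case: (i).
Qed.

(** The new vertex is placed next to [v1], so the moved edges keep their colours. It is connected to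
    [v1] in both classes: by the new edge in one and through [v2] in the other. *)
Lemma realizable_split (G : gain_graph) (v1 v2 : G) a (N1 : {set G}) :
  v2 != v1 -> gedge v1 v2 a \in gedges G -> N1 \subset (neighbours v1 :\ v2) ->
  realizable G -> realizable (vertex_split v1 v2 a N1).
Proof.
move=> v21 v12E N1P [sG cG [p [q [gp gq cn]]]].
set i := colour p q v1 v2 a.
have [p' [q' [gp' gq' old oth new]]] := clone v1 false (~~ i) gp gq.
have N1v x : x \in N1 -> x != v1 /\ x != v2.
  by move/(subsetP N1P); rewrite !inE => /andP[-> /andP[-> _]].
set moved := [set e in gedges G | [exists x in N1, e == gedge v1 x e.2]].
set X := [set e : {set option G} * bool | [exists x in N1,
        (e.1 == [set None; Some x]) && (gedge v1 x e.2 \in gedges G)]].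
have XP e : e \in X -> exists2 x, x \in N1 & e = gedge None (Some x) e.2 /\
    gedge v1 x e.2 \in gedges G.
  rewrite inE => /existsP[x /andP[xN /andP[/eqP ee xE]]]; exists x => //; split=> //.
  by rewrite [LHS]surjective_pairing ee.
split.
- move=> e; rewrite /= -/moved -/X => /setUP[/setUP[|]|].
  + by apply: simple_old => g /setDP[/sG].
  + by case/XP=> x _ [-> _]; apply: card_new.
  + by case/set2P=> ->; apply: card_new.
- rewrite /= -/moved -/X card_option.
  (* Sending the new vertex to [v1] takes its edges back to the edges they replace. *)
  have cX : #|X| <= #|moved|.
    pose g := map_edge (ext (@id G) v1).
    have gX e : e \in X -> exists2 x, e = gedge None (Some x) e.2 & g e = gedge v1 x e.2.
      by case/XP=> x _ [ee _]; exists x => //; rewrite /g {1}ee map_edge_gedge.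
    have gi : {in X &, injective g}.
      move=> e f /gX[x ee ge] /gX[y ef gf]; rewrite ge gf => /gedge_inj[xy ab].
      by rewrite ee ef xy ab.
    rewrite -(card_in_imset gi); apply/subset_leq_card/subsetP=> _ /imsetP[e eX ->].
    have [x xN [ee xE]] := XP e eX; have -> : g e = gedge v1 x e.2.
      by rewrite /g {1}ee map_edge_gedge.
    by rewrite inE xE; apply/existsP; exists x; rewrite xN /=.
  have mE : moved \subset gedges G by apply/subsetP=> e; rewrite inE => /andP[].
  have := cardsD (gedges G) moved; rewrite (setIidPr mE).
  have := subset_leq_card mE; have := card_old (gedges G :\: moved).
  have [+ _] := leq_card_setU (old_edges (gedges G :\: moved)) X.
  have [+ _] := leq_card_setU (old_edges (gedges G :\: moved) :|: X)
    [set gedge None (Some v1) false; gedge None (Some v2) a].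
  have := card_set2_le (gedge None (Some v1) false) (gedge None (Some v2) a).
  set N := [set _; _]; move: cX cG.
  move: #|N| #|_ :|: N| #|_ :|: X| #|X| #|old_edges _|.
  by move: #|_ :\: _| #|moved| #|gedges G| #|G|; clear; lia.
- exists p', q'; split=> // k f; rewrite /= -/moved -/X => hf.
  have f1 : k = ~~ i -> f None = f (Some v1).
    by move=> ki; apply: (hf _ _ false); rewrite ?new // !inE eqxx !orbT.
  have f2 : k = i -> f None = f (Some v2).
    move=> ki; apply: (hf _ _ a); first by rewrite !inE eqxx !orbT.
    by rewrite oth ?v21 // addbF.
  have fo u v g : gedge u v g \in gedges G -> gedge u v g \notin moved ->
      colour p q u v g = k -> f (Some u) = f (Some v).
    move=> uvE nm ck; apply: (hf _ _ g); last by rewrite old ck.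
    by apply/setUP; left; apply/setUP; left; apply: mem_old; rewrite inE nm.
  have v12m : gedge v1 v2 a \notin moved.
    rewrite inE v12E /=; apply/existsP=> -[x /andP[xN /eqP /gedge_inj[xv _]]].
    by have [_] := N1v x xN; rewrite xv eqxx.
  have f01 : f None = f (Some v1).
    have [ki|ki] := eqVneq k i; last by apply: f1; move: ki; case: (k); case: (i).
    by rewrite f2 //; apply/esym/(fo v1 v2 a).
  apply: (option_const _ f01); apply: (cn k (f \o Some)) => u v g uvE ck /=.
  have [|nm] := boolP (gedge u v g \in moved); last exact: fo uvE nm ck.
  rewrite inE uvE => /existsP[x /andP[xN /eqP]]; rewrite [(gedge u v g).2]/= => ee.
  have xE : gedge v1 x g \in gedges G by rewrite -ee.
  have f0x : colour p q v1 x g = k -> f None = f (Some x).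
    move=> cx; have [xv1 _] := N1v x xN; apply: (hf _ _ g).
      apply/setUP; left; apply/setUP; right; rewrite inE; apply/existsP; exists x.
      by rewrite xN eqxx xE.
    by rewrite oth ?xv1 // addbF.
  have uv := gedge_neq sG uvE.
  case: ee => /set2_eq[[uu vv]|[uu vv]]; subst u v; rewrite -f01 f0x //.
  by rewrite -ck colourC // eq_sym.
Qed.

End Realizable.

(** * The vertex-to-K_4 move preserves connected colour classes *)

Section RealizableK4.
Variable R : realFieldType.
Local Open Scope nat_scope.
Local Open Scope set_scope.

(* In the cluster of four points replacing a vertex, the second coordinates are
   ordered as 1, 3, 0, 2. The concordant pairs then form a path, and so do the
   discordant ones. *)
Definition K4_rank (i : 'I_4) : nat := nth 0 [:: 1; 3; 0; 2] i.

Definition cluster (T S : Type) (c : T -> R) (v : T) (g : S -> T) (e : R)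
    (h : 'I_4 -> nat) (z : S + 'I_4) : R :=
  match z with inl x => c (g x) | inr i => (c v + (h i)%:R * e)%R end.

Lemma K4_rank_inj : injective K4_rank.
Proof.
by move=> [[|[|[|[|//]]]] hi] [[|[|[|[|//]]]] hj] //= _; apply: val_inj.
Qed.

Lemma cluster_near (T : finType) (c : T -> R) (v : T) e (h : 'I_4 -> nat) :
  (0 < e)%R -> (forall u v a, (u != v) || a -> 8 * e < `|dif c u v a|)%R ->
  (forall i, h i <= 3) -> generic c -> injective h ->
  let c' := cluster c v (val : {x : T | x != v} -> T) e h in
  [/\ generic c',
      forall i x a, (0 < dif c' (inr i) (inl x) a)%R = (0 < dif c v (val x) a)%R &
      forall i j, (0 < dif c' (inr i) (inr j) false)%R = (h j < h i)].
Proof.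
move=> e0 he h3 gc hi c'.
have hb i : (0 <= (h i)%:R :> R)%R /\ ((h i)%:R <= 3 :> R)%R.
  by rewrite ler0n (ler_nat R _ 3) h3.
have difm i x a : dif c' (inr i) (inl x) a = (dif c v (val x) a + (h i)%:R * e)%R.
  by rewrite /dif /=; ring.
have near i x a : (0 < dif c' (inr i) (inl x) a)%R = (0 < dif c v (val x) a)%R /\
    (dif c' (inr i) (inl x) a != 0)%R.
  rewrite difm; have [h0 h1] := hb i; apply: (gt0_near e0).
    by apply: he; rewrite eq_sym (valP x).
  by rewrite ger0_norm ?mulr_ge0 ?(ltW e0) // ler_wpM2r ?(ltW e0) //; lra.
have difc i j : dif c' (inr i) (inr j) false = (((h i)%:R - (h j)%:R) * e)%R.
  by rewrite /dif /= expr0; ring.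
split=> [[x|i] [y|j] a|i x a|i j].
- by rewrite (inj_eq (@inl_inj _ _)) => ?; apply: gc.
- by move=> _; rewrite difC mulf_neq0 ?(near j x a).2 // oppr_eq0 signr_eq0.
- by move=> _; apply: (near i y a).2.
- rewrite (inj_eq (@inr_inj _ _)); case: a => [_|]; last first.
    rewrite orbF difc => ij; apply: mulf_neq0; last by rewrite gt_eqF.
    by rewrite subr_eq0 eqr_nat (inj_eq hi).
  have -> : dif c' (inr i) (inr j) true =
      (dif c v v true + ((h i)%:R * e + (h j)%:R * e))%R.
    by rewrite /dif /= expr1; ring.
  have [i0 i3] := hb i; have [j0 j3] := hb j.
  apply: (gt0_near e0 _ _).2; first by apply: he; rewrite orbT.
  rewrite ger0_norm ?addr_ge0 ?mulr_ge0 ?(ltW e0) //.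
  by rewrite -mulrDl ler_wpM2r ?(ltW e0) //; lra.
- by rewrite (near i x a).1.
- by rewrite difc pmulr_lgt0 // subr_gt0 ltr_nat.
Qed.

Lemma cluster_clone (T : finType) (c d : T -> R) (v : T) : generic c -> generic d ->
  exists c' d' : ({x : T | x != v} + 'I_4)%type -> R, [/\ generic c', generic d',
    forall x y a, colour c' d' (inl x) (inl y) a = colour c d (val x) (val y) a,
    forall i x a, colour c' d' (inr i) (inl x) a = colour c d v (val x) a &
    forall i j, colour c' d' (inr i) (inr j) false =
      ((j < i) == (K4_rank j < K4_rank i))].
Proof.
move=> gc gd; have [e1 e10 h1] := generic_gap gc; have [e2 e20 h2] := generic_gap gd.
have [|//|gc' nc cc] := cluster_near v e10 h1 (_ : forall i : 'I_4, i <= 3) gc.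
- by move=> i; rewrite -ltnS.
- exact: val_inj.
have [|//|gd' nd cd] := cluster_near v e20 h2 (_ : forall i : 'I_4, K4_rank i <= 3) gd.
- by move=> [[|[|[|[|//]]]] hi].
- exact: K4_rank_inj.
exists (cluster c v (val : {x : T | x != v} -> T) e1 val).
exists (cluster d v (val : {x : T | x != v} -> T) e2 K4_rank).
split=> //.
- by move=> i x a; rewrite /colour nc nd.
- by move=> i j; rewrite /colour cc cd.
Qed.

Lemma realizable_K4 (G : gain_graph) (v : G) (f : {x : G | x != v} -> bool -> 'I_4) :
  realizable R G -> realizable R (@vertex_to_K4 G v f).
Proof.
case=> sG cG [c [d [gc gd cn]]].
have [c' [d' [gc' gd' oo no nn]]] := cluster_clone v gc gd.
pose T : finType := ({x : G | x != v} + 'I_4)%type.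
set X1 := [set e : {set T} * bool | [exists x, exists y,
  (e.1 == [set inl x; inl y]) && (gedge (val x) (val y) e.2 \in gedges G)]].
set X2 := [set e : {set T} * bool | [exists i, exists j,
  (i != j) && (e == gedge (inr i) (inr j) false)]].
set X3 := [set e : {set T} * bool | [exists x,
  (e.1 == [set inl x; inr (f x e.2)]) && (gedge (val x) v e.2 \in gedges G)]].
have GE : gedges (@vertex_to_K4 G v f) = X1 :|: X2 :|: X3 by [].
have P1 e : e \in X1 -> exists x y, e = gedge (inl x) (inl y) e.2 /\
    gedge (val x) (val y) e.2 \in gedges G.
  rewrite inE => /existsP[x /existsP[y /andP[/eqP ee xyE]]]; exists x, y; split=> //.
  by rewrite [LHS]surjective_pairing ee.
have P3 e : e \in X3 -> exists x, e = gedge (inl x) (inr (f x e.2)) e.2 /\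
    gedge (val x) v e.2 \in gedges G.
  rewrite inE => /existsP[x /andP[/eqP ee xE]]; exists x; split=> //.
  by rewrite [LHS]surjective_pairing ee.
have K2 u w a : u != w -> #|(gedge u w a : {set T} * bool).1| = 2.
  by move=> uw; rewrite /gedge /= cards2 uw.
split.
- move=> e; rewrite GE => /setUP[/setUP[|]|].
  + case/P1=> x [y [-> xyE]]; apply: K2; rewrite (inj_eq (@inl_inj _ _)) -val_eqE.
    exact: gedge_neq sG xyE.
  + by rewrite inE => /existsP[i /existsP[j /andP[ij /eqP->]]]; apply: K2.
  + by case/P3=> x [-> _]; apply: K2.
- rewrite GE.
  have c6 : #|X2| <= 6.
    pose D := [set A : {set 'I_4} | #|A| == 2].
    have D6 : #|D| = 6.
      have := cards_draws [set: 'I_4] 2; rewrite cardsT card_ord => h.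
      transitivity 'C(4, 2) => //; rewrite -h; apply: eq_card => A.
      by rewrite !inE finset.subsetT.
    pose g (A : {set 'I_4}) : {set T} * bool := ([set inr x | x in A], false).
    rewrite -D6; apply: leq_trans (leq_imset_card g _); apply/subset_leq_card/subsetP=> e.
    rewrite inE => /existsP[i /existsP[j /andP[ij /eqP->]]].
    apply/imsetP; exists [set i; j]; first by rewrite inE cards2 ij.
    by rewrite /g imsetU !imset_set1.
  have c13 : #|X1 :|: X3| <= #|gedges G|.
    (* Contracting the cluster to [v] recovers the old edges injectively, because the attachment [f]
       depends only on the outer vertex and the gain. *)
    pose q (z : T) := match z with inl x => val x | inr _ => v end.
    have Q e : e \in X1 :|: X3 -> map_edge q e \in gedges G /\
        ((exists x y, e = gedge (inl x) (inl y) e.2 /\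
            map_edge q e = gedge (val x) (val y) e.2) \/
         (exists x, e = gedge (inl x) (inr (f x e.2)) e.2 /\
            map_edge q e = gedge v (val x) e.2)).
      case/setUP=> [/P1[x [y [ee xyE]]]|/P3[x [ee xE]]].
        have qe : map_edge q e = gedge (val x) (val y) e.2 by rewrite {1}ee map_edge_gedge.
        by rewrite qe; split=> //; left; exists x, y.
      have qe : map_edge q e = gedge v (val x) e.2.
        by rewrite {1}ee map_edge_gedge gedgeC.
      by split; [rewrite qe gedgeC|right; exists x].
    have qi : {in X1 :|: X3 &, injective (map_edge q)}.
      have vn (x y z : {x : G | x != v}) a b : gedge (val x) (val y) a <> gedge v (val z) b.
        move=> [h _]; have : v \in [set val x; val y] by rewrite h set21.
        by rewrite !inE !(eq_sym v) (negPf (valP x)) (negPf (valP y)).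
      move=> e e' /Q[_ [[x [y [ee qe]]]|[x [ee qe]]]] /Q[_ [[x' [y' [ee' qe']]]|[x' [ee' qe']]]];
        rewrite qe qe' => h.
      + rewrite ee ee'; case: h => /set2_eq[[/val_inj-> /val_inj->]|[/val_inj-> /val_inj->]] -> //.
        by rewrite gedgeC.
      + by case: (vn _ _ _ _ _ h).
      + by case: (vn _ _ _ _ _ (esym h)).
      + by move/gedge_inj: h => [/val_inj xx aa]; rewrite ee ee' xx aa.
    rewrite -(card_in_imset qi); apply/subset_leq_card/subsetP=> _ /imsetP[e /Q[? _] ->] //.
  rewrite setUAC; have [+ _] := leq_card_setU (X1 :|: X3) X2.
  have -> : #|vertex_to_K4 f| = #|G|.-1 + 4.
    by rewrite card_sum card_ord card_sig -(cardC1 v); congr (_ + _).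
  by move: c6 c13 cG; move: #|X1 :|: X3| #|X2| #|_ :|: X2| #|gedges G| #|G|; clear; lia.
- exists c', d'; split=> // i h; rewrite GE => hf.
  have hK (j k : 'I_4) : j != k -> colour c' d' (inr j) (inr k) false = i ->
      h (inr j) = h (inr k).
    move=> jk ci; apply: (hf _ _ false) => //; apply/setUP; left; apply/setUP; right.
    by rewrite inE; apply/existsP; exists j; apply/existsP; exists k; rewrite jk /=.
  have hr : forall j, h (inr j) = h (inr ord0).
    pose o1 : 'I_4 := inord 1; pose o2 : 'I_4 := inord 2; pose o3 : 'I_4 := inord 3.
    have [v1 v2 v3] : [/\ o1 = 1 :> nat, o2 = 2 :> nat & o3 = 3 :> nat].
      by rewrite !inordK.
    have E (j : 'I_4) : [\/ j = ord0, j = o1, j = o2 | j = o3].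
      case: j => [[|[|[|[|//]]]] hj]; [constructor 1|constructor 2|constructor 3|constructor 4];
        by apply: val_inj; rewrite /= ?v1 ?v2 ?v3.
    have H (j k : 'I_4) : j != k :> nat -> ((k < j) == (K4_rank k < K4_rank j)) = i ->
        h (inr j) = h (inr k).
      by move=> jk ci; apply: hK; rewrite ?nn.
    move: H; rewrite /K4_rank => H.
    (* The pairs on this line form the concordant path 1, 0, 3, 2, and those on the next line the
       discordant path 0, 2, 1, 3. *)
    have H10 := H o1 ord0; have H30 := H o3 ord0; have H32 := H o3 o2.
    have H20 := H o2 ord0; have H21 := H o2 o1; have H31 := H o3 o1.
    rewrite !(v1, v2, v3) /= in H10 H30 H32 H20 H21 H31.
    case: (i) H10 H30 H32 H20 H21 H31 => H10 H30 H32 H20 H21 H31.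
      have {}H10 := H10 isT erefl; have {}H30 := H30 isT erefl; have {}H32 := H32 isT erefl.
      by move=> j; case: (E j) => -> //; rewrite -H32.
    have {}H20 := H20 isT erefl; have {}H21 := H21 isT erefl; have {}H31 := H31 isT erefl.
    by move=> j; case: (E j) => -> //; rewrite ?H31 -H21.
  (* As [h] is constant on the cluster, it induces a function on the old vertices. *)
  pose g (u : G) := if insub u is Some x then h (inl x) else h (inr ord0).
  have gl x : g (val x) = h (inl x) by rewrite /g valK.
  have gv : g v = h (inr ord0) by rewrite /g insubF // eqxx.
  have gc1 : forall u w, g u = g w.
    apply: (cn i) => u w a uwE ci.
    have uw := gedge_neq sG uwE.
    have hv (x : {x : G | x != v}) : gedge (val x) v a \in gedges G ->
        colour c d (val x) v a = i -> h (inl x) = h (inr ord0).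
      move=> xE cx; rewrite -(hr (f x a)); apply: (hf _ _ a).
        by apply/setUP; right; rewrite inE; apply/existsP; exists x; rewrite eqxx.
      by rewrite colourC // no colourC // (valP x).
    have [uv|nuv] := eqVneq u v; have [wv|nwv] := eqVneq w v.
    - by rewrite uv wv.
    - subst u; rewrite gv; rewrite -[w]/(val (exist (fun x => x != v) w nwv)) gl.
      by apply/esym/hv => /=; [rewrite gedgeC|rewrite (colourC _ gc gd uw)].
    - subst w; rewrite gv; rewrite -[u]/(val (exist (fun x => x != v) u nuv)) gl.
      exact: hv.
    - rewrite -[u]/(val (exist (fun x => x != v) u nuv)).
      rewrite -[w]/(val (exist (fun x => x != v) w nwv)) !gl; apply: (hf _ _ a).
        apply/setUP; left; apply/setUP; left; rewrite inE; apply/existsP.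
        by exists (exist _ u nuv); apply/existsP; exists (exist _ w nwv); rewrite eqxx.
      by rewrite oo.
  have hv z : h z = g v.
    by case: z => [x|j]; [rewrite -gl|rewrite hr gv].
  by move=> z z'; rewrite !hv.
Qed.

Theorem constructible_realizable G : constructible G -> realizable R G.
Proof.
elim=> {G}.
- exact: realizable_K1.
- by move=> G H GH _; apply: realizable_iso.
- by move=> G v _; apply: realizable_switch.
- by move=> G x y a b xy _; apply: realizable_H1; rewrite xy.
- by move=> G x _; apply: realizable_H1; rewrite orbT.
- move=> G x y z a b c d xyE xy zx zy bc _.
  by apply: realizable_H2 => //; rewrite ?zx ?zy.
- move=> G x y a d xyE xy _ rG.
  (* The two edges replacing the deleted one need gains with sum [a], so the edge to [x] of gain
     [d (+) a] is one of them, and its parallel edge takes the part of the edge to [z]. *)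
  have := @realizable_H2 R G x y x a (d (+) a) d (~~ (d (+) a)) xyE.
  rewrite addbC addKb eqxx => /(_ erefl); rewrite xy => /(_ _ isT rG).
  rewrite (_ : [set _; _; gedge None (Some x) _] = [set gedge None (Some x) false;
    gedge None (Some x) true; gedge None (Some y) d]); last first.
    rewrite setUAC; case: (d (+) a) => //=; congr (_ :|: _); exact: setUC.
  by apply; case: (d (+) a).
- by move=> G v f _; apply: realizable_K4.
- by move=> G v1 v2 a N1 v21 v12 N1P _; apply: realizable_split.
Qed.

End RealizableK4.

(** * Incidence matrices and pairs of spanning trees *)

Section Incidence.
Variables (K : fieldType) (A B : finType) (s t : B -> A).

Definition incidence : 'M[K]_(#|A|, #|B|) :=
  \matrix_(i, j) ((enum_val i == s (enum_val j))%:R - (enum_val i == t (enum_val j))%:R).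

Lemma incidenceE (x : 'rV[K]_#|A|) j : (x *m incidence) 0 j =
  x 0 (enum_rank (s (enum_val j))) - x 0 (enum_rank (t (enum_val j))).
Proof.
have sum1 a : \sum_i x 0 i * (enum_val i == a)%:R = x 0 (enum_rank a).
  rewrite (bigD1 (enum_rank a)) //= enum_rankK eqxx mulr1 big1 ?addr0 // => i ia.
  by rewrite (_ : _ == a = false) ?mulr0 //; apply: contraNF ia => /eqP <-; rewrite enum_valK.
rewrite mxE -!sum1 -sumrB; apply: eq_bigr => i _.
by rewrite !mxE mulrBr.
Qed.

(** The kernel consists of the functions that are constant along the edges, hence by connectedness
    of multiples of the all-one vector. *)
Lemma connected_rank :
  (forall x : A -> K, (forall b, x (s b) = x (t b)) -> forall u v, x u = x v) ->
  (#|A| <= \rank incidence + 1)%N.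
Proof.
move=> h; have : (kermx incidence <= (const_mx 1 : 'rV[K]_#|A|))%MS.
  apply/rV_subP=> y /sub_kermxP y0.
  have yc i j : y 0 i = y 0 j.
    have := h (fun a => y 0 (enum_rank a)) _ (enum_val i) (enum_val j).
    rewrite !enum_valK; apply=> b.
    have := incidenceE y (enum_rank b); rewrite enum_rankK y0 mxE => /esym/eqP.
    by rewrite subr_eq0 => /eqP.
  apply/sub_rVP; case: (pickP (@predT 'I_#|A|)) => [i _|n0].
    by exists (y 0 i); apply/rowP=> j; rewrite !mxE mulr1.
  by exists 0; apply/rowP=> j; have := n0 j.
move/mxrankS; rewrite mxrank_ker => le; have := leq_trans le (rank_leq_row _).
by rewrite leq_subLR.
Qed.

Lemma connected_card :
  (forall x : A -> K, (forall b, x (s b) = x (t b)) -> forall u v, x u = x v) ->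
  (#|A| <= #|B| + 1)%N.
Proof.
by move/connected_rank/leq_trans; apply; rewrite leq_add2r rank_leq_col.
Qed.

(** With at most [#|A| - 1] edges the rank bound is attained, the columns are independent, and all
    edge values can be prescribed. *)
Lemma connected_solve :
  (forall x : A -> K, (forall b, x (s b) = x (t b)) -> forall u v, x u = x v) ->
  (#|B| + 1 <= #|A|)%N ->
  forall y : B -> K, exists x : A -> K, forall b, x (s b) - x (t b) = y b.
Proof.
move=> h BA y; have full : row_full incidence.
  rewrite /row_full eqn_leq rank_leq_col -(leq_add2r 1).
  exact: leq_trans BA (connected_rank h).
have /submxP[z ez] : ((\row_j y (enum_val j)) <= incidence)%MS by apply: submx_full.
exists (fun a => z 0 (enum_rank a)) => b.
by have := congr1 (fun r : 'rV__ => r 0 (enum_rank b)) ez;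
  rewrite mxE incidenceE enum_rankK => <-.
Qed.

(** Prescribing single edges gives full column rank, while the all-one vector in the left kernel
    bounds the rank by [#|A| - 1]. *)
Lemma independent_card : (0 < #|A|)%N ->
  (forall b, exists x : A -> K, forall b', x (s b') - x (t b') = (b' == b)%:R) ->
  (#|B| + 1 <= #|A|)%N.
Proof.
move=> A0 h; have full : row_full incidence.
  apply/row_fullP; have /choice[X XP] : forall j : 'I_#|B|, exists x : A -> K,
      forall b', x (s b') - x (t b') = (b' == enum_val j)%:R by move=> j; apply: h.
  exists (\matrix_(j, i) X j (enum_val i)); apply/row_matrixP=> j.
  apply/rowP=> k; rewrite row_mul incidenceE !mxE !enum_rankK XP.
  by rewrite (inj_eq enum_val_inj) eq_sym.
have one : (const_mx 1 : 'rV[K]_#|A|) != 0.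
  apply/eqP=> /rowP/(_ (Ordinal A0)); rewrite !mxE; exact/eqP/oner_neq0.
have : ((const_mx 1 : 'rV[K]_#|A|) <= kermx incidence)%MS.
  by apply/sub_kermxP/rowP=> j; rewrite incidenceE !mxE subrr.
move/mxrankS; rewrite mxrank_ker rank_rV one (eqP full) => h1.
by rewrite addnC -leq_subRL //; have := h1; case: #|A| (#|B|) => [|a] [|b] //; lia.
Qed.

End Incidence.

(** * Two colour classes that are spanning trees *)

Section Trees.
Variables (K : fieldType) (G : gain_graph).
Variables (s t : {set G} * bool -> G) (col : {set G} * bool -> bool).
Hypothesis ends : forall e, e \in gedges G -> e.1 = [set s e; t e]%SET.

Definition class (F : {set {set G} * bool}) (i : bool) := [set e in F | col e == i]%SET.

Lemma card_class (F : {set {set G} * bool}) : #|F| = (#|class F true| + #|class F false|)%N.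
Proof.
rewrite -(cardsID [set e | col e] F); congr (_ + _)%N; apply: eq_card => e;
  by rewrite !inE ?eqb_id // eqbF_neg andbC.
Qed.

Definition connected_class i := forall x : G -> K,
  (forall e, e \in gedges G -> col e = i -> x (s e) = x (t e)) ->
  forall u v, x u = x v.

Lemma connected_class_card i : connected_class i ->
  (#|G| <= #|class (gedges G) i| + 1)%N.
Proof.
move=> h; pose B : finType := {e | e \in class (gedges G) i}.
have -> : #|class (gedges G) i| = #|B| by rewrite card_sig; apply: eq_card.
apply: (@connected_card K G B (fun b => s (val b)) (fun b => t (val b))) => x hx.
apply: h => e eE ei; have eB : e \in class (gedges G) i by rewrite inE eE ei eqxx.
exact: (hx (exist _ e eB)).
Qed.

(** Each class has at least [#|G| - 1] edges and both together have at most twice as many, so each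
    has exactly that number. *)
Lemma connected_class_solve i : (forall j, connected_class j) ->
  (#|gedges G| + 2 <= 2 * #|G|)%N ->
  forall y, exists x : G -> K,
    forall e, e \in gedges G -> col e = i -> x (s e) - x (t e) = y e.
Proof.
move=> h cG y; pose B : finType := {e | e \in class (gedges G) i}.
have cB : #|class (gedges G) i| = #|B| by rewrite card_sig; apply: eq_card.
have ht := connected_class_card (h true); have hf := connected_class_card (h false).
have le : (#|B| + 1 <= #|G|)%N.
  rewrite -cB; move: cG; rewrite (card_class (gedges G)).
  case: i {B cB}; move: ht hf; move: #|class _ true| #|class _ false| #|G|; clear; lia.
have hB : forall x : G -> K,
    (forall b : B, x (s (val b)) = x (t (val b))) -> forall u v, x u = x v.
  move=> x hx; apply: (h i) => e eE ei.
  have eB : e \in class (gedges G) i by rewrite inE eE ei eqxx.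
  exact: (hx (exist _ e eB)).
have [x xP] := connected_solve hB le (fun b => y (val b)).
exists x => e eE ei; have eB : e \in class (gedges G) i by rewrite inE eE ei eqxx.
exact: (xP (exist _ e eB)).
Qed.

(** The last hypothesis makes each class independent. Restricted to [F] and its support, this bounds
    the edges of [F] in each colour by [#|edge_support F| - 1]; the two colours add up to the
    count. *)
Lemma trees_tight : (0 < #|G|)%N -> (forall i, connected_class i) ->
  (forall e0, e0 \in gedges G -> exists x : G -> K, forall e, e \in gedges G ->
     col e = col e0 -> x (s e) - x (t e) = (e == e0)%:R) ->
  gain_tight222 G.
Proof.
move=> G0 h ind.
have sub (F : {set {set G} * bool}) : F \subset gedges G -> F != finset.set0 ->
    (#|F| + 2 <= 2 * #|edge_support F|)%N.
  move=> FE /set0Pn[e0 e0F].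
  have sF e : e \in F -> s e \in edge_support F /\ t e \in edge_support F.
    move=> eF; have ee := ends (subsetP FE _ eF).
    by split; apply/bigcupP; exists e => //; rewrite ee !inE eqxx ?orbT.
  pose A : finType := {x | x \in edge_support F}.
  have cA : #|edge_support F| = #|A| by rewrite card_sig; apply: eq_card.
  have A0 : (0 < #|A|)%N.
    by rewrite -cA card_gt0; apply/set0Pn; exists (s e0); apply: (sF _ e0F).1.
  have ci i : (#|class F i| + 1 <= #|A|)%N.
    pose B : finType := {e | e \in class F i}.
    have -> : #|class F i| = #|B| by rewrite card_sig; apply: eq_card.
    have BF (b : B) : val b \in F by have := valP b; rewrite inE => /andP[].
    apply: (@independent_card K A B
      (fun b => exist _ (s (val b)) (sF _ (BF b)).1)
      (fun b => exist _ (t (val b)) (sF _ (BF b)).2) A0) => b.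
    have [x xP] := ind (val b) (subsetP FE _ (BF b)).
    exists (fun a => x (val a)) => b'; rewrite /= xP ?(subsetP FE) ?BF //.
    by have := valP b; have := valP b'; rewrite !inE => /andP[_ /eqP->] /andP[_ /eqP->].
  have := ci true; have := ci false; rewrite cA (card_class F).
  by move: #|class F true| #|class F false| #|A|; clear; lia.
split=> //; have := connected_class_card (h true).
have := connected_class_card (h false).
have [E0|E0] := eqVneq (gedges G) finset.set0.
  have c0 i : class (gedges G) i = finset.set0 by rewrite E0; apply/setP=> e; rewrite !inE.
  rewrite !c0 E0 !cards0; move: G0; move: #|G|; clear; lia.
have := sub _ (subxx _) E0; have := max_card (mem (edge_support (gedges G))).
rewrite (card_class (gedges G)).
by move: #|class _ true| #|class _ false| #|G| #|edge_support _|; clear; lia.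
Qed.

End Trees.

(** * Norms with a quadrilateral unit ball *)

Section QuadrilateralNorm.
Variables (R : realType) (N : 'cV[R]_2 -> R).
Hypothesis N_norm : is_norm N.
Variable a : 'I_4 -> 'cV[R]_2.
Hypothesis ballE : closed_unit_ball N = convex_hull xpredT a.
Hypothesis a_ext : forall i, ~ convex_hull (fun j => j != i) a (a i).

Lemma normN x : N (- x) = N x.
Proof. by case: N_norm => _ NZ _; rewrite -scaleN1r NZ normrN1 mul1r. Qed.

Lemma ballP x : N x <= 1 <-> exists c : 'I_4 -> R,
  [/\ forall i, 0 <= c i, \sum_i c i = 1 & x = \sum_i c i *: a i].
Proof. by have := congr1 (fun S => S x) ballE; rewrite /closed_unit_ball /= => ->. Qed.

Lemma sum_delta (j : 'I_4) (P : pred 'I_4) (F : 'I_4 -> 'cV[R]_2) : P j ->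
  \sum_(i | P i) (i == j)%:R *: F i = F j.
Proof.
move=> Pj; rewrite (bigD1 j) //= eqxx scale1r big1 ?addr0 // => i /andP[_ /negPf->].
by rewrite scale0r.
Qed.

Lemma sum_delta1 (j : 'I_4) (P : pred 'I_4) : P j -> \sum_(i | P i) (i == j)%:R = 1 :> R.
Proof.
move=> Pj; rewrite (bigD1 j) //= eqxx big1 ?addr0 // => i /andP[_ /negPf->] //.
Qed.

(** If [m i] were not 1, solving for [a i] and dividing by [1 - m i] would put [a i] in the hull of
    the other vertices. *)
Lemma vertex_coef i (m : 'I_4 -> R) : (forall j, 0 <= m j) -> \sum_j m j = 1 ->
  a i = \sum_j m j *: a j -> m i = 1.
Proof.
move=> m0 m1 ai; apply/eqP/contraT => mi; case: (a_ext (i := i)).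
have S : \sum_(j | j != i) m j = 1 - m i.
  by rewrite -m1 [in RHS](bigD1 i) //= addrAC subrr add0r.
have n0 : 1 - m i != 0 by rewrite subr_eq0 eq_sym.
have p0 : 0 < 1 - m i by rewrite lt_def n0 -S sumr_ge0.
exists (fun j => m j / (1 - m i)); split.
- by move=> j; rewrite divr_ge0 // ltW.
- by rewrite -mulr_suml S divff.
- have e : a i - m i *: a i = \sum_(j | j != i) m j *: a j.
    by rewrite {1}ai [in LHS](bigD1 i) //= addrAC subrr add0r.
  rewrite -{1}[a i]scale1r -scalerBl in e.
  rewrite -[LHS](scalerK n0) e scaler_sumr; apply: eq_bigr => j _.
  by rewrite scalerA mulrC.
Qed.

Lemma vertex_inj : injective a.
Proof.
move=> i j ij; apply/eqP/contraT => nij; case: (a_ext (i := i)).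
have ji : j != i by rewrite eq_sym.
exists (fun k => (k == j)%:R); split.
- by move=> k; apply: ler0n.
- exact: sum_delta1.
- by rewrite sum_delta.
Qed.

(** The ball is symmetric, so each [- a j] is a convex combination of the vertices, with
    coefficients [d j]. Substituting twice writes [a i] as such a combination, whose coefficient at
    [i] is 1 by extremality; hence [d j i = 1] as soon as [d i j] is nonzero. *)
Lemma vertex_opp i : exists j, a j = - a i.
Proof.
have /choice[d dP] : forall j, exists c : 'I_4 -> R,
    [/\ forall i, 0 <= c i, \sum_i c i = 1 & - a j = \sum_i c i *: a i].
  move=> j; apply/ballP; rewrite normN; apply/ballP; exists (fun k => (k == j)%:R).
  by split; [move=> k; apply: ler0n|rewrite sum_delta1|rewrite sum_delta].
have d0 j k : 0 <= d j k by have [] := dP j.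
have d1 j : \sum_k d j k = 1 by have [] := dP j.
have dle j k : d j k <= 1.
  by rewrite -(d1 j) (bigD1 k) //= lerDl sumr_ge0.
have m1 : \sum_j d i j * d j i = 1.
  apply: (@vertex_coef i (fun k => \sum_j d i j * d j k)).
  - by move=> k; apply: sumr_ge0 => j _; apply: mulr_ge0.
  - rewrite exchange_big /= -[RHS](d1 i); apply: eq_bigr => j _.
    by rewrite -mulr_sumr d1 mulr1.
  - have [_ _ e] := dP i; rewrite -[LHS]opprK e -sumrN.
    transitivity (\sum_j \sum_k (d i j * d j k) *: a k).
      apply: eq_bigr => j _; have [_ _ ej] := dP j.
      by rewrite -scalerN ej scaler_sumr; apply: eq_bigr => k _; rewrite scalerA.
    by rewrite exchange_big /=; apply: eq_bigr => k _; rewrite scaler_suml.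
have z : \sum_j d i j * (1 - d j i) = 0.
  under eq_bigr do rewrite mulrBr mulr1.
  by rewrite sumrB d1 m1 subrr.
have z' j : d i j * (1 - d j i) = 0.
  by apply: (psumr_eq0P _ z) => // k _; rewrite mulr_ge0 // subr_ge0 dle.
have [j dij] : exists j, d i j != 0.
  apply/existsP; apply: contraT => /existsPn h.
  have := d1 i; rewrite big1 => [/eqP|k _]; first by rewrite eq_sym oner_eq0.
  by apply/eqP; have := h k; rewrite negbK.
exists j; have /eqP := z' j; rewrite mulf_eq0 (negPf dij) /= subr_eq0 => /eqP/esym dji.
have [_ _ e] := dP j; rewrite -[LHS]opprK e; congr (- _).
have S : \sum_(k | k != i) d j k = 0.
  by have := d1 j; rewrite (bigD1 i) //= dji => h; apply: (addrI 1); rewrite h addr0.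
rewrite (bigD1 i) //= dji scale1r big1 ?addr0 // => k ki.
by rewrite (psumr_eq0P _ S) ?scale0r // => ? _.
Qed.

(** Otherwise [a i] would be the midpoint of another vertex and its opposite. *)
Lemma vertex_neq0 i : a i != 0.
Proof.
apply/eqP=> ai0; have [j ji] : exists j : 'I_4, j != i.
  by apply/existsP; case: (i) => [[|k] hk]; apply/existsP; [exists 1|exists 0].
have [k akj] := vertex_opp j.
have aj0 : a j != 0 by rewrite -ai0 (inj_eq vertex_inj).
have ki : k != i.
  by rewrite -(inj_eq vertex_inj) akj ai0 oppr_eq0.
case: (a_ext (i := i)); exists (fun l => 2^-1 * (l == j)%:R + 2^-1 * (l == k)%:R); split.
- by move=> l; rewrite addr_ge0 ?mulr_ge0 ?ler0n ?invr_ge0.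
- by rewrite big_split /= -!mulr_sumr !sum_delta1 // ?mulr1; lra.
- under eq_bigr do rewrite scalerDl -!scalerA.
  by rewrite big_split /= -!scaler_sumr !sum_delta // akj scalerN subrr.
Qed.

Lemma vertex_not_between i j k (mu : R) : i != j -> i != k -> a k = - a j ->
  `|mu| <= 1 -> a i <> mu *: a j.
Proof.
move=> ij ik akj; rewrite ler_norml => /andP[m1 m2] ai; rewrite eq_sym in ij.
rewrite eq_sym in ik; case: (a_ext (i := i)).
exists (fun l => (1 + mu) / 2 * (l == j)%:R + (1 - mu) / 2 * (l == k)%:R); split.
- by move=> l; rewrite addr_ge0 ?mulr_ge0 ?ler0n ?divr_ge0 //; lra.
- by rewrite big_split /= -!mulr_sumr !sum_delta1 // !mulr1; lra.
- under eq_bigr do rewrite scalerDl -!scalerA.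
  rewrite big_split /= -!scaler_sumr !sum_delta // akj !scalerN !scalerA -scalerBl ai.
  by congr (_ *: _); lra.
Qed.

(** The vertices form two opposite pairs, so the ball is the hull of [u], [- u], [w], [- w]: the
    unit ball of the l^1 norm in the basis [u], [w]. *)
Lemma norm_l1 : exists u w : 'cV[R]_2,
  (forall s t, s *: u + t *: w = 0 -> s = 0 /\ t = 0) /\
  forall s t, N (s *: u + t *: w) = `|s| + `|t|.
Proof.
have [j aj] := vertex_opp 0.
have j0 : j != 0.
  apply/eqP=> j0; have := vertex_neq0 0; move: aj; rewrite j0 => /eqP.
  by rewrite -addr_eq0 -mulr2n -scaler_nat scaler_eq0 pnatr_eq0 /= => ->.
have [k [k0 kj]] : exists k : 'I_4, k != 0 /\ k != j.
  have : (0 < #|~: [set 0%R; j]|)%N.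
    by rewrite cardsCs setCK cards2 eq_sym j0 card_ord.
  by move/card_gt0P=> [k]; rewrite !inE negb_or => /andP[]; exists k.
have [l al] := vertex_opp k.
have l0 : l != 0.
  by apply/eqP=> l0; move/eqP: kj; apply; apply: vertex_inj; rewrite aj -l0 al opprK.
have lj : l != j.
  apply/eqP=> lj; move/eqP: k0; apply; apply: vertex_inj.
  by apply: oppr_inj; rewrite -al lj aj.
have lk : l != k.
  apply/eqP=> lk; have := vertex_neq0 k; move: al; rewrite lk => /eqP.
  by rewrite -addr_eq0 -mulr2n -scaler_nat scaler_eq0 pnatr_eq0 /= => ->.
have all4 i : [\/ i = 0, i = j, i = k | i = l].
  have : i \in [set 0%R; j; k; l].
    suff -> : [set 0%R; j; k; l] = setT by rewrite inE.
    apply/eqP; rewrite eqEcard finset.subsetT cardsT card_ord.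
    rewrite -setUA cardsU !cards2 (eq_sym 0) j0 (eq_sym k) lk.
    rewrite (_ : _ :&: _ = finset.set0) ?cards0 //; apply/setP=> z; rewrite !inE.
    apply/negP=> /andP[/orP[] /eqP-> /orP[] /eqP] h.
    - by move: k0; rewrite -h eqxx.
    - by move: l0; rewrite -h eqxx.
    - by move: kj; rewrite -h eqxx.
    - by move: lj; rewrite -h eqxx.
  rewrite !inE => /orP[/orP[/orP[]|]|] /eqP->;
    by [constructor 1|constructor 2|constructor 3|constructor 4].
(* In a linear dependence the vertex with the larger coefficient would lie on the segment between
   the other one and its opposite. *)
have ind s t : s *: a 0 + t *: a k = 0 -> s = 0 /\ t = 0.
  move=> st; have [/andP[/eqP-> /eqP->] //|] := boolP ((s == 0) && (t == 0)).
  rewrite negb_and => n0; have [le|lt] := lerP `|s| `|t|.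
    have t0 : t != 0.
      by apply: contraTneq n0 => t0; move: le; rewrite t0 normr0 normr_le0 => ->; rewrite eqxx.
    case: (@vertex_not_between k 0 j (- s / t)) => //.
      by rewrite normrM normrN normfV ler_pdivrMr ?normr_gt0 // mul1r.
    apply: (scalerI t0); rewrite scalerA mulrC divfK // scaleNr.
    by apply/eqP; rewrite -addr_eq0 addrC st.
  have s0 : s != 0 by rewrite -normr_gt0; apply: le_lt_trans lt.
  case: (@vertex_not_between 0 k l (- t / s)) => //.
  - by rewrite eq_sym.
  - by rewrite eq_sym.
  - by rewrite normrM normrN normfV ler_pdivrMr ?normr_gt0 // mul1r ltW.
  - apply: (scalerI s0); rewrite scalerA mulrC divfK // scaleNr.
    by apply/eqP; rewrite -addr_eq0 st.
exists (a 0), (a k); split=> // s t; have [N0 NZ ND] := N_norm.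
have Na i : N (a i) <= 1.
  apply/ballP; exists (fun k => (k == i)%:R).
  by split; [move=> m; apply: ler0n|rewrite sum_delta1|rewrite sum_delta].
have ball_coord x : N x <= 1 -> exists s' t', x = s' *: a 0 + t' *: a k /\ `|s'| + `|t'| <= 1.
  move/ballP=> [c [c0 c1 ->]].
  have /choice[st stP] : forall i, exists st : R * R,
      a i = st.1 *: a 0 + st.2 *: a k /\ `|st.1| + `|st.2| <= 1.
    move=> i; case: (all4 i) => ->.
    - by exists (1, 0); rewrite /= scale1r scale0r addr0 normr1 normr0 addr0.
    - by exists (-1, 0); rewrite /= scaleN1r scale0r addr0 normrN1 normr0 addr0.
    - by exists (0, 1); rewrite /= scale1r scale0r add0r normr1 normr0 add0r.
    - by exists (0, -1); rewrite /= scaleN1r scale0r add0r normrN1 normr0 add0r.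
  exists (\sum_i c i * (st i).1), (\sum_i c i * (st i).2); split.
    rewrite !scaler_suml -big_split /=; apply: eq_bigr => i _.
    by rewrite {1}(stP i).1 scalerDr !scalerA.
  rewrite -c1; apply: le_trans (lerD (ler_norm_sum _ _ _) (ler_norm_sum _ _ _)) _.
  rewrite -big_split /=; apply: ler_sum => i _.
  by rewrite !normrM -mulrDr ger0_norm // ler_piMr // (stP i).2.
(* The triangle inequality gives one bound; the other comes from [ball_coord] at [x] scaled to norm
   1. *)
apply/le_anti/andP; split.
  apply: le_trans (ND _ _) _; rewrite !NZ.
  by apply: lerD; rewrite ler_piMr.
set x := s *: a 0 + t *: a k; have [x0|x0] := eqVneq (N x) 0.
  by have [-> ->] := ind _ _ (N0 _ x0); rewrite normr0 addr0 x0.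
have Nx : 0 < N x.
  rewrite lt_def x0 /=; have := ND x (- x); rewrite normN subrr.
  have -> : N 0 = 0 by have := NZ 0 0; rewrite scale0r normr0 mul0r.
  by rewrite -mulr2n pmulrn_lge0.
have [|s' [t' [e le]]] := ball_coord ((N x)^-1 *: x).
  by rewrite NZ gtr0_norm ?invr_gt0 // mulVf.
have e2 : (s - N x * s') *: a 0 + (t - N x * t') *: a k = 0.
  have : x = N x *: (s' *: a 0 + t' *: a k) by rewrite -e scalerA mulfV // scale1r.
  rewrite {1}/x scalerDr !scalerA !scalerBl => h.
  by rewrite addrACA h -opprD subrr.
have [/eqP + /eqP] := ind _ _ e2; rewrite !subr_eq0 => /eqP-> /eqP->.
by rewrite !normrM (gtr0_norm Nx) -mulrDr ler_piMr // ltW.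
Qed.

End QuadrilateralNorm.

(** * Linear coordinates in which the norm is l^1 *)

Section L1.
Variables (R : realType) (N : 'cV[R]_2 -> R).

Lemma ord2 (i : 'I_2) : i = 0 \/ i = 1.
Proof. by case: i => [[|[|//]]] hi; [left|right]; apply: val_inj. Qed.

Lemma sum2 (V : nmodType) (F : 'I_2 -> V) : \sum_i F i = F 0 + F 1.
Proof. by rewrite big_ord_recl big_ord1; congr (_ + F _); apply: val_inj. Qed.

Lemma col2_eq (K : Type) (x y : 'cV[K]_2) : x 0 0 = y 0 0 -> x 1 0 = y 1 0 -> x = y.
Proof.
by move=> h0 h1; apply/colP=> i; case: (ord2 i) => ->.
Qed.

Lemma quadrilateral_norm : is_norm N -> quadrilateral (closed_unit_ball N) ->
  exists2 A : 'M[R]_2, A \in unitmx &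
    forall x, N x = `|(A *m x) 0 0| + `|(A *m x) 1 0|.
Proof.
move=> Nn [a [ballE aext]]; have [u [w [ind NE]]] := norm_l1 Nn ballE aext.
pose P : 'M[R]_2 := \matrix_(i, j) (if j == 0 then u i 0 else w i 0).
have PE (y : 'cV[R]_2) : P *m y = y 0 0 *: u + y 1 0 *: w.
  by apply/colP=> i; rewrite !mxE sum2 !mxE /= mulrC [w _ _ * _]mulrC.
have Pu : P \in unitmx.
  rewrite -unitmx_tr -row_free_unit; apply: inj_row_free => v v0.
  have : P *m v^T = 0 by apply: trmx_inj; rewrite trmx_mul trmxK v0 trmx0.
  rewrite PE => /ind; rewrite !mxE => -[h0 h1].
  by apply/rowP=> i; rewrite mxE; case: (ord2 i) => ->.
exists (invmx P); first by rewrite unitmx_inv.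
by move=> x; rewrite -{1}(mulKVmx Pu x) PE NE.
Qed.

End L1.

(** * Derivatives of locally affine maps *)

Section Differential.
Variable R : realType.

Lemma linear_mx_continuous (m n : nat) (W : normedModType R) (L : {linear 'M[R]_(m, n) -> W}) :
  continuous L.
Proof.
move=> x.
have LE y : L y = \sum_i \sum_j y i j *: L (delta_mx i j).
  rewrite {1}(matrix_sum_delta y) linear_sum; apply: eq_bigr => i _.
  by rewrite linear_sum; apply: eq_bigr => j _; rewrite linearZ.
rewrite (_ : (L : _ -> _) = fun y => \sum_i \sum_j y i j *: L (delta_mx i j)); last first.
  by apply/funext => y; apply: LE.
move: x; apply: continuous_big => [|i _]; first exact: add_continuous.
apply: continuous_big => [|j _ y]; first exact: add_continuous.
by apply: cvgZr_tmp; [exact: (nbhs_filter y)|exact: (@coord_continuous R m n i j y)].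
Qed.

(** The l^1 length is piecewise linear, so away from zero coordinates it is locally affine and the
    remainder vanishes identically near [p]. *)
Lemma diff_near (V W : normedModType R) (f : V -> W) (L : {linear V -> W}) p :
  continuous L -> (\forall h \near (0 : V), f (h + p) = f p + L h) ->
  differentiable f p /\ 'd f p = L :> (V -> W).
Proof.
move=> Lc fL.
have H : f \o shift p = cst (f p) + L +o_ 0 id.
  apply/eqaddoP => e e0; near=> h.
  have -> : ((f \o shift p) - (cst (f p) + L)) h = 0.
    rewrite -[LHS]/(f (h + p) - (f p + L h)).
    by rewrite (near fL h) // subrr.
  by rewrite normr0 mulr_ge0 // ltW.
have dE := diff_unique Lc H; split=> //.
by apply/diff_locallyP; rewrite dE.
Unshelve. all: by end_near.
Qed.

End Differential.

(** * Infinitesimal motions are constant fields *)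

Section L1Norm.
Variable R : realType.

Lemma abs_near (s e : R) : s != 0 -> `|e| < `|s| -> `|s + e| = `|s| + Num.sg s * e.
Proof.
move=> s0; case: (ltrgt0P s) s0 => // s0 _; rewrite ltr_norml => /andP[e1 e2].
- by rewrite gtr0_norm ?gtr0_sg ?mul1r //; lra.
- by rewrite ltr0_norm ?ltr0_sg //; lra.
Qed.

(** The quotients are 1 and -1 on the two sides of 0, and no [l] is at distance less than 1 from
    both. *)
Lemma abs_slope (l : R) : ~ ((fun t : R => t^-1 * `|t|) @ 0^' --> l)%classic.
Proof.
move=> /cvgrPdist_lt /(_ 1 ltr01) /nbhs_ballP[e e0 he].
have e20 : 0 < e / 2 by rewrite divr_gt0.
have b1 : ball (0 : R) e (e / 2).
  by rewrite /ball /= sub0r normrN gtr0_norm //; move: e0 => /=; lra.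
have b2 : ball (0 : R) e (- (e / 2)).
  by rewrite /ball /= sub0r opprK gtr0_norm //; move: e0 => /=; lra.
have := he _ b1; have := he _ b2; rewrite /= oppr_eq0 gt_eqF // => /(_ isT) + /(_ isT).
rewrite [`|- (e / 2)|]normrN (gtr0_norm e20) invrN mulNr mulVf ?gt_eqF //.
by rewrite !ltr_norml => /andP[? ?] /andP[? ?]; lra.
Qed.

Variables (N : 'cV[R]_2 -> R) (A : 'M[R]_2).
Hypothesis A_unit : A \in unitmx.
Hypothesis NE : forall x, N x = `|(A *m x) 0 0| + `|(A *m x) 1 0|.

(** While both coordinates of [z] are nonzero, the length is affine in a small displacement. As it
    is preserved, the linear term vanishes on the difference quotients [q t], and hence in the
    limit. *)
Lemma inf_motion_slope eta x y : inf_motion N eta ->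
  let z := A *m (x - y) in let w := A *m (eta x - eta y) in
  z 0 0 != 0 -> z 1 0 != 0 ->
  Num.sg (z 0 0) * w 0 0 + Num.sg (z 1 0) * w 1 0 = 0.
Proof.
case=> alpha [_ alpha0 alphaN] Dalpha z w z0 z1.
pose q t : 'cV[R]_2 := t^-1 *: (alpha x t - x) - t^-1 *: (alpha y t - y).
have qx u : ((fun t : R => t^-1 *: (alpha u t - u)) @ 0^' --> eta u)%classic.
  have [du <-] := Dalpha u; move: du; rewrite /derivable /derive.
  rewrite (_ : (fun h : R => _) = (fun t : R => t^-1 *: (alpha u t - u))) //.
  by apply/funext => t; rewrite /= alpha0 scaler1 addr0.
have qc : (q @ 0^' --> eta x - eta y)%classic by apply: cvgB; apply: qx.
have Ac k : ((fun t : R => (A *m q t) k 0) @ 0^' --> (A *m (eta x - eta y)) k 0)%classic.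
  have lin : linear (fun v : 'cV[R]_2 => (A *m v) k 0 : R^o).
    by move=> c u v; rewrite mulmxDr -scalemxAr !mxE.
  pose L : {linear 'cV[R]_2 -> R^o} := HB.pack (fun v : 'cV[R]_2 => (A *m v) k 0 : R^o)
    (GRing.isLinear.Build _ _ _ _ _ lin).
  have Lc := @linear_mx_continuous R _ _ _ L (eta x - eta y).
  have h := cvg_comp _ _ qc Lc.
  exact: h.
have sc : ((fun t : R => Num.sg (z 0 0) * (A *m q t) 0 0 + Num.sg (z 1 0) * (A *m q t) 1 0)
    @ 0^' --> Num.sg (z 0 0) * w 0 0 + Num.sg (z 1 0) * w 1 0)%classic.
  by apply: cvgD; apply: cvgM; [exact: cvg_cst|exact: Ac|exact: cvg_cst|exact: Ac].
have tc k : ((fun t : R => t * (A *m q t) k 0) @ 0^' --> 0 * w k 0)%classic.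
  by apply: cvgM; [exact: nbhs_dnbhs|exact: Ac].
have small k : z k 0 != 0 -> \forall t \near (0 : R)^'%classic, `|t * (A *m q t) k 0| < `|z k 0|.
  move=> zk; have /cvgrPdist_lt/(_ `|z k 0|) := tc k; rewrite normr_gt0 => /(_ zk).
  by apply: filterS => t; rewrite mul0r sub0r normrN.
apply: (cvg_unique (@norm_hausdorff _ R^o) sc); apply: cvg_near_cst.
near=> t; have t0 : t != 0 by near: t; exact: nbhs_dnbhs_neq.
have tq : alpha x t - alpha y t = (x - y) + t *: q t.
  rewrite /q -scalerBr scalerA mulfV // scale1r.
  by apply/colP=> i; rewrite !mxE; ring.
have t1 : -1 <= t <= 1 by rewrite -ler_norml; near: t; apply: dnbhs0_le.
have zE k : (z + t *: (A *m q t)) k 0 = z k 0 + t * (A *m q t) k 0.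
  by rewrite mxE [X in _ + X]mxE.
have := alphaN x y t t1; rewrite tq !NE mulmxDr -scalemxAr -/z !zE !abs_near //; last 2 first.
- by near: t; apply: small.
- by near: t; apply: small.
move=> e; have : t * (Num.sg (z 0 0) * (A *m q t) 0 0 + Num.sg (z 1 0) * (A *m q t) 1 0) = 0.
  by move: e; move: (`|z 0 0|) (`|z 1 0|) => a b e; lra.
by move/eqP; rewrite mulf_eq0 (negPf t0) /= => /eqP.
Unshelve. all: by end_near.
Qed.

(* A point [z] with both [x - z] and [z - y] in one quadrant transfers one
   slope relation from [z] to the pair [x], [y]; the two kinds of quadrants give
   both relations. *)
Lemma inf_motion_const eta x y : inf_motion N eta -> eta x = eta y.
Proof.
move=> he; pose D := A *m (x - y).
(* [M] exceeds both coordinates of [D] in absolute value, so [D - v] and [v] below have opposite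
   signs in each coordinate and their slope relations involve the same linear form up to sign. *)
pose M := 1 + `|D 0 0| + `|D 1 0|.
have M0 : 0 < M by rewrite /M -addrA ltr_pwDl // addr_ge0.
pose W := A *m (eta x - eta y).
have key (s : R) : s = 1 \/ s = -1 -> W 0 0 + s * W 1 0 = 0.
  move=> hs; pose v : 'cV[R]_2 := \col_i (if i == 0 then M else s * M).
  pose z := y + invmx A *m v.
  have zy : A *m (z - y) = v by rewrite /z addrC addKr mulKVmx.
  have xz : A *m (x - z) = D - v.
    by rewrite /z opprD addrA mulmxBr mulKVmx.
  have v0 : v 0 0 = M by rewrite mxE.
  have v1 : v 1 0 = s * M by rewrite mxE.
  have d0 : D 0 0 - M < 0.
    have := ler_norm (D 0 0); have := normr_ge0 (D 1 0); rewrite /M; lra.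
  have d1 : `|D 1 0| < M by have := normr_ge0 (D 0 0); rewrite /M; lra.
  have e1 := inf_motion_slope (x := x) (y := z) he.
  have e2 := inf_motion_slope (x := z) (y := y) he.
  rewrite xz in e1; rewrite zy in e2; rewrite /= in e1 e2.
  have W2 k : W k 0 = (A *m (eta x - eta z)) k 0 + (A *m (eta z - eta y)) k 0.
    rewrite /W (_ : eta x - eta y = (eta x - eta z) + (eta z - eta y)).
      by rewrite mulmxDr mxE.
    by rewrite addrA subrK.
  have DE k : (D - v) k 0 = D k 0 - v k 0 by rewrite mxE [X in _ + X]mxE.
  rewrite !DE v0 v1 in e1.
  rewrite v0 v1 in e2; rewrite !W2.
  have sg0 : Num.sg (D 0 0 - M) = -1 by rewrite ltr0_sg.
  rewrite sg0 (ltr0_neq0 d0) in e1; rewrite (gtr0_sg M0) (lt0r_neq0 M0) in e2.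
  case: hs => sE; rewrite sE in e1 e2 *.
    have d1' : D 1 0 - 1 * M < 0 by move: d1; rewrite ltr_norml => /andP[? ?]; lra.
    have M1 : 0 < 1 * M by rewrite mul1r.
    rewrite (ltr0_neq0 d1') (ltr0_sg d1') (lt0r_neq0 M1) (gtr0_sg M1) in e1 e2.
    by have := e1 isT isT; have := e2 isT isT; lra.
  have d1' : 0 < D 1 0 - -1 * M by move: d1; rewrite ltr_norml => /andP[? ?]; lra.
  have M1 : -1 * M < 0 by lra.
  rewrite (lt0r_neq0 d1') (gtr0_sg d1') (ltr0_neq0 M1) (ltr0_sg M1) in e1 e2.
  by have := e1 isT isT; have := e2 isT isT; lra.
have k1 := key 1 (or_introl erefl); have k2 := key (-1) (or_intror erefl).
have W0 : W = 0 by apply: col2_eq; rewrite [RHS]mxE; lra.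
by apply/subr0_eq; rewrite -(mulKmx A_unit (eta x - eta y)) -/W W0 mulmx0.
Qed.

Lemma inf_motion_translation (k : 'cV[R]_2) : inf_motion N (fun=> k).
Proof.
exists (fun x t => x + t *: k).
  split=> [x|x|x y t _]; last by rewrite opprD addrACA subrr addr0.
  - apply: continuous_subspaceT => t; apply: cvgD; first exact: cvg_cst.
    by apply: cvgZr_tmp; apply: cvg_id.
  - by rewrite scale0r addr0.
move=> x; have c : ((fun h : R => h^-1 *: (((fun t : R => x + t *: k) \o shift 0) (h *: (1 : R))
    - (x + (0 : R) *: k))) @ 0^' --> k)%classic.
  apply: cvg_near_cst; near=> h; have h0 : h != 0 by near: h; exact: nbhs_dnbhs_neq.
  by rewrite /= scaler1 addr0 scale0r addr0 addrAC subrr add0r scalerA mulVf // scale1r.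
split; first by apply/cvg_ex; exists k.
by apply: (cvg_lim _ c); apply: norm_hausdorff.
Unshelve. all: by end_near.
Qed.

End L1Norm.

(** * Differentiability of the rigidity map *)

Section RigidityMap.
Variables (R : realType) (N : 'cV[R]_2 -> R) (A : 'M[R]_2).
Hypothesis A_unit : A \in unitmx.
Hypothesis NE : forall x, N x = `|(A *m x) 0 0| + `|(A *m x) 1 0|.
Variables (V : finType) (E : {set {set V}}).
Variables (src tgt : 'I_#|E| -> V).
Hypothesis src_tgt : forall i, enum_val i = [set src i; tgt i]%SET.
Implicit Types (x p h : 'M[R]_(2, #|V|)).

Definition edge_coord (k : 'I_2) (i : 'I_#|E|) x : R^o :=
  (A *m (Defs.point x (src i) - Defs.point x (tgt i))) k 0.

Lemma edge_coord_linear k i : linear (edge_coord k i).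
Proof.
move=> c x y; rewrite /edge_coord.
have pE v : Defs.point (c *: x + y) v = c *: Defs.point x v + Defs.point y v.
  by apply/colP=> r; rewrite !mxE.
by rewrite !pE opprD addrACA -scalerBr mulmxDr -scalemxAr mxE [X in X + _]mxE.
Qed.

HB.instance Definition _ k i :=
  GRing.isLinear.Build R _ _ _ (edge_coord k i) (edge_coord_linear k i).

Lemma rigidity_mapE x i :
  rigidity_map N E x 0 i = `|edge_coord 0 i x| + `|edge_coord 1 i x|.
Proof.
rewrite mxE /edge_length src_tgt; case: pickP => [[v w] /= /eqP|/(_ (src i, tgt i))]; last first.
  by rewrite /= eqxx.
rewrite NE /edge_coord; case/set2_eq => -[-> ->] //.
by rewrite -opprB mulmxN; congr (_ + _); rewrite mxE normrN.
Qed.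

Definition rigidity_differential p x : 'rV[R]_#|E| :=
  \row_i (Num.sg (edge_coord 0 i p) * edge_coord 0 i x +
          Num.sg (edge_coord 1 i p) * edge_coord 1 i x).

Lemma rigidity_differential_linear p : linear (rigidity_differential p).
Proof.
move=> c x y; apply/rowP=> i.
have eE k : edge_coord k i (c *: x + y) = c * edge_coord k i x + edge_coord k i y.
  exact: edge_coord_linear.
by rewrite !mxE !eE; ring.
Qed.

HB.instance Definition _ p := GRing.isLinear.Build R _ _ _
  (rigidity_differential p) (rigidity_differential_linear p).

Lemma rigidity_diff p : (forall k i, edge_coord k i p != 0) ->
  well_positioned N E p /\ 'd (rigidity_map N E) p =1 rigidity_differential p.
Proof.
move=> p0; have [||wp ->] := @diff_near R _ _ (rigidity_map N E)
    (rigidity_differential p) p; last by split.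
  exact: linear_mx_continuous.
have near_k k : \forall h \near (0 : 'M[R]_(2, #|V|)),
    forall i, `|edge_coord k i h| < `|edge_coord k i p|.
  apply: (@filter_forall _ _ (fun i (h : 'M[R]_(2, #|V|)) =>
    is_true (`|edge_coord k i h| < `|edge_coord k i p|)) _ (nbhs_filter _)) => i.
  have c := @linear_mx_continuous R _ _ _ (edge_coord k i) 0.
  have /cvgrPdist_lt/(_ `|edge_coord k i p|) := c; rewrite normr_gt0 => /(_ (p0 k i)).
  by apply: filterS => h; rewrite linear0 sub0r normrN.
near=> h; apply/rowP=> i; have h0 := near (near_k 0) h; have h1 := near (near_k 1) h.
rewrite [RHS]mxE !rigidity_mapE [rigidity_differential p h 0 i]mxE !linearD /= ![edge_coord _ i h + _]addrC.
by rewrite !abs_near ?h0 ?h1 // addrACA.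
Unshelve. all: by end_near.
Qed.

(** Were coordinate [k] of an edge zero, moving one end in this coordinate alone would lengthen the
    edge by the absolute value of [t], which has no derivative at 0. *)
Lemma edge_coord_neq0 p : (forall i, src i != tgt i) -> well_positioned N E p ->
  forall k i, edge_coord k i p != 0.
Proof.
move=> ne wp k i; apply/eqP=> pk0.
(* Only the source of edge [i] moves, in the direction that [A] takes to the coordinate vector
   [k]. *)
pose x : 'M[R]_(2, #|V|) := \matrix_(r, j)
  (if enum_val j == src i then (invmx A *m delta_mx k (0 : 'I_1)) r 0 else 0).
have px v : Defs.point x v = if v == src i then invmx A *m delta_mx k 0 else 0.
  by apply/colP=> r; rewrite !mxE enum_rankK; case: eqP => // _; rewrite mxE.
have xk l : edge_coord l i x = (l == k)%:R.
  rewrite /edge_coord !px eqxx eq_sym (negPf (ne i)) subr0 mulKVmx // mxE.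
  by rewrite andbT.
have slope t : rigidity_map N E (t *: x + p) 0 i = `|t| + rigidity_map N E p 0 i.
  have eE l : edge_coord l i (t *: x + p) = t * edge_coord l i x + edge_coord l i p.
    exact: edge_coord_linear.
  rewrite !rigidity_mapE !eE !xk; move: pk0.
  by case: (ord2 k) => -> ->; rewrite /= ?mulr1 ?mulr0 ?add0r ?addr0 ?normr0 ?add0r ?addr0 // addrC.
have /cvg_ex[l lP] := @diff_derivable _ _ _ _ _ x wp.
have := cvg_comp _ _ lP (@coord_continuous R 1 _ 0 i l).
rewrite (_ : _ \o _ = fun t : R => t^-1 * `|t|); first exact: abs_slope.
apply/funext => t; rewrite /= mxE [X in _ * X]mxE [X in _ * (_ + X)]mxE slope.
by rewrite addrK.
Qed.

End RigidityMap.

(** * The quotient gain graph *)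

Section Quotient.
Variables (V : finType) (E : {set {set V}}) (theta : bool -> {perm V}).
Variable rep : vertex_orbit theta -> V.
Hypothesis G_simple : simple_graph E.
Hypothesis G_sym : Z2_symmetric E theta.
Hypothesis G_free : free_on_edges E theta.
Hypothesis rep_in : forall O : vertex_orbit theta, rep O \in val O.

Lemma theta_add g h v : theta (g (+) h) v = theta h (theta g v).
Proof. by case: G_sym => _ -> _; rewrite permM. Qed.

Lemma theta_id v : theta false v = v.
Proof.
by apply: (@perm_inj _ (theta false)); rewrite -theta_add.
Qed.

Lemma thetaK g v : theta g (theta g v) = v.
Proof. by rewrite -theta_add addbb theta_id. Qed.

Lemma orbit_proof v :
  [set theta g v | g : bool]%SET \in [set [set theta g v | g : bool] | v : V]%SET.
Proof. exact: imset_f. Qed.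

Definition orb v : vertex_orbit theta :=
  exist (fun O => O \in [set [set theta g v | g : bool] | v : V]%SET) _ (orbit_proof v).

Lemma orb_theta g v : orb (theta g v) = orb v.
Proof.
apply: val_inj; apply/setP=> w; apply/imsetP/imsetP => -[h _ ->].
  by exists (g (+) h) => //; rewrite theta_add.
by exists (g (+) h) => //; rewrite theta_add thetaK.
Qed.

Lemma orb_rep O : orb (rep O) = O.
Proof.
have /imsetP[v _ OE] := valP O; have := rep_in O; rewrite OE => /imsetP[g _ ->].
by rewrite orb_theta; apply: val_inj; rewrite /= OE.
Qed.

(** The group element that takes the representative of the orbit of [v] to [v], unique because the
    action on the vertices is free. *)
Definition sgn v : bool := v != rep (orb v).

Lemma sgnP v : theta (sgn v) (rep (orb v)) = v.
Proof.
rewrite /sgn; case: eqP => [<-|ne]; first by rewrite theta_id.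
have /imsetP[[] _ e] := rep_in (orb v); first by rewrite e thetaK.
by case: ne; rewrite e theta_id.
Qed.

Lemma theta_inj2 g h v : theta g v = theta h v -> g = h.
Proof.
move=> e; apply/eqP/contraT => gh; have [_ _ /(_ true v isT)] := G_sym.
by rewrite (_ : true = g (+) h) ?theta_add ?e ?thetaK ?eqxx //; case: g h gh {e} => [] [].
Qed.

Lemma sgn_theta g v : sgn (theta g v) = sgn v (+) g.
Proof.
apply: (@theta_inj2 _ _ (rep (orb v))).
by rewrite -{1}(orb_theta g v) sgnP theta_add sgnP.
Qed.

Lemma sgn_rep O : sgn (rep O) = false.
Proof. by rewrite /sgn orb_rep eqxx. Qed.

Lemma theta_set2 g v w : theta g @: [set v; w]%SET = [set theta g v; theta g w]%SET.
Proof. by rewrite imsetU !imset_set1. Qed.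

Lemma theta_edge g v w :
  ([set theta g v; theta g w]%SET \in E) = ([set v; w]%SET \in E).
Proof.
have [aut _ _] := G_sym.
have mem e : e \in E -> theta g @: e \in E by move=> eE; rewrite -(aut g) imset_f.
apply/idP/idP => [/mem|/mem]; rewrite theta_set2 ?thetaK //.
Qed.

Lemma quotient_edge u w a :
  (gedge u w a \in gedges (quotient_gain_graph E rep)) =
  ([set rep u; theta a (rep w)]%SET \in E).
Proof.
rewrite inE; apply/existsP/idP => [[x /existsP[y /andP[/eqP e]]]|h].
  case/set2_eq: e => -[-> ->] //; rewrite /= -(theta_edge a) thetaK.
  by rewrite setUC.
by exists u; apply/existsP; exists w; rewrite eqxx.
Qed.

Lemma lift_edge v w : ([set v; w]%SET \in E) =
  (gedge (orb v) (orb w) (sgn v (+) sgn w) \in gedges (quotient_gain_graph E rep)).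
Proof.
rewrite quotient_edge -[in RHS](theta_edge (sgn v)) -theta_add addbAC addbb addFb.
by rewrite !sgnP.
Qed.

(** A quotient edge may record its ends in either order, hence the two cases: an edge is a translate
    of the lift starting at the representative of [a], read forwards or backwards. *)
Lemma edge_fibre v w a b :
  gedge (orb v) (orb w) (sgn v (+) sgn w) = gedge a b (sgn v (+) sgn w) ->
  let w0 := theta (sgn v (+) sgn w) (rep b) in
  exists g, (v = theta g (rep a) /\ w = theta g w0) \/
            (w = theta g (rep a) /\ v = theta g w0).
Proof.
case=> /set2_eq[[<- <-]|[<- <-]] /=; [exists (sgn v); left|exists (sgn w); right];
  rewrite sgnP -theta_add; split=> //.
  by rewrite addbAC addbb sgnP.
by rewrite -addbA addbb addbF sgnP.
Qed.

Lemma edge_proj v w v' w' : [set v; w]%SET = [set v'; w']%SET ->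
  gedge (orb v) (orb w) (sgn v (+) sgn w) = gedge (orb v') (orb w') (sgn v' (+) sgn w').
Proof. by case/set2_eq=> -[-> ->] //; rewrite gedgeC addbC. Qed.

Lemma quotient_ends (v0 : V) : exists s t : {set quotient_gain_graph E rep} * bool ->
    quotient_gain_graph E rep,
  forall e, e \in gedges (quotient_gain_graph E rep) -> e = gedge (s e) (t e) e.2.
Proof.
have /choice[st stP] : forall e : {set quotient_gain_graph E rep} * bool,
    exists st : quotient_gain_graph E rep * quotient_gain_graph E rep,
    e \in gedges (quotient_gain_graph E rep) -> e = gedge st.1 st.2 e.2.
  move=> e; have [|ne] := boolP (e \in gedges (quotient_gain_graph E rep)); last first.
    by exists (orb v0, orb v0).
  by rewrite inE => /existsP[u /existsP[w /andP[/eqP ee _]]]; exists (u, w);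
    rewrite [LHS]surjective_pairing ee.
by exists (fun e => (st e).1), (fun e => (st e).2).
Qed.

(** A loop of gain [true] would come from an edge fixed by [theta true], which freeness on the edges
    excludes; one of gain [false] would be a degenerate edge of [E]. *)
Lemma quotient_simple : simple_edges (quotient_gain_graph E rep).
Proof.
move=> e; rewrite inE => /existsP[u /existsP[w /andP[/eqP -> uwE]]].
rewrite cards2; case: eqP => // uw; rewrite uw in uwE.
case: (e.2) uwE => uwE.
  have := G_free (g := true) isT uwE; rewrite theta_set2 thetaK.
  by rewrite setUC eqxx.
by have := G_simple uwE; rewrite theta_id setUid cards1.
Qed.

Lemma quotient_nonempty : (0 < #|V|)%N -> (0 < #|quotient_gain_graph E rep|)%N.
Proof. by move/card_gt0P=> [v _]; apply/card_gt0P; exists (orb v). Qed.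

End Quotient.

(** * Symmetric isostaticity in terms of the colour classes *)

Section Rows.
Local Open Scope complex_scope.
Variables (R : realType) (N : 'cV[R]_2 -> R) (A : 'M[R]_2).
Hypothesis A_unit : A \in unitmx.
Hypothesis NE : forall x, N x = `|(A *m x) 0 0| + `|(A *m x) 1 0|.
Variables (V : finType) (E : {set {set V}}).
Hypothesis E_simple : simple_graph E.

Definition coord (K : pzRingType) (B : 'M[K]_2) (k : 'I_2) (x : 'M[K]_(2, #|V|)) v : K :=
  (B *m Defs.point x v) k 0.

Lemma coordE (K : pzRingType) (B : 'M[K]_2) k (x : 'M[K]_(2, #|V|)) v :
  coord B k x v = B k 0 * x 0 (enum_rank v) + B k 1 * x 1 (enum_rank v).
Proof. by rewrite /coord mxE sum2 !mxE. Qed.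

Lemma coord_inj (K : comUnitRingType) (B : 'M[K]_2) (x y : 'M[K]_(2, #|V|)) v w :
  B \in unitmx -> coord B 0 x v = coord B 0 y w -> coord B 1 x v = coord B 1 y w ->
  Defs.point x v = Defs.point y w.
Proof.
move=> Bu h0 h1; rewrite -(mulKmx Bu (Defs.point x v)) -(mulKmx Bu (Defs.point y w)).
by congr (_ *m _); apply: col2_eq.
Qed.

Lemma coord_build (K : comUnitRingType) (B : 'M[K]_2) (a b : V -> K) : B \in unitmx ->
  exists x : 'M[K]_(2, #|V|), forall v, coord B 0 x v = a v /\ coord B 1 x v = b v.
Proof.
move=> Bu; pose y v : 'cV[K]_2 := \col_i (if i == 0 then a v else b v).
exists (\matrix_(i, j) (invmx B *m y (enum_val j)) i 0) => v.
rewrite /coord (_ : Defs.point _ v = invmx B *m y v) ?mulKVmx ?mxE //.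
by apply/colP=> i; rewrite !mxE enum_rankK.
Qed.

Definition cA : 'M[R[i]]_2 := to_complex A.

Lemma cA_unit : cA \in unitmx.
Proof. by rewrite map_unitmx. Qed.

Variable p : 'M[R]_(2, #|V|).

Definition row_form (x : 'M[R[i]]_(2, #|V|)) v w : R[i] :=
  \sum_k (Num.sg (coord A k p v - coord A k p w))%:C * (coord cA k x v - coord cA k x w).

Lemma row_formC x v w : row_form x w v = row_form x v w.
Proof.
apply: eq_bigr => k _; rewrite -opprB sgrN rmorphN /= -[coord cA k x w - _]opprB.
by rewrite mulNr mulrN opprK.
Qed.

(** The combination of coordinates that an edge of class [i] sees in the l^1 norm: their sum for [i]
    true and their difference for [i] false. *)
Definition class_coord (i : bool) (x : 'M[R[i]]_(2, #|V|)) v : R[i] :=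
  coord cA 0 x v + (-1) ^+ (~~ i) * coord cA 1 x v.

Lemma row_form_class x v w :
  coord A 0 p v - coord A 0 p w != 0 -> coord A 1 p v - coord A 1 p w != 0 ->
  let i := (0 < coord A 0 p v - coord A 0 p w) == (0 < coord A 1 p v - coord A 1 p w) in
  row_form x v w = (Num.sg (coord A 0 p v - coord A 0 p w))%:C *
    (class_coord i x v - class_coord i x w).
Proof.
rewrite /row_form sum2 /class_coord.
move: (_ - _) (coord A 1 p v - _) => s t s0 t0 /=.
move: (coord cA 0 x v) (coord cA 0 x w) (coord cA 1 x v) (coord cA 1 x w) => a b c d.
case: (ltrgt0P s) s0 => // hs _; case: (ltrgt0P t) t0 => // ht _ /=;
  rewrite ?(gtr0_sg hs) ?(gtr0_sg ht) ?(ltr0_sg hs) ?(ltr0_sg ht) ?rmorphN /= ?rmorph1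
    ?expr0 ?expr1; ring.
Qed.

Lemma complexified_differentialE :
  (forall v w, [set v; w]%SET \in E -> forall k, coord A k p v - coord A k p w != 0) ->
  well_positioned N E p /\
  forall x j v w, enum_val j = [set v; w]%SET ->
    complexified_differential N E p x 0 j = row_form x v w.
Proof.
move=> p0; have /choice[st stP] : forall j : 'I_#|E|, exists st : V * V,
    enum_val j = [set st.1; st.2]%SET.
  move=> j; have /E_simple/eqP/cards2P[v [w [_ e]]] := enum_valP j.
  by exists (v, w).
pose src j := (st j).1; pose tgt j := (st j).2.
have ecE k j x : edge_coord A src tgt k j x = coord A k x (src j) - coord A k x (tgt j).
  by rewrite /edge_coord mulmxBr mxE [X in _ + X]mxE.
have [|wp dE] := @rigidity_diff R N A NE V E src tgt stP p.
  by move=> k j; rewrite ecE; apply: p0; rewrite -stP enum_valP.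
split=> // x j v w jvw.
suff -> : complexified_differential N E p x 0 j = row_form x (src j) (tgt j).
  by move: jvw; rewrite stP -/(src j) -/(tgt j) => /set2_eq[[-> ->]|[-> ->]] //; rewrite row_formC.
rewrite mxE [X in _ + X]mxE !mxE !dE !mxE /row_form sum2 !ecE.
have cE k u : coord cA k x u = (coord A k (map_mx (@complex.Re R) x) u)%:C +
    'i * (coord A k (map_mx (@complex.Im R) x) u)%:C.
  rewrite !coordE !mxE !rmorphD !rmorphM /=.
  rewrite {1}[x 0 _]complexE {1}[x 1 _]complexE ?complexiE; ring.
rewrite !cE !rmorphD !rmorphM /= !rmorphB /= ?complexiE; ring.
Qed.

Lemma well_positioned_coord : well_positioned N E p ->
  forall v w, [set v; w]%SET \in E -> forall k, coord A k p v - coord A k p w != 0.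
Proof.
move=> wp v w vwE k.
have vw : v != w by have := E_simple vwE; rewrite cards2; case: (v != w).
(* The edges are oriented so that the given one is read from [v] to [w]. *)
have /choice[st stP] : forall j : 'I_#|E|, exists st : V * V,
    [/\ enum_val j = [set st.1; st.2]%SET, st.1 != st.2 &
        enum_val j = [set v; w]%SET -> st = (v, w)].
  move=> j; have [e|ne] := pselect (enum_val j = [set v; w]%SET).
    by exists (v, w).
  have /E_simple/eqP/cards2P[v' [w' [? e]]] := enum_valP j.
  by exists (v', w'); split=> // h; case: ne.
pose src j := (st j).1; pose tgt j := (st j).2.
have sP j : enum_val j = [set src j; tgt j]%SET by have [] := stP j.
have sn j : src j != tgt j by have [] := stP j.
have := edge_coord_neq0 A_unit NE sP sn wp k (enum_rank_in vwE [set v; w]%SET).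
have [_ _] := stP (enum_rank_in vwE [set v; w]%SET); rewrite enum_rankK_in // => /(_ erefl).
rewrite /edge_coord /src /tgt => ->; rewrite /= mulmxBr mxE [X in _ + X]mxE //.
Qed.

End Rows.

(** * From isostatic frameworks to tightness *)

Section Necessity.
Local Open Scope complex_scope.
Variables (R : realType) (N : 'cV[R]_2 -> R) (A : 'M[R]_2).
Hypothesis A_unit : A \in unitmx.
Hypothesis NE : forall x, N x = `|(A *m x) 0 0| + `|(A *m x) 1 0|.
Variables (V : finType) (E : {set {set V}}) (theta : bool -> {perm V}).
Variable rep : vertex_orbit theta -> V.
Hypothesis V_nonempty : (0 < #|V|)%N.
Hypothesis G_simple : simple_graph E.
Hypothesis G_sym : Z2_symmetric E theta.
Hypothesis G_free : free_on_edges E theta.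
Hypothesis rep_in : forall O : vertex_orbit theta, rep O \in val O.

Section Placement.
Variables (tau : bool -> 'M[R]_2) (p : 'M[R]_(2, #|V|)).
Hypothesis tau0 : tau false = 1%:M.
Hypothesis p_sym : C2_symmetric theta tau p.

(** For the half-turn the signs of [chi1] and of [tau] cancel. *)
Lemma X_chi1P x : X_chi1 theta tau x <-> forall g v, Defs.point x (theta g v) = Defs.point x v.
Proof.
have [_ tau1] := p_sym.
have E0 (y : 'cV[R[i]]_2) g : chi1 _ g *: (to_complex (tau g) *m y) = y.
  case: g; last by rewrite tau0 /chi1 expr0 scale1r /to_complex map_mx1 mul1mx.
  by rewrite tau1 /chi1 expr1 /to_complex map_mxN map_mx1 mulNmx mul1mx scaleN1r opprK.
by split=> h g v; have := h g v; rewrite E0.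
Qed.

Lemma coord_theta k g v : coord A k p (theta g v) = (-1) ^+ g * coord A k p v.
Proof.
have [ps tau1] := p_sym; rewrite /coord -ps.
case: g; last by rewrite tau0 mul1mx expr0 mul1r.
by rewrite tau1 mulNmx mul1mx mulmxN mxE expr1 mulN1r.
Qed.

Definition edge_diff k v w := coord A k p v - coord A k p w.

Definition edge_class v w : bool := (0 < edge_diff 0 v w) == (0 < edge_diff 1 v w).

Lemma edge_diffC k v w : edge_diff k w v = - edge_diff k v w.
Proof. by rewrite /edge_diff opprB. Qed.

Lemma edge_diff_theta k g v w :
  edge_diff k (theta g v) (theta g w) = (-1) ^+ g * edge_diff k v w.
Proof. by rewrite /edge_diff !coord_theta mulrBr. Qed.

Hypothesis p_wp : forall v w, [set v; w]%SET \in E -> forall k, edge_diff k v w != 0.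

Lemma edge_classC v w : [set v; w]%SET \in E -> edge_class w v = edge_class v w.
Proof.
move=> vwE; have := @pos_sign R (edge_diff 0 v w) (edge_diff 1 v w) true (p_wp vwE 0) (p_wp vwE 1).
by rewrite expr1 !mulN1r -!edge_diffC.
Qed.

Lemma edge_class_theta g v w : [set v; w]%SET \in E ->
  edge_class (theta g v) (theta g w) = edge_class v w.
Proof. by move=> vwE; rewrite /edge_class !edge_diff_theta pos_sign ?p_wp. Qed.

(* [edge_class] descends to the quotient. *)
Lemma edge_class_fibre v w a b : [set v; w]%SET \in E ->
  gedge (orb theta v) (orb theta w) (sgn rep v (+) sgn rep w) = gedge a b (sgn rep v (+) sgn rep w) ->
  edge_class v w = edge_class (rep a) (theta (sgn rep v (+) sgn rep w) (rep b)).
Proof.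
move=> vwE /(edge_fibre G_sym rep_in) /= [g [[vE wE]|[wE vE]]].
  have : [set rep a; theta (sgn rep v (+) sgn rep w) (rep b)]%SET \in E.
    by rewrite -(theta_edge G_sym g) -vE -wE.
  by move/(edge_class_theta g) <-; rewrite -vE -wE.
have : [set rep a; theta (sgn rep v (+) sgn rep w) (rep b)]%SET \in E.
  by rewrite -(theta_edge G_sym g) -vE -wE setUC.
by move/(edge_class_theta g) <-; rewrite -vE -wE (edge_classC vwE).
Qed.

End Placement.

Lemma T_chi1_const (tau : bool -> 'M[R]_2) eta x y : T_chi1 N tau eta -> eta x = eta y.
Proof.
case=> -[n [c [h [hm hE]]]] _; rewrite !hE; apply: eq_bigr => k _.
by rewrite (inf_motion_const A_unit NE x y (hm k)).
Qed.

(** The description of the kernel gives connected classes and surjectivity gives their independence;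
    [trees_tight] turns both into the count. *)
Lemma isostatic_tight (tau : bool -> 'M[R]_2) (p : 'M[R]_(2, #|V|)) :
  representation N tau -> well_positioned N E p -> C2_symmetric theta tau p ->
  chi1_isostatic N E theta tau p -> gain_tight222 (quotient_gain_graph E rep).
Proof.
move=> [tau0 _ _] wp p_sym [ker surj].
have p_wp := well_positioned_coord A_unit NE G_simple wp.
have [_ dE] := complexified_differentialE NE G_simple p_wp.
have /card_gt0P[v0 _] := V_nonempty.
have [s [t stE]] := quotient_ends E rep v0.
set G0 := quotient_gain_graph E rep in s t stE *.
pose src e := rep (s e); pose tgt (e : {set G0} * bool) := theta e.2 (rep (t e)).
pose col e := edge_class p (src e) (tgt e).
have stEE e : e \in gedges G0 -> [set src e; tgt e]%SET \in E.
  by move=> eE; rewrite /src /tgt -(quotient_edge G_sym) -stE.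
have orb_src e : orb theta (src e) = s e by exact: (orb_rep G_sym rep_in).
have orb_tgt e : orb theta (tgt e) = t e by rewrite (orb_theta G_sym) (orb_rep G_sym rep_in).
have sgn_st e : sgn rep (src e) (+) sgn rep (tgt e) = e.2.
  by rewrite (sgn_theta G_sym rep_in) !(sgn_rep G_sym rep_in).
have rowE x v w : [set v; w]%SET \in E -> row_form A p x v w =
    (Num.sg (edge_diff p 0 v w))%:C *
    (class_coord A (edge_class p v w) x v - class_coord A (edge_class p v w) x w).
  by move=> vwE; apply: row_form_class; apply: p_wp.
have Xc x k O v : X_chi1 theta tau x -> orb theta v = O ->
    coord (cA A) k x v = coord (cA A) k x (rep O).
  move=> /(X_chi1P tau0 p_sym) hx <-; rewrite /coord -{1}(sgnP G_sym rep_in v).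
  by rewrite hx.
have sgC (u : R) : u != 0 -> (Num.sg u)%:C != 0 :> R[i].
  by move=> u0; rewrite fmorph_eq0 sgr_eq0.
apply: (@trees_tight R[i] G0 s t col).
- by move=> e eE; rewrite {1}(stE e eE).
- exact: quotient_nonempty V_nonempty.
- move=> i f hf.
  (* The field has [class_coord i] equal to twice [f] and the other [class_coord] zero, so that only
     edges of class [i] test it. Lying in the kernel, it is a constant field. *)
  have [x xP] := coord_build (fun v => f (orb theta v)) (fun v => (-1) ^+ (~~ i) * f (orb theta v))
    (cA_unit A_unit).
  have xX : X_chi1 theta tau x.
    apply/(X_chi1P tau0 p_sym) => g v.
    by apply: coord_inj (cA_unit A_unit) _ _; rewrite !(proj1 (xP _), proj2 (xP _)) (orb_theta G_sym).
  have xd : complexified_differential N E p x = 0.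
    apply/rowP=> j; have /G_simple/eqP/cards2P[v [w [_ e]]] := enum_valP j.
    have vwE : [set v; w]%SET \in E by rewrite -e enum_valP.
    rewrite (dE x j v w e) [RHS]mxE rowE // /class_coord !(proj1 (xP _), proj2 (xP _)).
    have [ei|ei] := eqVneq (edge_class p v w) i; last first.
      have -> : (~~ edge_class p v w) = i by case: (edge_class p v w) (i) ei => [] [].
      rewrite mulrA mulrA -signr_addb addbN addbb /= expr1 !mulN1r !subrr.
      by rewrite mulr0.
    have eE := vwE; rewrite (lift_edge G_sym rep_in) in eE.
    suff -> : f (orb theta v) = f (orb theta w) by rewrite subrr mulr0.
    have se := stE _ eE; rewrite [_.2]/= in se.
    have := hf _ eE; rewrite /col /src /tgt [_.2]/=.
    rewrite -(edge_class_fibre tau0 p_sym p_wp vwE se) => /(_ ei).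
    by case: se => /set2_eq[[<- <-]|[<- <-]].
  have : [set x | X_chi1 theta tau x /\ complexified_differential N E p x = 0]%classic x.
    by [].
  rewrite ker => -[eta /= eT etaE] u w.
  have pt v v' : coord (cA A) 0 x v = coord (cA A) 0 x v'.
    rewrite /coord; congr ((_ *m _) _ _); apply/colP=> r; rewrite -etaE !mxE !enum_rankK.
    by rewrite (T_chi1_const _ (Defs.point p v') eT).
  have fO O : f O = coord (cA A) 0 x (rep O).
    by rewrite (proj1 (xP _)) (orb_rep G_sym rep_in).
  by rewrite !fO; apply: pt.
- move=> e0 e0E; set v0' := src e0; set w0' := tgt e0.
  have vwE : [set v0'; w0']%SET \in E by apply: stEE.
  pose sig0 : R[i] := (Num.sg (edge_diff p 0 v0' w0'))%:C.
  (* The indicator of one lift of [e0], made antisymmetric as [Y_chi1] demands; [sig0] cancels the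
     sign in the row of this lift, so that the difference becomes exactly 1. *)
  pose y : 'rV[R[i]]_#|E| := \row_j (sig0 * ((enum_val j == [set v0'; w0']%SET)%:R -
     (enum_val j == [set theta true v0'; theta true w0']%SET)%:R)).
  have yY : Y_chi1 theta y.
    move=> g j k jk; rewrite !mxE jk; case: g jk => _; rewrite /chi1.
      have tE (a b : {set V}) : (theta true @: a == b) = (a == theta true @: b).
        apply/eqP/eqP => [<-|->]; rewrite -imset_comp imset_id_in // => v _ /=;
          exact: (thetaK G_sym).
      rewrite !tE !theta_set2 !(thetaK G_sym) expr1 mulN1r -mulrN opprB //.
    rewrite expr0 mul1r (imset_id_in (f := theta false)) // => v _.
    exact: (theta_id G_sym).
  have [x xX xy] := surj y yY.
  exists (fun O => class_coord A (col e0) x (rep O)) => e eE ce.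
  have vwE' := stEE e eE.
  have := dE x (enum_rank_in vwE' [set src e; tgt e]%SET) (src e) (tgt e).
  rewrite enum_rankK_in // => /(_ erefl); rewrite xy mxE enum_rankK_in // rowE //.
  rewrite -/(col e) ce.
  have cc v O : orb theta v = O -> class_coord A (col e0) x v = class_coord A (col e0) x (rep O).
    by move=> vO; rewrite /class_coord !(Xc x _ O v xX vO).
  rewrite (cc _ _ (orb_src e)) (cc _ _ (orb_tgt e)).
  have eP v w : [set src e; tgt e]%SET = [set v; w]%SET ->
      e = gedge (orb theta v) (orb theta w) (sgn rep v (+) sgn rep w).
    by move/(edge_proj rep) <-; rewrite orb_src orb_tgt sgn_st -stE.
  have [ee|ne] := eqVneq e e0.
    rewrite ee -/v0' -/w0' !eqxx -theta_set2 eq_sym.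
    rewrite (negPf (G_free (g := true) isT vwE)) subr0 mulr1 -/sig0 => /esym/eqP.
    rewrite -[X in _ == X]mulr1 -subr_eq0 -mulrBr mulf_eq0 (negPf (sgC _ (p_wp _ _ vwE 0))) /=.
    by rewrite subr_eq0 => /eqP.
  rewrite (_ : _ == _ = false); last first.
    apply/eqP => /eP ee; case/eqP: ne; rewrite ee /v0' /w0'.
    by rewrite orb_src orb_tgt sgn_st -stE.
  rewrite (_ : _ == _ = false); last first.
    apply/eqP => /eP ee; case/eqP: ne; rewrite ee.
    rewrite (orb_theta G_sym true v0') (orb_theta G_sym true w0').
    rewrite (sgn_theta G_sym rep_in true v0') (sgn_theta G_sym rep_in true w0').
    by rewrite addbACA addbb addbF /v0' /w0' orb_src orb_tgt sgn_st -stE.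
  rewrite subrr mulr0 => /esym/eqP; rewrite mulf_eq0 (negPf (sgC _ (p_wp _ _ vwE' 0))) /=.
  by move/eqP.
Qed.

End Necessity.

(** * From connected colour classes to isostatic frameworks *)

Section Sufficiency.
Local Open Scope complex_scope.
Variables (R : realType) (N : 'cV[R]_2 -> R) (A : 'M[R]_2).
Hypothesis N_norm : is_norm N.
Hypothesis A_unit : A \in unitmx.
Hypothesis NE : forall x, N x = `|(A *m x) 0 0| + `|(A *m x) 1 0|.
Variables (V : finType) (E : {set {set V}}) (theta : bool -> {perm V}).
Variable rep : vertex_orbit theta -> V.
Hypothesis V_nonempty : (0 < #|V|)%N.
Hypothesis G_simple : simple_graph E.
Hypothesis G_sym : Z2_symmetric E theta.
Hypothesis G_free : free_on_edges E theta.
Hypothesis rep_in : forall O : vertex_orbit theta, rep O \in val O.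

Lemma inf_motion_complex (k : 'cV[R[i]]_2) : complex_inf_motion N (fun=> k).
Proof.
exists 2%N, (fun j : 'I_2 => if j == 0 then 1 else 'i),
  (fun j _ => if j == 0 then map_mx (@complex.Re R) k else map_mx (@complex.Im R) k).
split=> [j|x]; first by case: (j == 0); apply: inf_motion_translation.
by rewrite sum2 /= scale1r; apply/colP=> r; rewrite !mxE -complexE.
Qed.

Lemma realizable_isostatic : realizable R (quotient_gain_graph E rep) ->
  exists (tau : bool -> 'M[R]_2) (p : 'M[R]_(2, #|V|)),
    [/\ representation N tau, realisation p, well_positioned N E p,
        C2_symmetric theta tau p & chi1_isostatic N E theta tau p].
Proof.
set G0 := quotient_gain_graph E rep; case=> sG cG [c [d [gc gd cn]]].
have [_ NZ _] := N_norm.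
pose tau (g : bool) : 'M[R]_2 := ((-1) ^+ g)%:M.
have tau0 : tau false = 1%:M by rewrite /tau expr0.
(* The two coordinates on the gain graph are used as l^1 coordinates of the representatives and
   continued by the half-turn. *)
have [p pE] := coord_build (fun v => (-1) ^+ sgn rep v * c (orb theta v))
  (fun v => (-1) ^+ sgn rep v * d (orb theta v)) A_unit.
have p_sym : C2_symmetric theta tau p.
  split=> [g v|]; last by rewrite /tau expr1 raddfN.
  have cE k : coord A k p (theta g v) = (-1) ^+ g * coord A k p v.
    by case: (ord2 k) => ->; rewrite !(proj1 (pE _), proj2 (pE _)) (orb_theta G_sym)
      (sgn_theta G_sym rep_in) signr_addb mulrA [_ ^+ g * _]mulrC.
  rewrite mul_scalar_mx -(mulKmx A_unit (Defs.point p (theta g v))).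
  rewrite -[Defs.point p v in LHS](mulKmx A_unit) scalemxAr; congr (_ *m _).
  by apply: col2_eq; rewrite [LHS]mxE; apply/esym/cE.
have difE v w :
    edge_diff A p 0 v w = (-1) ^+ sgn rep v *
      dif c (orb theta v) (orb theta w) (sgn rep v (+) sgn rep w) /\
    edge_diff A p 1 v w = (-1) ^+ sgn rep v *
      dif d (orb theta v) (orb theta w) (sgn rep v (+) sgn rep w).
  rewrite /edge_diff !(proj1 (pE _), proj2 (pE _)) /dif.
  by rewrite !mulrBr !mulrA -!signr_addb !addbA !addbb !addFb.
have neq_dif v w : v != w -> (orb theta v != orb theta w) || (sgn rep v (+) sgn rep w).
  apply: contraR; rewrite negb_or negbK => /andP[/eqP oo].
  by rewrite -negb_eqb negbK => /eqP ss; rewrite -(sgnP G_sym rep_in v) oo ss (sgnP G_sym rep_in).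
have p_wp v w : [set v; w]%SET \in E -> forall k, edge_diff A p k v w != 0.
  move=> vwE k; have vw : v != w by have := G_simple vwE; rewrite cards2; case: (v != w).
  have nd := neq_dif v w vw.
  by case: (ord2 k) => ->; rewrite ?(difE v w).1 ?(difE v w).2 mulf_neq0 ?signr_eq0 ?gc ?gd.
have [wp dE] := complexified_differentialE NE G_simple p_wp.
exists tau, p; split=> //.
- split=> //.
  + by move=> g h; rewrite /tau -scalar_mxM -signr_addb.
  + by move=> g x; rewrite mul_scalar_mx NZ normrX normrN1 expr1n mul1r.
- move=> v w vw; apply/eqP/contraT => /neq_dif nd.
  have := gc _ _ _ nd; have := (difE v w).1; rewrite /edge_diff /coord vw subrr => /esym/eqP.
  by rewrite mulf_eq0 signr_eq0 /= => ->.
have classE v w : [set v; w]%SET \in E -> edge_class A p v w =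
    colour c d (orb theta v) (orb theta w) (sgn rep v (+) sgn rep w).
  move=> vwE; have vw : v != w by have := G_simple vwE; rewrite cards2; case: (v != w).
  have nd := neq_dif v w vw.
  by rewrite /edge_class (difE v w).1 (difE v w).2 pos_sign ?gc ?gd.
have rowE x v w : [set v; w]%SET \in E -> row_form A p x v w =
    (Num.sg (edge_diff A p 0 v w))%:C *
    (class_coord A (edge_class A p v w) x v - class_coord A (edge_class A p v w) x w).
  by move=> vwE; apply: row_form_class; apply: p_wp.
have sgC (u : R) : u != 0 -> (Num.sg u)%:C != 0 :> R[i].
  by move=> u0; rewrite fmorph_eq0 sgr_eq0.
have XP := X_chi1P tau0 p_sym.
have rowj x j : exists v w, [/\ enum_val j = [set v; w]%SET, [set v; w]%SET \in E &
    complexified_differential N E p x 0 j = row_form A p x v w].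
  have /G_simple/eqP/cards2P[v [w [_ e]]] := enum_valP j.
  by exists v, w; split=> //; [rewrite -e enum_valP|rewrite (dE x j v w e)].
split.
- apply/seteqP; split=> [x [xX xd]|x [eta [etaI etaX] <-]] /=.
    have Xc k v : coord (cA A) k x v = coord (cA A) k x (rep (orb theta v)).
      by rewrite /coord -{1}(sgnP G_sym rep_in v) ((XP x).1 xX).
    have cc i v : class_coord A i x v = class_coord A i x (rep (orb theta v)).
      by rewrite /class_coord !(Xc _ v).
    have hc i u w : class_coord A i x (rep u) = class_coord A i x (rep w).
      (* Testing equality with one value turns a complex function into a two-valued one, as
         [colour_connected] asks. *)
      pose h u' := class_coord A i x (rep u') == class_coord A i x (rep u).
      suff : h u = h w by rewrite /h eqxx => /esym/eqP.
      apply: (cn i h) => {w}a b g abE ci; rewrite /h; congr (_ == _).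
      have vwE := abE; rewrite (quotient_edge G_sym) in vwE.
      have := dE x (enum_rank_in vwE [set rep a; theta g (rep b)]%SET) _ _ (enum_rankK_in vwE vwE).
      rewrite xd mxE rowE // classE // (orb_theta G_sym) (sgn_theta G_sym rep_in).
      rewrite !(orb_rep G_sym rep_in) !(sgn_rep G_sym rep_in) /= ci => /esym/eqP.
      rewrite mulf_eq0 (negPf (sgC _ (p_wp _ _ vwE 0))) /= subr_eq0 => /eqP ->.
      by rewrite cc (orb_theta G_sym) (orb_rep G_sym rep_in).
    have pc v w : Defs.point x v = Defs.point x w.
      have e i : class_coord A i x v = class_coord A i x w by rewrite cc [RHS]cc; apply: hc.
      have := e true; have := e false; rewrite /class_coord /= expr0 expr1.
      set f := coord (cA A) => e1 e2.
      have two : (2 : R[i]) != 0 by rewrite pnatr_eq0.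
      have f0 : f 0 x v = f 0 x w.
        apply: (mulfI two); transitivity ((f 0 x v + -1 * f 1 x v) + (f 0 x v + 1 * f 1 x v)).
          ring.
        by rewrite e1 e2; ring.
      have f1 : f 1 x v = f 1 x w by move: e2; rewrite f0 !mul1r => /addrI.
      exact: coord_inj (cA_unit A_unit) f0 f1.
    have /card_gt0P[v0 _] := V_nonempty.
    exists (fun=> Defs.point x v0); last first.
      apply/matrixP=> r j; rewrite mxE (pc v0 (enum_val j)) mxE.
      by rewrite enum_valK.
    split; first exact: inf_motion_complex.
    move=> g _; rewrite /tau /to_complex map_scalar_mx mul_scalar_mx scalerA.
    by rewrite /chi1 rmorphXn rmorphN1 -signr_addb addbb expr0 scale1r.
  have et y z : eta y = eta z.
    by case: etaI => n [k [h [hm hE]]]; rewrite !hE; apply: eq_bigr => l _;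
      rewrite (inf_motion_const A_unit NE y z (hm l)).
  have pc v w : Defs.point (rho_chi1 p eta) v = Defs.point (rho_chi1 p eta) w.
    by apply/colP=> r; rewrite !mxE (et _ (Defs.point p (enum_val (enum_rank w)))).
  split; first by apply/XP => g v; apply: pc.
  apply/rowP=> j; have [v [w [_ vwE ->]]] := rowj (rho_chi1 p eta) j.
  by rewrite mxE rowE // /class_coord /coord (pc v w) subrr mulr0.
- move=> y yY.
  have /card_gt0P[v0 _] := V_nonempty.
  have [s [t stE]] := quotient_ends E rep v0; rewrite -/G0 in s t stE.
  pose yf e : R[i] := if [pick j : 'I_#|E| | enum_val j == e] is Some j then y 0 j else 0.
  have yfE j : y 0 j = yf (enum_val j).
    rewrite /yf; case: pickP => [k /eqP/enum_val_inj-> //|/(_ j)].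
    by rewrite eqxx.
  have yf_theta g v w : [set v; w]%SET \in E ->
      yf [set theta g v; theta g w]%SET = (-1) ^+ g * yf [set v; w]%SET.
    move=> vwE; have tE : [set theta g v; theta g w]%SET \in E by rewrite (theta_edge G_sym).
    have := yY g (enum_rank_in vwE [set v; w]%SET)
      (enum_rank_in tE [set theta g v; theta g w]%SET).
    by rewrite !yfE !enum_rankK_in // theta_set2 => /(_ erefl).
  pose src e := rep (s e); pose tgt (e : {set G0} * bool) := theta e.2 (rep (t e)).
  pose col e := edge_class A p (src e) (tgt e).
  (* The prescribed value divided by the sign in the row of the chosen lift; a sign is its own
     inverse. *)
  pose Z e := (Num.sg (edge_diff A p 0 (src e) (tgt e)))%:C * yf [set src e; tgt e]%SET.
  have cc i : connected_class R[i] s t col i.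
    move=> f hf u w; apply/eqP; pose h u' := f u' == f w.
    suff : h u = h w by rewrite /h eqxx.
    apply: (cn i h) => a b g abE ci; rewrite /h; congr (_ == _).
    have vwE := abE; rewrite (quotient_edge G_sym) in vwE.
    have se := stE _ abE; rewrite [_.2]/= in se.
    have ce : col (gedge a b g) = i.
      rewrite /col /src /tgt [_.2]/= -ci.
      have := classE _ _ vwE; rewrite (orb_theta G_sym) (sgn_theta G_sym rep_in).
      rewrite !(orb_rep G_sym rep_in) !(sgn_rep G_sym rep_in) /= => <-.
      have := @edge_class_fibre R A V E theta rep G_sym rep_in tau p tau0 p_sym p_wp
        (rep a) (theta g (rep b)) (s (gedge a b g)) (t (gedge a b g)) vwE.
      rewrite (orb_theta G_sym) (sgn_theta G_sym rep_in).
      rewrite !(orb_rep G_sym rep_in) !(sgn_rep G_sym rep_in) /= => -> //.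
    have := hf _ abE ce; case: se => /set2_eq[[<- <-]|[<- <-]] //.
  have [h1 h1P] := @connected_class_solve _ _ s t col true cc cG Z.
  have [h0 h0P] := @connected_class_solve _ _ s t col false cc cG Z.
  pose h i := if i then h1 else h0.
  have hP i e : e \in gedges G0 -> col e = i -> h i (s e) - h i (t e) = Z e.
    by case: i => /=; [apply: h1P|apply: h0P].
  (* Half-sum and half-difference, so that the sum of the coordinates is [h1] and their difference
     [h0]. *)
  have [x xE] := coord_build (fun v => (h1 (orb theta v) + h0 (orb theta v)) / 2)
    (fun v => (h1 (orb theta v) - h0 (orb theta v)) / 2) (cA_unit A_unit).
  have two : (2 : R[i]) != 0 by rewrite pnatr_eq0.
  have xc i v : class_coord A i x v = h i (orb theta v).
    rewrite /class_coord (xE v).1 (xE v).2 /h.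
    by case: i; rewrite /= ?expr0 ?expr1 ?mul1r ?mulN1r; field.
  have xX : X_chi1 theta tau x.
    apply/XP => g v; apply: coord_inj (cA_unit A_unit) _ _;
      by rewrite !(proj1 (xE _), proj2 (xE _)) (orb_theta G_sym).
  exists x => //; apply/rowP=> j; have [v [w [jE vwE ->]]] := rowj x j.
  rewrite yfE jE rowE // !xc.
  have eE := vwE; rewrite (lift_edge G_sym rep_in) -/G0 in eE.
  have se := stE _ eE; rewrite [_.2]/= in se.
  set e := gedge _ _ _ in eE se.
  have ce := edge_class_fibre G_sym rep_in tau0 p_sym p_wp vwE se.
  have he := hP (edge_class A p v w) e eE (esym ce).
  have sE : [set src e; tgt e]%SET \in E by rewrite -(quotient_edge G_sym) -/G0 -stE.
  have sg2 v' w' : [set v'; w']%SET \in E -> (Num.sg (edge_diff A p 0 v' w'))%:C *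
      (Num.sg (edge_diff A p 0 v' w'))%:C = 1 :> R[i].
    by move=> /p_wp/(_ 0) n0; rewrite -rmorphM /= -expr2 sqr_sg n0 rmorph1.
  have sgt g v' w' : (Num.sg (edge_diff A p 0 (theta g v') (theta g w')))%:C =
      (-1) ^+ g * (Num.sg (edge_diff A p 0 v' w'))%:C :> R[i].
    rewrite (edge_diff_theta A tau0 p_sym) sgrM rmorphM /=; congr (_ * _).
    by case: g; rewrite ?expr0 ?expr1 ?sgrN sgr1 ?rmorphN /= rmorph1.
  (* Under [theta g] the sign of the row and the prescribed value change by the same factor, so
     solving the equation on one lift solves it on both. *)
  have key g v' w' : v' = theta g (src e) -> w' = theta g (tgt e) ->
      (Num.sg (edge_diff A p 0 v' w'))%:C * Z e = yf [set v'; w']%SET.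
    move=> -> ->; rewrite sgt yf_theta // /Z -mulrA; congr (_ * _).
    by rewrite mulrA sg2 // mul1r.
  have [g fib] := edge_fibre G_sym rep_in se.
  case: fib => -[vE wE].
    rewrite -(key g v w vE wE) -he; congr (_ * (h _ _ - h _ _)).
      by rewrite vE (orb_theta G_sym) (orb_rep G_sym rep_in).
    by rewrite wE !(orb_theta G_sym) (orb_rep G_sym rep_in).
  rewrite setUC -(key g w v vE wE) -he edge_diffC sgrN rmorphN mulNr -mulrN opprB.
  congr (_ * (h _ _ - h _ _)).
    by rewrite vE (orb_theta G_sym) (orb_rep G_sym rep_in).
  by rewrite wE !(orb_theta G_sym) (orb_rep G_sym rep_in).
Qed.

End Sufficiency.

Theorem theorem4p9 (R : realType) (N : 'cV[R]_2 -> R)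
    (V : finType) (E : {set {set V}}) (theta : bool -> {perm V})
    (rep : vertex_orbit theta -> V)
    (N_norm : is_norm N)
    (N_quad : quadrilateral (closed_unit_ball N))
    (V_nonempty : (0 < #|V|)%N)
    (G_simple : simple_graph E)
    (G_sym : Z2_symmetric E theta)
    (G_free : free_on_edges E theta)
    (rep_in : forall O : vertex_orbit theta, rep O \in val O) :
  let G0 := quotient_gain_graph E rep in
  ((exists (tau : bool -> 'M[R]_2) (p : 'M[R]_(2, #|V|)),
      [/\ representation N tau,
          realisation p,
          well_positioned N E p,
          C2_symmetric theta tau p &
          chi1_isostatic N E theta tau p])
   <-> gain_tight222 G0) /\
  (gain_tight222 G0 <-> constructible G0).
Proof.
move=> G0; have [A A_unit NE] := quadrilateral_norm N_norm N_quad.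
have tight_con : gain_tight222 G0 -> constructible G0.
  exact: tight222_constructible (quotient_simple G_simple G_sym G_free).
have con_iso : constructible G0 -> exists (tau : bool -> 'M[R]_2) (p : 'M[R]_(2, #|V|)),
    [/\ representation N tau, realisation p, well_positioned N E p,
        C2_symmetric theta tau p & chi1_isostatic N E theta tau p].
  move/(@constructible_realizable R).
  exact: (realizable_isostatic N_norm A_unit NE V_nonempty G_simple G_sym rep_in).
have iso_tight : (exists (tau : bool -> 'M[R]_2) (p : 'M[R]_(2, #|V|)),
    [/\ representation N tau, realisation p, well_positioned N E p,
        C2_symmetric theta tau p & chi1_isostatic N E theta tau p]) -> gain_tight222 G0.
  move=> [tau [p [tau_rep _ wp p_sym iso]]].
  exact: (isostatic_tight A_unit NE V_nonempty G_simple G_sym G_free rep_in tau_rep wp p_sym iso).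
split; split=> //.
- by move/tight_con/con_iso.
- by move/con_iso/iso_tight.
Qed.
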